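(* Let $\Gamma$ be a smooth tropical $(3,3)$-curve and let $\Omega$ be a tritangent class of $\Gamma$ with bounded subcomplex $\Omega^b$. The support of $\Omega^b$ is a strong deformation retract of the support $|\Omega|$ of $\Omega$. In particular, it is connected when viewed as a subset of $\mathbb{R}^3$ with the induced subspace topology.
   Context: Max convention. A smooth tropical $(3,3)$-curve $\Gamma\subset\mathbb{R}^2$ is the corner locus of a tropical polynomial $\max_{0\le i,j\le 3}(c_{ij}+ix+jy)$ with $c_{ij}\in\mathbb{R}$, whose dual (Newton) subdivision of $[0,3]^2$ is a unimodular triangulation. A tropical $(1,1)$-curve $\Lambda$ (with Newton polytope the full unit square) is encoded by a point $(v_0,l)\in\mathbb{R}^2\times\mathbb{R}=\mathbb{R}^3$: $v_0$ is its lowest vertex and $l$ the signed length of its bounded edge. If $l>0$ the other vertex is $v_1=v_0+l(1,1)$, the edge is $[v_0,v_1]$, and the legs are the rays from $v_0$ in directions $(-1,0),(0,-1)$ and from $v_1$ in directions $(1,0),(0,1)$. If $l<0$ then $v_1=v_0-l(-1,1)$, the edge is $[v_0,v_1]$, and the legs are the rays from $v_0$ in directions $(1,0),(0,-1)$ and from $v_1$ in directions $(-1,0),(0,1)$. If $l=0$ then $v_0=v_1$ and the four legs emanate from it. $\Lambda$ is tritangent to $\Gamma$ if the connected components of $\Lambda\cap\Gamma$ have total stable intersection multiplicities $(2,2,2)$, or $(2,4)$, or $(6)$. A tritangent class $\Omega$ of $\Gamma$ is a connected component of the set of all $(v_0,l)\in\mathbb{R}^3$ encoding tropical $(1,1)$-curves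 tritangent to $\Gamma$. It is the support of a polyhedral complex, and it is endowed with a polyhedral structure compatible with $\Gamma$: for each cell $\mathscr{C}$, as $(v_0,l)$ varies in the relative interior $\mathscr{C}^\circ$, each of $v_0$, $v_1$ stays in a fixed relatively open cell of the polyhedral decomposition of $\mathbb{R}^2$ induced by $\Gamma$. Bounded subcomplex. For a lattice point $(i,j)\in[0,3]^2$, $(i,j)^\vee$ is the open component of $\mathbb{R}^2\smallsetminus\Gamma$ where the term $c_{ij}+ix+jy$ is the unique maximum. For $v\in\mathbb{R}^2$, $v^\vee$ is the cell of the Newton subdivision dual to the relatively open cell of the decomposition containing $v$. $\Omega^b$ is obtained from $\Omega$ by removing all cells $\mathscr{C}$ such that some (equivalently every) $(v_0,l)\in\mathscr{C}^\circ$ satisfies one of: (U1) $l>0$ and $v_0\in(0,0)^\vee$; (U2) $l>0$ and $v_1\in(3,3)^\vee$; (U3) $l<0$ and $v_0\in(3,0)^\vee$; (U4) $l<0$ and $v_1\in(0,3)^\vee$; (R1) $l>0$, $v_0^\vee\supseteq\{(1,0),(0,1)\}$ and $(i,2-i)\notin v_0^\vee$ for $i=0,1,2$; (R2) $l<0$, $v_0^\vee\supseteq\{(2,0),(3,1)\}$ and $(1+i,i)\notin v_0^\vee$ for $i=0,1,2$; (R3) $l>0$, $v_1^\vee\supseteq\{(2,3),(3,2)\}$ and $(1+i,3-i)\notin v_1^\vee$ for $i=0,1,2$; (R4) $l<0$, $v_1^\vee\supseteq\{(0,2),(1,3)\}$ and $(i,1+i)\notin v_1^\vee$ for $i=0,1,2$.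 *)

(* Defs.v *)
From HB Require Import structures.
From mathcomp Require Import all_boot all_order all_algebra.
From mathcomp Require Import all_classical all_reals all_analysis.
Set Implicit Arguments.
Unset Strict Implicit.
Unset Printing Implicit Defensive.
Import Order.TTheory GRing.Theory Num.Theory.
Import numFieldNormedType.Exports.
Local Open Scope classical_set_scope.
Local Open Scope ring_scope.

(* Points of the plane are pairs [R * R]; a tropical (1,1)-curve (v_0, l) is a
   point of [R * R * R].  The lattice points of the square [0,3]^2 are
   ['I_4 * 'I_4]. *)

Definition trop_term (R : realType) (c : 'I_4 -> 'I_4 -> R)
    (a : 'I_4 * 'I_4) (v : R * R) : R :=
  c a.1 a.2 + a.1%:R * v.1 + a.2%:R * v.2.

(* The relatively open cells of the decomposition of the plane induced by the
   curve are the nonempty fibres of [argmax c]. *)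
Definition argmax (R : realType) (c : 'I_4 -> 'I_4 -> R) (v : R * R) :
    {set 'I_4 * 'I_4} :=
  [set a | [forall b, trop_term c b v <= trop_term c a v]]%SET.

Definition corner_locus (R : realType) (c : 'I_4 -> 'I_4 -> R) : set (R * R) :=
  [set v | (1 < #|argmax c v|)%N].

(* The region (i,j)^\vee, for a = (i,j). *)
Definition region (R : realType) (c : 'I_4 -> 'I_4 -> R) (a : 'I_4 * 'I_4) :
    set (R * R) :=
  [set v | argmax c v = [set a]%SET].

Definition lattice_point (R : realType) (i j : nat) : R * R := (i%:R, j%:R).
Arguments lattice_point {R} i j.

Definition lattice_hull (R : realType) (S : {set 'I_4 * 'I_4}) : set (R * R) :=
  [set p | exists w : 'I_4 * 'I_4 -> R,
    [/\ forall a, 0 <= w a,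
        forall a, a \notin S -> w a = 0,
        \sum_a w a = 1 &
        p = (\sum_a w a * a.1%:R, \sum_a w a * a.2%:R)]].
Arguments lattice_hull R S : clear implicits.

(* The cell v^\vee of the Newton subdivision, as a polytope. *)
Definition dual_cell (R : realType) (c : 'I_4 -> 'I_4 -> R) (v : R * R) :
    set (R * R) :=
  lattice_hull R (argmax c v).

Definition det2 (u v : int * int) : int := u.1 * v.2 - u.2 * v.1.

Definition unimodular_triangle (T : {set 'I_4 * 'I_4}) : Prop :=
  exists p q r : 'I_4 * 'I_4, T = [set p; q; r]%SET /\
    absz (det2 (q.1%:Z - p.1%:Z, q.2%:Z - p.2%:Z)
               (r.1%:Z - p.1%:Z, r.2%:Z - p.2%:Z)) = 1%N.

(* Every cell of the Newton subdivision is a face of a lattice triangle of area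
   1/2, i.e. a simplex whose vertices are part of an affine basis of Z^2. *)
Definition smooth_curve (R : realType) (c : 'I_4 -> 'I_4 -> R) : Prop :=
  forall v : R * R, exists T S : {set 'I_4 * 'I_4},
    [/\ unimodular_triangle T, S \subset T & dual_cell c v = lattice_hull R S].

Definition ray (R : realType) (v d : R * R) : set (R * R) :=
  [set p | exists2 t : R, 0 <= t & p = (v.1 + t * d.1, v.2 + t * d.2)].

Definition segment (R : realType) (v w : R * R) : set (R * R) :=
  [set p | exists2 t : R, 0 <= t <= 1 &
     p = (v.1 + t * (w.1 - v.1), v.2 + t * (w.2 - v.2))].

Definition vertex0 (R : realType) (z : R * R * R) : R * R := z.1.

Definition vertex1 (R : realType) (z : R * R * R) : R * R :=
  if 0 <= z.2 then (z.1.1 + z.2, z.1.2 + z.2) else (z.1.1 + z.2, z.1.2 - z.2).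

Definition curve11 (R : realType) (z : R * R * R) : set (R * R) :=
  let v0 := vertex0 z in
  let v1 := vertex1 z in
  segment v0 v1 `|`
  if 0 <= z.2 then
    ray v0 (-1, 0) `|` ray v0 (0, -1) `|` ray v1 (1, 0) `|` ray v1 (0, 1)
  else
    ray v0 (1, 0) `|` ray v0 (0, -1) `|` ray v1 (-1, 0) `|` ray v1 (0, 1).

(* The primitive integer vectors spanning the rays of the star of C at p. *)
Definition star_rays (R : realType) (C : set (R * R)) (p : R * R) :
    set (int * int) :=
  [set u | coprimez u.1 u.2 /\
     \forall t \near (0 : R)^'+, C (p.1 + t * u.1%:~R, p.2 + t * u.2%:~R)].

(* Stable intersection multiplicity at p of two tropical curves all of whose
   edges have weight 1, by the fan displacement rule: the star of D at p is
   translated by a generic vector, and the lattice indices |det (u, v)| of the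
   pairs of rays that then meet are added up.  The sum does not depend on the
   generic vector; (1, sqrt 2) is generic for any two rational fans because its
   slope is irrational. *)
Definition displaced_rays_meet (R : realType) (u v : int * int) : Prop :=
  exists s t : R, [/\ 0 <= s, 0 <= t,
    s * u.1%:~R = 1 + t * v.1%:~R & s * u.2%:~R = Num.sqrt 2 + t * v.2%:~R].

Definition stable_mult (R : realType) (C D : set (R * R)) (p : R * R) : nat :=
  \sum_(uv \in [set uv : (int * int) * (int * int) |
      [/\ star_rays C p uv.1, star_rays D p uv.2 &
          displaced_rays_meet R uv.1 uv.2]])
    absz (det2 uv.1 uv.2).

Definition total_stable_mult (R : realType) (C D K : set (R * R)) : nat :=
  \sum_(p \in K) stable_mult C D p.

Definition components (T : topologicalType) (A : set T) : set (set T) :=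
  [set connected_component A x | x in A].

(* The list [Ks] enumerates the connected components in any order. *)
Definition tritangent (R : realType) (c : 'I_4 -> 'I_4 -> R) (z : R * R * R) :
    Prop :=
  exists Ks : seq (set (R * R)),
    [/\ uniq Ks,
        [set` Ks] = components (curve11 z `&` corner_locus c) &
        [seq total_stable_mult (corner_locus c) (curve11 z) K | K <- Ks]
          \in [:: [:: 2; 2; 2]; [:: 2; 4]; [:: 6]]%N].

Definition tritangent_class (R : realType) (c : 'I_4 -> 'I_4 -> R)
    (Omega : set (R * R * R)) : Prop :=
  components [set z | tritangent c z] Omega.

Definition dot3 (R : realType) (a z : R * R * R) : R :=
  a.1.1 * z.1.1 + a.1.2 * z.1.2 + a.2 * z.2.

Definition polyhedron (R : realType) (C : set (R * R * R)) : Prop :=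
  exists s : seq ((R * R * R) * R),
    C = [set z | forall h, h \in s -> dot3 h.1 z <= h.2].

(* Nonempty faces; [a = 0] gives C itself. *)
Definition is_face (R : realType) (F C : set (R * R * R)) : Prop :=
  F !=set0 /\ exists a : R * R * R, exists b : R,
    (forall z, C z -> dot3 a z <= b) /\ F = C `&` [set z | dot3 a z = b].

Definition polyhedral_complex (R : realType) (P : set (set (R * R * R))) :
    Prop :=
  [/\ finite_set P,
      forall C, P C -> C !=set0 /\ polyhedron C,
      forall C F, P C -> is_face F C -> P F &
      forall C C', P C -> P C' -> C `&` C' !=set0 ->
        is_face (C `&` C') C /\ is_face (C `&` C') C'].

Definition complex_support (R : realType) (P : set (set (R * R * R))) :
    set (R * R * R) :=
  \bigcup_(C in P) C.

(* In R^3 the affine hull is the intersection of the hyperplanes containing the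
   set ([a = 0], [b = 0] gives the whole space). *)
Definition affine_hull (R : realType) (C : set (R * R * R)) :
    set (R * R * R) :=
  [set z | forall (a : R * R * R) (b : R),
     (forall y, C y -> dot3 a y = b) -> dot3 a z = b].

Definition rel_interior (R : realType) (C : set (R * R * R)) :
    set (R * R * R) :=
  [set z | C z /\ \forall y \near z, affine_hull C y -> C y].

Definition compatible (R : realType) (c : 'I_4 -> 'I_4 -> R)
    (P : set (set (R * R * R))) : Prop :=
  forall C, P C -> forall z z', rel_interior C z -> rel_interior C z' ->
    argmax c (vertex0 z) = argmax c (vertex0 z') /\
    argmax c (vertex1 z) = argmax c (vertex1 z').

(* (U1)--(U4) *)
Definition removedU (R : realType) (c : 'I_4 -> 'I_4 -> R) (z : R * R * R) :
    Prop :=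
  [\/ 0 < z.2 /\ region c (ord0, ord0) (vertex0 z),
      0 < z.2 /\ region c (ord_max, ord_max) (vertex1 z),
      z.2 < 0 /\ region c (ord_max, ord0) (vertex0 z) |
      z.2 < 0 /\ region c (ord0, ord_max) (vertex1 z)].

(* (R1)--(R4) *)
Definition removedR (R : realType) (c : 'I_4 -> 'I_4 -> R) (z : R * R * R) :
    Prop :=
  let cell0 := dual_cell c (vertex0 z) in
  let cell1 := dual_cell c (vertex1 z) in
  [\/ [/\ 0 < z.2, cell0 (lattice_point 1 0), cell0 (lattice_point 0 1) &
          forall i, (i <= 2)%N -> ~ cell0 (lattice_point i (2 - i))],
      [/\ z.2 < 0, cell0 (lattice_point 2 0), cell0 (lattice_point 3 1) &
          forall i, (i <= 2)%N -> ~ cell0 (lattice_point (1 + i) i)],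
      [/\ 0 < z.2, cell1 (lattice_point 2 3), cell1 (lattice_point 3 2) &
          forall i, (i <= 2)%N -> ~ cell1 (lattice_point (1 + i) (3 - i))] |
      [/\ z.2 < 0, cell1 (lattice_point 0 2), cell1 (lattice_point 1 3) &
          forall i, (i <= 2)%N -> ~ cell1 (lattice_point i (1 + i))]].

Definition bounded_subcomplex (R : realType) (c : 'I_4 -> 'I_4 -> R)
    (P : set (set (R * R * R))) : set (set (R * R * R)) :=
  [set C | P C /\
     ~ exists2 z, rel_interior C z & removedU c z \/ removedR c z].

Definition strong_deformation_retract (R : realType) (T : topologicalType)
    (A B : set T) : Prop :=
  B `<=` A /\ exists H : R * T -> T,
    [/\ {within [set` `[0, 1]] `*` A, continuous H},
        forall (t : R) x, 0 <= t <= 1 -> A x -> A (H (t, x)),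
        forall x, A x -> H (0, x) = x,
        forall x, A x -> B (H (1, x)) &
        forall (t : R) x, 0 <= t <= 1 -> B x -> H (t, x) = x].
Arguments strong_deformation_retract R {T} A B.

(* Main.v *)
Require Import Defs.
From mathcomp Require Import all_boot all_order all_algebra.
From mathcomp Require Import all_classical all_reals all_analysis.
From mathcomp Require Import lra ring zify.
Import Order.TTheory GRing.Theory Num.Theory.
Import numFieldNormedType.Exports.
Set Implicit Arguments.
Unset Strict Implicit.
Unset Printing Implicit Defensive.
Local Open Scope classical_set_scope.
Local Open Scope ring_scope.

(** Call a curve slidable if [l > 0] and the maximum at [v_0] is attained only among
    the exponents (0,0), (1,0), (0,1); this is an open condition.  For a tritangent curve
    it is equivalent to (U1) or (R1): in every other cell with that property some component
    of the intersection has odd multiplicity.  A slidable curve is moved by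
    (v_0, l) |-> (v_0 + t(1,1), l - t), which shrinks its edge, until the property fails.
    Inside the region (0,0)^\vee nothing changes in the intersection; along the edge
    dual to {(1,0), (0,1)} the part of the intersection behind the moving vertex retracts
    onto it and keeps its multiplicity; at the end points one uses that Omega is closed.
    The stopping time is the minimum of l and a max-min formula in v_0, hence continuous.
    Conjugating by the reflections of the plane gives the flows for (U2)-(U4) and
    (R2)-(R4).  Each flow preserves the complement of the other three open sets, so the
    composition of the four flows retracts Omega onto the set of curves satisfying none
    of the eight conditions, and this set is the support of Omega^b because relative
    interiors of cells are dense. *)

(** * Maximal terms *)

(** The direction (1,1) is that of the edge, so a slide fixes v_1 and all of the curve to the right
    of the moving vertex. Along it the term of exponent (i,j) grows with slope i + j, so (0,0),
    (1,0), (0,1) are exactly the slowest exponents, and leaving them happens once and for all at a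
    computable time. Parity also steers the slide: if it leaves the region (0,0)^\vee before
    stopping, the limit curve is still tritangent, hence (1,0) and (0,1) become maximal at the same
    moment and the motion goes on along their common edge.

    Stable multiplicities are computed with the displacement (1, sqrt 2), which reflections alter;
    therefore all local computations are made for an arbitrary displacement with rationally
    independent coordinates.

    Removal is decided cell by cell, slidability curve by curve. Compatibility fixes the cells of
    v_0 and v_1 on a relative interior but says nothing about the sign of l, and this sign needs an
    argument of its own. *)

Section Argmax.
Variables (R : realType) (c : 'I_4 -> 'I_4 -> R).
Implicit Types (a b : 'I_4 * 'I_4) (v d : R * R) (t : R).

Definition slope d a : R := a.1%:R * d.1 + a.2%:R * d.2.

Lemma trop_term_shift a v t d :
  trop_term c a (v.1 + t * d.1, v.2 + t * d.2) = trop_term c a v + t * slope d a.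
Proof. rewrite /trop_term /slope /=; ring. Qed.

Lemma argmaxP a v :
  reflect (forall b, trop_term c b v <= trop_term c a v) (a \in argmax c v).
Proof. by rewrite inE; apply: (iffP forallP) => h b; apply: h. Qed.

Lemma argmax_ex v : exists a, a \in argmax c v.
Proof.
pose a := [arg max_(a > (ord0, ord0)) trop_term c a v]%O.
exists a; apply/argmaxP => b; rewrite /a.
by case: arg_maxP => //= i _ h; apply: h.
Qed.

Lemma argmax_lt a b v : a \in argmax c v -> b \notin argmax c v ->
  trop_term c b v < trop_term c a v.
Proof.
move=> /argmaxP ha hb; rewrite ltNge; apply: contra hb => hab.
by apply/argmaxP => e; apply: le_trans (ha e) hab.
Qed.

Lemma argmax_eq a b v : a \in argmax c v -> b \in argmax c v ->
  trop_term c a v = trop_term c b v.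
Proof. by move=> /argmaxP ha /argmaxP hb; apply/eqP; rewrite eq_le ha hb. Qed.

Lemma argmax_in a b v : a \in argmax c v ->
  trop_term c b v = trop_term c a v -> b \in argmax c v.
Proof. by move=> /argmaxP ha e; apply/argmaxP => f; rewrite e. Qed.

(** Inclusion becomes a combination of strict inequalities between two terms. This makes it an open
    condition on [v], and along a line a comparison of times. *)
Lemma argmax_subP (L : {set 'I_4 * 'I_4}) v :
  reflect (forall b, b \notin L ->
             exists2 a, a \in L & trop_term c b v < trop_term c a v)
          (argmax c v \subset L).
Proof.
apply: (iffP idP) => [/fintype.subsetP h b bL|h].
  have [a am] := argmax_ex v; exists a; first exact: h.
  by apply: argmax_lt => //; apply: contra bL; apply: h.
apply/fintype.subsetP => b /argmaxP hb; apply/negPn/negP => /h[a _].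
by rewrite ltNge hb.
Qed.

(* The time at which [v + t d] leaves the set of points where the maximum is attained
   only in [L]: at time [t] the terms outside [L] are smaller iff each of them is beaten
   by some term in [L], whence the min over [b] of a max over [a]. *)
Definition crossing (L : {set 'I_4 * 'I_4}) a0 b0 d v : R :=
  let G a b := (trop_term c a v - trop_term c b v) / (slope d b - slope d a) in
  let F b := \big[Num.max/G a0 b]_(a in L) G a b in
  \big[Num.min/F b0]_(b in ~: L) F b.

Section Crossing.
Variables (L : {set 'I_4 * 'I_4}) (a0 b0 : 'I_4 * 'I_4) (d : R * R).
Hypotheses (a0L : a0 \in L) (b0L : b0 \notin L).
Hypothesis slopeL : forall a b, a \in L -> b \notin L -> slope d a < slope d b.

Let shift v t : R * R := (v.1 + t * d.1, v.2 + t * d.2).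

Let lt_ratio a b v t : a \in L -> b \notin L ->
  (t < (trop_term c a v - trop_term c b v) / (slope d b - slope d a)) =
  (trop_term c b (shift v t) < trop_term c a (shift v t)).
Proof.
move=> aL bL; have s0 : 0 < slope d b - slope d a by rewrite subr_gt0 slopeL.
by rewrite ltr_pdivlMr // !trop_term_shift; apply/idP/idP => h; nra.
Qed.

Let gt_ratio a b v t : a \in L -> b \notin L ->
  ((trop_term c a v - trop_term c b v) / (slope d b - slope d a) < t) =
  (trop_term c a (shift v t) < trop_term c b (shift v t)).
Proof.
move=> aL bL; have s0 : 0 < slope d b - slope d a by rewrite subr_gt0 slopeL.
by rewrite ltr_pdivrMr // !trop_term_shift; apply/idP/idP => h; nra.
Qed.

(** Terms outside [L] grow strictly faster than those of [L], so each pair changes order exactly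
    once, at its ratio, and the inclusion compares [t] with a min-max of these ratios. The default
    values come from [a0] and [b0], which belong to the index sets, so they do not affect the
    result. *)
Lemma crossing_gt v t :
  (t < crossing L a0 b0 d v) = (argmax c (shift v t) \subset L).
Proof.
apply/idP/argmax_subP => [h b bL|h].
  have /bigmin_gtP[_ /(_ b)] := h; rewrite inE => /(_ bL) hb.
  apply: contrapT => hn; move: hb; apply/negP; rewrite -leNgt.
  apply: bigmax_le => [|a aL]; rewrite leNgt lt_ratio //; apply/negP => hl; apply: hn.
    by exists a0.
  by exists a.
have hF b : b \notin L ->
    t < \big[Num.max/(trop_term c a0 v - trop_term c b v) / (slope d b - slope d a0)]_(a in L)
      ((trop_term c a v - trop_term c b v) / (slope d b - slope d a)).
  move=> bL; have [a aL hab] := h b bL.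
  by apply: (@lt_le_trans _ _ _ _ _ _ (le_bigmax_cond _ _ aL)); rewrite lt_ratio.
by apply/bigmin_gtP; split=> [|b]; [exact: hF|rewrite inE; apply: hF].
Qed.

(** Combined with [crossing_gt]: at the crossing time, and only then, both [L] and its complement
    contain maximal terms. This is how the crossings of a leg with the curve are located. *)
Lemma crossing_lt v t :
  (crossing L a0 b0 d v < t) = (argmax c (shift v t) \subset ~: L).
Proof.
apply/idP/argmax_subP => [h b|h].
  rewrite inE negbK => bL.
  apply: contrapT => hn; move: h; apply/negP; rewrite -leNgt.
  have hF e : e \notin L ->
    t <= \big[Num.max/(trop_term c a0 v - trop_term c e v) / (slope d e - slope d a0)]_(a in L)
      ((trop_term c a v - trop_term c e v) / (slope d e - slope d a)).
    move=> eL; apply: le_trans (le_bigmax_cond _ _ bL); rewrite leNgt gt_ratio //.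
    by apply/negP => hl; apply: hn; exists e; rewrite // inE.
  by apply/bigmin_geP; split=> [|e]; [exact: hF|rewrite inE; apply: hF].
have [b] : exists2 b, b \notin L & forall a, a \in L ->
    trop_term c a (shift v t) < trop_term c b (shift v t).
  have [b bm] := argmax_ex (shift v t); exists b.
    by apply/negP => bL; have [|e _] := h b; rewrite ?inE ?negbK //;
       rewrite ltNge; move/argmaxP: bm => ->.
  move=> a aL; have [|e _ he] := h a; first by rewrite inE negbK.
  by apply: lt_le_trans he _; move/argmaxP: bm.
move=> bL hb; apply: (@le_lt_trans _ _ _ _ _ (@bigmin_le_cond _ _ _ _ b _ _ _)).
  by rewrite inE.
by apply/bigmax_ltP; split=> [|a aL]; rewrite gt_ratio ?hb.
Qed.

(** By [crossing_gt] both sides have the same strict lower bounds. *)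
Lemma crossing_shift v t : crossing L a0 b0 d (shift v t) = crossing L a0 b0 d v - t.
Proof.
have key u : (u < crossing L a0 b0 d (shift v t)) = (u < crossing L a0 b0 d v - t).
  rewrite crossing_gt ltrBrDr crossing_gt /shift /=.
  by congr (argmax c (_, _) \subset L); ring.
apply/eqP; rewrite eq_le; apply/andP; split; rewrite leNgt.
  by rewrite key ltxx.
by rewrite -key ltxx.
Qed.

End Crossing.
End Argmax.

(** * Neighbourhoods and continuity *)

Lemma nbhs_sub (T : topologicalType) (x : T) (P Q : T -> Prop) :
  (forall y, P y -> Q y) -> (\forall y \near x, P y) -> \forall y \near x, Q y.
Proof. exact: (@filterS _ (nbhs x)). Qed.

Lemma nbhs_forall (T : topologicalType) (x : T) (I : finType) (P : I -> T -> Prop) :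
  (forall i, \forall y \near x, P i y) -> \forall y \near x, forall i, P i y.
Proof. exact: filter_forall. Qed.

Section RealContinuity.
Variables (R : realType) (T : topologicalType).
Implicit Types f g : T -> R.

Lemma contD f g : continuous f -> continuous g -> continuous (fun x => f x + g x).
Proof. by move=> cf cg x; apply: cvgD; [apply: cf|apply: cg]. Qed.

Lemma contN f : continuous f -> continuous (fun x => - f x).
Proof. by move=> cf x; apply: cvgN; apply: cf. Qed.

Lemma contB f g : continuous f -> continuous g -> continuous (fun x => f x - g x).
Proof. by move=> cf cg x; apply: cvgB; [apply: cf|apply: cg]. Qed.

Lemma contM f g : continuous f -> continuous g -> continuous (fun x => f x * g x).
Proof. by move=> cf cg x; apply: cvgM; [apply: cf|apply: cg]. Qed.

Lemma cont_norm f : continuous f -> continuous (fun x => `|f x|).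
Proof. by move=> cf x; apply: cvg_norm; apply: cf. Qed.

Lemma contmax f g : continuous f -> continuous g ->
  continuous (fun x => Num.max (f x) (g x)).
Proof. by move=> cf cg; apply: max_fun_continuous. Qed.

Lemma contmin f g : continuous f -> continuous g ->
  continuous (fun x => Num.min (f x) (g x)).
Proof. by move=> cf cg; apply: min_fun_continuous. Qed.

Lemma cont_bigmax (I : Type) (r : seq I) (P : pred I) (F : I -> T -> R) f :
  continuous f -> (forall i, continuous (F i)) ->
  continuous (fun x => \big[Num.max/f x]_(i <- r | P i) F i x).
Proof.
move=> cf cF; elim: r => [|i r IH].
  by under eq_fun do rewrite big_nil.
under eq_fun do rewrite big_cons.
by case: (P i) => //; apply: contmax.
Qed.

Lemma cont_bigmin (I : Type) (r : seq I) (P : pred I) (F : I -> T -> R) f :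
  continuous f -> (forall i, continuous (F i)) ->
  continuous (fun x => \big[Num.min/f x]_(i <- r | P i) F i x).
Proof.
move=> cf cF; elim: r => [|i r IH].
  by under eq_fun do rewrite big_nil.
under eq_fun do rewrite big_cons.
by case: (P i) => //; apply: contmin.
Qed.

Lemma cont_pair (U V : topologicalType) (f : T -> U) (g : T -> V) :
  continuous f -> continuous g -> continuous (fun x => (f x, g x)).
Proof. by move=> cf cg x; apply: cvg_pair; [apply: cf|apply: cg]. Qed.

Lemma cont_comp (U V : topologicalType) (f : T -> U) (g : U -> V) :
  continuous g -> continuous f -> continuous (fun x => g (f x)).
Proof. by move=> cg cf x; apply: continuous_comp; [apply: cf|apply: cg]. Qed.

Lemma cont_fst (U V : topologicalType) (f : T -> U * V) :
  continuous f -> continuous (fun x => (f x).1).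
Proof. by move=> cf x; apply: (cvg_comp _ _ (cf x)); apply: cvg_fst. Qed.

Lemma cont_snd (U V : topologicalType) (f : T -> U * V) :
  continuous f -> continuous (fun x => (f x).2).
Proof. by move=> cf x; apply: (cvg_comp _ _ (cf x)); apply: cvg_snd. Qed.

Lemma cont_cst (U : topologicalType) (u : U) : continuous (fun _ : T => u).
Proof. by move=> x; apply: cvg_cst. Qed.

Lemma cont_id : continuous (fun x : T => x).
Proof. by move=> x. Qed.

End RealContinuity.

Ltac cont := repeat match goal with
  | H : continuous ?f |- continuous ?f => exact: H
  | |- continuous (fun _ => ?u) => exact: cont_cst
  | |- continuous (fun x => x) => exact: cont_id
  | |- continuous (fun x => (@?f x, @?g x)) => apply: cont_pair
  | |- continuous (fun x => @?f x + @?g x) => apply: contD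
  | |- continuous (fun x => - @?f x) => apply: contN
  | |- continuous (fun x => @?f x * @?g x) => apply: contM
  | |- continuous (fun x => `|@?f x|) => apply: cont_norm
  | |- continuous (fun x => Num.max (@?f x) (@?g x)) => apply: contmax
  | |- continuous (fun x => Num.min (@?f x) (@?g x)) => apply: contmin
  | |- continuous (fun x => (@?f x).1) => apply: cont_fst
  | |- continuous (fun x => (@?f x).2) => apply: cont_snd
  | |- continuous (@fst _ _) => move=> ?; exact: cvg_fst
  | |- continuous (@snd _ _) => move=> ?; exact: cvg_snd
  end.

Lemma trop_term_continuous (R : realType) (c : 'I_4 -> 'I_4 -> R) a :
  continuous (fun v : R * R => trop_term c a v).
Proof. by rewrite /trop_term; cont. Qed.

Lemma crossing_continuous (R : realType) (c : 'I_4 -> 'I_4 -> R) L a0 b0 d :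
  continuous (fun v : R * R => crossing c L a0 b0 d v).
Proof.
rewrite /crossing.
have ct a := @trop_term_continuous R c a.
by apply: cont_bigmin => [|i]; apply: cont_bigmax => [|j]; cont; exact: ct.
Qed.

Lemma near_argmax_sub (R : realType) (c : 'I_4 -> 'I_4 -> R) (v : R * R) :
  \forall y \near v, argmax c y \subset argmax c v.
Proof.
have [a am] := argmax_ex c v.
have h b : \forall y \near v, b \notin argmax c v ->
    trop_term c b y < trop_term c a y.
  have [bm|bm] := boolP (b \in argmax c v); first by near=> y.
  have lt0 : 0 < trop_term c a v - trop_term c b v by rewrite subr_gt0 argmax_lt.
  have cf : continuous (fun y => trop_term c a y - trop_term c b y).
    by apply: contB; apply: trop_term_continuous.
  near=> y => _; rewrite -subr_gt0; near: y.
  exact: (cvgr_gt _ (cf v) _ lt0).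
apply: nbhs_sub (nbhs_forall h) => y hy.
by apply/argmax_subP => b /hy; exists a.
Unshelve. all: by end_near. Qed.

(** Near [v] only the terms already maximal at [v] compete, so the germ of the curve at [v] depends
    on these terms alone. *)
Lemma near_argmax (R : realType) (c : 'I_4 -> 'I_4 -> R) (v : R * R) :
  \forall y \near v, argmax c y =
    [set a in argmax c v | [forall (b | b \in argmax c v), trop_term c b y <= trop_term c a y]]%SET.
Proof.
apply: nbhs_sub (near_argmax_sub c v) => y /fintype.subsetP hy.
apply/setP => a; rewrite [RHS]inE; apply/argmaxP/andP => [h|[am /forallP h] b].
  split; first by apply: hy; apply/argmaxP.
  by apply/forallP => b; apply/implyP => _; apply: h.
have [e em] := argmax_ex c y.
have /implyP/(_ (hy _ em)) := h e; apply: le_trans.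
by move/argmaxP: em.
Qed.

Lemma notin_corner (R : realType) (c : 'I_4 -> 'I_4 -> R) a v :
  argmax c v = [set a]%SET -> ~ corner_locus c v.
Proof. by rewrite /corner_locus /= => ->; rewrite cards1. Qed.

Lemma nbhs_and (T : topologicalType) (x : T) (P Q : T -> Prop) :
  (\forall y \near x, P y) -> (\forall y \near x, Q y) -> \forall y \near x, P y /\ Q y.
Proof. exact: (@filterI _ (nbhs x)). Qed.

Lemma near_cont (T U : topologicalType) (f : T -> U) (x : T) (Q : U -> Prop) :
  continuous f -> (\forall y \near f x, Q y) -> \forall u \near x, Q (f u).
Proof. by move=> cf; apply: cf. Qed.

(** * Polyhedra and relative interiors *)

Lemma near0_norm (R : realType) (Q : R -> Prop) :
  (\forall t \near (0 : R), Q t) -> exists2 e, 0 < e & forall t, `|t| < e -> Q t.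
Proof.
move=> /nbhs_ballP[e /= e0 he]; exists e => // t te; apply: he.
by rewrite /ball /= sub0r normrN.
Qed.

Section Polyhedra.
Variable R : realType.
Implicit Types (C F : set (R * R * R)) (z y : R * R * R) (t : R).

Definition lerp z y t : R * R * R :=
  (z.1.1 + t * (y.1.1 - z.1.1), z.1.2 + t * (y.1.2 - z.1.2), z.2 + t * (y.2 - z.2)).

Lemma dot3_lerp a z y t : dot3 a (lerp z y t) = dot3 a z + t * (dot3 a y - dot3 a z).
Proof. rewrite /dot3 /lerp /=; ring. Qed.

Lemma dot3_continuous (a : R * R * R) : continuous (dot3 a).
Proof. by rewrite /dot3; cont. Qed.

Lemma lerp_continuous z y : continuous (lerp z y).
Proof. by rewrite /lerp; cont. Qed.

Lemma lerp0 z y : lerp z y 0 = z.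
Proof. by rewrite /lerp !mul0r !addr0 -!surjective_pairing. Qed.

Lemma closed_le0 (T : topologicalType) (f : T -> R) (b : R) :
  continuous f -> closed [set x | f x <= b].
Proof. by move=> cf; apply: ((continuous_closedP f).1 cf [set y | y <= b]); exact: closed_le. Qed.

Lemma polyhedron_closed C : polyhedron C -> closed C.
Proof.
move=> [s ->]; elim: s => [|h s IH].
  by rewrite (_ : [set z | _] = setT); [exact: closedT|apply/seteqP; split].
rewrite (_ : [set z | _] = [set z | dot3 h.1 z <= h.2] `&`
   [set z | forall h, h \in s -> dot3 h.1 z <= h.2]).
  by apply: closedI => //; apply: closed_le0; apply: dot3_continuous.
apply/seteqP; split => [z /= hz|z /= [h1 h2] k].
  by split=> [|k ks]; apply: hz; rewrite in_cons ?eqxx ?ks ?orbT.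
by rewrite in_cons => /predU1P[->|/h2].
Qed.

Lemma complex_support_closed (P : set (set (R * R * R))) :
  polyhedral_complex P -> closed (complex_support P).
Proof.
move=> [finP polyP _ _]; apply: closed_bigcup => // C /polyP[_].
exact: polyhedron_closed.
Qed.

Lemma polyhedron_convex C z y t : polyhedron C -> C z -> C y -> 0 <= t <= 1 ->
  C (lerp z y t).
Proof.
move=> [s ->] /= hz hy t01 h hs; rewrite dot3_lerp.
by have := hz h hs; have := hy h hs; nra.
Qed.

Lemma affine_hull_lerp C z y t : affine_hull C z -> affine_hull C y ->
  affine_hull C (lerp z y t).
Proof.
move=> hz hy a b hab; rewrite dot3_lerp (hz a b) // (hy a b) //; ring.
Qed.

Lemma affine_hull_sub C : C `<=` affine_hull C.
Proof. by move=> z Cz a b; apply. Qed.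

Lemma near_all (T : topologicalType) (x : T) (I : eqType) (s : seq I) (Q : I -> T -> Prop) :
  (forall i, i \in s -> \forall y \near x, Q i y) ->
  \forall y \near x, forall i, i \in s -> Q i y.
Proof.
elim: s => [|i s IH] h; first by near=> y.
have h1 := h i (mem_head _ _).
have h2 : \forall y \near x, forall i, i \in s -> Q i y.
  by apply: IH => j js; apply: h; rewrite in_cons js orbT.
by near=> y => j; rewrite in_cons => /predU1P[->|]; [near: y|move: (j); near: y].
Unshelve. all: by end_near. Qed.

(** A strict inequality persists near [z], and an inequality that is an equation on all of [C] is an
    equation on its affine hull. *)
Lemma rel_interior_tight (s : seq ((R * R * R) * R)) z :
  let C := [set z | forall h, h \in s -> dot3 h.1 z <= h.2] in
  C z ->
  (forall h, h \in s -> dot3 h.1 z < h.2 \/ (forall y, C y -> dot3 h.1 y = h.2)) ->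
  rel_interior C z.
Proof.
move=> C Cz hs; split=> //.
have : \forall y \near z, forall h, h \in s -> affine_hull C y -> dot3 h.1 y <= h.2.
  apply: near_all => h /hs[lt|tight].
    have near_lt : \forall y \near z, dot3 h.1 y < h.2.
      exact: (cvgr_lt _ (@dot3_continuous h.1 z) _ lt).
    by near=> y => _; apply: ltW; near: y.
  by near=> y => /(_ h.1 h.2 tight) ->.
by apply: nbhs_sub => y hy hull h hs'; apply: hy.
Unshelve. all: by end_near. Qed.

(** Take [w] in [C] strict in every inequality that is not an equation on [C]. All points of the
    segment from [z] to [w] other than [z] are then strict in the same inequalities, hence
    relatively interior, and they approach [z]. *)
Lemma rel_interior_dense C z : polyhedron C -> C z ->
  forall U, nbhs z U -> exists2 y, rel_interior C y & U y.
Proof.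
move=> [s eC] Cz U Uz; rewrite eC in Cz *.
set D := [set _ | _] in Cz *.
have polyD : polyhedron D by exists s.
have [w Dw hw] : exists2 w, D w & forall h, h \in s ->
    dot3 h.1 w < h.2 \/ (forall y, D y -> dot3 h.1 y = h.2).
  suff : forall l : seq ((R * R * R) * R), {subset l <= s} -> exists2 w, D w & forall h, h \in l ->
    dot3 h.1 w < h.2 \/ (forall y, D y -> dot3 h.1 y = h.2) by apply.
  elim=> [|h l IH] hl; first by exists z.
  have [|w Dw hw] := IH; first by move=> k kl; apply: hl; rewrite in_cons kl orbT.
  have [tight|] := pselect (forall y, D y -> dot3 h.1 y = h.2).
    by exists w => // k; rewrite in_cons => /predU1P[->|/hw//]; right.
  move=> /existsNP[y /not_implyP[Dy ny]].
  have lty : dot3 h.1 y < h.2.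
    by rewrite lt_neqAle; apply/andP; split; [apply/eqP|apply: Dy; apply: hl; exact: mem_head].
  (* The midpoint keeps the inequalities already strict at [w] and gains the inequality [h], strict
     at [y]. *)
  exists (lerp w y (1/2)).
    by apply: polyhedron_convex => //; lra.
  move=> k kl; have ks := hl _ kl; rewrite dot3_lerp.
  have := Dw k ks; have := Dy k ks; move: kl; rewrite in_cons => /predU1P[->|/hw[lt|?]].
  - by left; lra.
  - by left; lra.
  - by right.
have : \forall t \near (0 : R), U (lerp z w t) by apply: near_cont; [exact: lerp_continuous|rewrite lerp0].
move=> /near0_norm[e e0 he].
pose t := Num.min (e / 2) 1; have [tp0 [tp1 tpe]] : 0 < t /\ t <= 1 /\ t < e.
  rewrite /t; split; first by rewrite lt_min; apply/andP; split; lra.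
  by split; [rewrite ge_min lexx orbT|rewrite gt_min; apply/orP; left; lra].
exists (lerp z w t); last first.
  by apply: he; rewrite gtr0_norm.
apply: rel_interior_tight; first by apply: polyhedron_convex => //; lra.
move=> h hs; have := Cz h hs; rewrite dot3_lerp; case: (hw h hs) => [lt|tight] le0.
  by left; nra.
by right.
Qed.

(** [F] is the face on which all inequalities tight at [z] are equations. Their sum cuts it out,
    because equality in a sum of inequalities forces equality in each of them. *)
Lemma rel_interior_cover (P : set (set (R * R * R))) C z :
  polyhedral_complex P -> P C -> C z -> exists2 F, P F & rel_interior F z.
Proof.
move=> [_ polyP faceP _] PC Cz; have [_ [s eC]] := polyP _ PC.
pose s' := [seq h <- s | dot3 h.1 z == h.2].
pose A := ((\sum_(h <- s') h.1.1.1, \sum_(h <- s') h.1.1.2), \sum_(h <- s') h.1.2).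
pose B := \sum_(h <- s') h.2.
have dotA y : dot3 A y = \sum_(h <- s') dot3 h.1 y.
  by rewrite /dot3 /A /= !mulr_suml -!big_split.
have s's : {subset s' <= s} by move=> h; rewrite mem_filter => /andP[].
have face : is_face (C `&` [set y | dot3 A y = B]) C.
  split; last first.
    exists A, B; split=> // y; rewrite eC dotA => Cy.
    by rewrite /B !big_seq; apply: ler_sum => h /s's; apply: Cy.
  exists z; split=> //=; rewrite dotA /B !big_seq; apply: eq_bigr => h.
  by rewrite mem_filter => /andP[/eqP].
exists (C `&` [set y | dot3 A y = B]); first exact: (faceP C).
(* Adding the reversed tight inequalities describes the face by a list again, the form needed for
   [rel_interior_tight]. *)
pose opp h : (R * R * R) * R := (((- h.1.1.1, - h.1.1.2), - h.1.2), - h.2).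
have dotopp h y : dot3 (opp h).1 y = - dot3 h.1 y by rewrite /dot3 /opp /=; ring.
rewrite (_ : _ `&` _ = [set y | forall h, h \in s ++ map opp s' -> dot3 h.1 y <= h.2]).
  apply: rel_interior_tight.
    move=> h; rewrite mem_cat => /orP[hs|/mapP[k]]; first by move: Cz; rewrite eC; apply.
    by rewrite mem_filter => /andP[/eqP hk _] ->; rewrite dotopp hk.
  have Czs h : h \in s -> dot3 h.1 z <= h.2 by move=> hs; move: Cz; rewrite eC; apply.
  have tight h : h \in s' -> forall y, (forall h, h \in s ++ map opp s' -> dot3 h.1 y <= h.2) ->
      dot3 h.1 y = h.2.
    move=> hs' y hy; apply/eqP; rewrite eq_le hy ?mem_cat ?s's //=.
    have := hy (opp h); rewrite dotopp lerN2; apply.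
    by rewrite mem_cat map_f ?orbT.
  move=> h; rewrite mem_cat => /orP[hs|/mapP[k ks' ->]].
    have [e|ne] := eqVneq (dot3 h.1 z) h.2; last by left; rewrite lt_neqAle ne Czs.
    by right; apply: tight; rewrite mem_filter e eqxx.
  by right => y /(tight k ks'); rewrite dotopp => ->.
apply/seteqP; split=> y /=.
  move=> [Cy]; rewrite dotA /B => e.
  have Cys h : h \in s -> dot3 h.1 y <= h.2 by move=> hs; move: Cy; rewrite eC; apply.
  have e0 : \sum_(h <- s') (h.2 - dot3 h.1 y) == 0 by rewrite sumrB e subrr.
  have allt : all (fun h => h.2 - dot3 h.1 y == 0) s'.
    move: e0; rewrite big_seq psumr_eq0; last by move=> h /s's/Cys; rewrite subr_ge0.
    move=> /allP h0; apply/allP => h hs'; by have := h0 h hs'; rewrite hs'.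
  move=> h; rewrite mem_cat => /orP[/Cys//|/mapP[k ks' ->]].
  by rewrite dotopp lerN2 -subr_le0; have /eqP -> := allP allt _ ks'.
move=> hy; split.
  by rewrite eC => h hs; apply: hy; rewrite mem_cat hs.
rewrite dotA /B !big_seq; apply: eq_bigr => h hs'; apply/eqP.
rewrite eq_le hy ?mem_cat ?s's //=.
by have := hy (opp h); rewrite dotopp lerN2; apply; rewrite mem_cat map_f ?orbT.
Qed.

(** A point [u] near [x] is the same convex combination of the translates of [z] and [y] by [u - x].
    These lie in the hull and near [z] and [y], hence in [C]. *)
Lemma rel_interior_convex C z y t : polyhedron C -> rel_interior C z ->
  rel_interior C y -> 0 <= t <= 1 -> rel_interior C (lerp z y t).
Proof.
move=> polyC [Cz nz] [Cy ny] t01; split; first exact: polyhedron_convex.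
set x := lerp z y t.
pose tr (v u : R * R * R) : R * R * R :=
  (v.1.1 + (u.1.1 - x.1.1), v.1.2 + (u.1.2 - x.1.2), v.2 + (u.2 - x.2)).
have trc v : continuous (tr v) by rewrite /tr; cont.
have trx v : tr v x = v by rewrite /tr !subrr !addr0 -!surjective_pairing.
have hull v u : affine_hull C v -> affine_hull C u -> affine_hull C (tr v u).
  move=> hv hu a b hab.
  have hx : dot3 a x = b.
    by rewrite /x dot3_lerp (hab z) // (hab y) //; ring.
  have -> : dot3 a (tr v u) = dot3 a v + dot3 a u - dot3 a x by rewrite /dot3 /tr /=; ring.
  by rewrite hx (hv a b) // (hu a b) //; ring.
have n1 : \forall u \near x, affine_hull C (tr z u) -> C (tr z u).
  by apply: (near_cont (Q := fun w => affine_hull C w -> C w) (trc z)); rewrite trx.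
have n2 : \forall u \near x, affine_hull C (tr y u) -> C (tr y u).
  by apply: (near_cont (Q := fun w => affine_hull C w -> C w) (trc y)); rewrite trx.
apply: nbhs_sub (nbhs_and n1 n2) => u [h1 h2] hu.
have c1 : C (tr z u) by apply/h1/hull => //; exact: affine_hull_sub.
have c2 : C (tr y u) by apply/h2/hull => //; exact: affine_hull_sub.
have -> : u = lerp (tr z u) (tr y u) t.
  rewrite /lerp /tr /x /lerp /=; case: u {hu c1 c2 h1 h2} => [[u1 u2] u3] /=.
  by congr (_, _, _); ring.
exact: polyhedron_convex.
Qed.

Lemma rel_interior_line C z y : rel_interior C z -> C y ->
  \forall t \near (0 : R), rel_interior C (lerp z y t).
Proof.
move=> [Cz nz] Cy.
have nnz : \forall v \near z, \forall u \near v, affine_hull C u -> C u.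
  exact: (nbhs_interior nz).
have h1 : \forall t \near (0 : R), \forall u \near lerp z y t, affine_hull C u -> C u.
  apply: (near_cont (Q := fun v => \forall u \near v, affine_hull C u -> C u)).
    exact: lerp_continuous.
  by rewrite lerp0.
apply: nbhs_sub h1 => t ht; split=> //.
apply: (nbhs_singleton ht); apply: affine_hull_lerp; exact: affine_hull_sub.
Qed.

(** The segment from [z] to [y] contains a point [x] with third coordinate 0. As [z] itself may be
    this point, the opposite sign is reached by continuing beyond [x], away from [y], which relative
    interiority allows. *)
Lemma rel_interior_sign C z y : polyhedron C -> rel_interior C z ->
  rel_interior C y -> z.2 * y.2 <= 0 -> y.2 != 0 ->
  (exists2 x, rel_interior C x & x.2 = 0) /\
  (exists2 x, rel_interior C x & x.2 * y.2 < 0).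
Proof.
move=> polyC rz ry zy0 y0.
have [x rx x0] : exists2 x, rel_interior C x & x.2 = 0.
  have d0 : y.2 - z.2 != 0.
    apply/eqP => e; have e' : z.2 = y.2 by lra.
    by move: zy0; rewrite e' -expr2 le_eqVlt sqrf_eq0 (negbTE y0) ltNge sqr_ge0.
  exists (lerp z y (- z.2 / (y.2 - z.2))); last by rewrite /lerp /=; field.
  apply: rel_interior_convex => //.
  have : 0 < y.2 \/ y.2 < 0 by case: (ltgtP y.2 0) y0 => // ?; [right|left].
  case=> yp.
    have zp : z.2 <= 0 by nra.
    by rewrite ler_pdivlMr ?ler_pdivrMr ?mul0r; lra.
  have zp : 0 <= z.2 by nra.
  by rewrite ler_ndivlMr ?ler_ndivrMr ?mul0r; lra.
split; first by exists x.
have /near0_norm[e e0 he] := rel_interior_line rx ry.1.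
exists (lerp x y (- (e / 2))).
  by apply: he; rewrite normrN gtr0_norm; lra.
by rewrite /lerp /= x0 subr0 add0r; have : 0 < y.2 * y.2 by [rewrite -expr2 exprn_even_gt0]; nra.
Qed.

End Polyhedra.

(** * Tritangency for an arbitrary displacement *)

Lemma connected_component_map (T U : topologicalType) (f : T -> U)
    (A : set T) (B : set U) x y :
  continuous f -> (forall u, A u -> B (f u)) ->
  connected_component A x y -> connected_component B (f x) (f y).
Proof.
move=> cf AB [K [Kx KA cK] Ky].
exists (f @` K); last by exists y.
split; first by exists x.
  by move=> _ [u /KA/AB ? <-].
by apply: connected_continuous_connected => //; apply: continuous_subspaceT.
Qed.

Section Tritangency.
Variable R : realType.
Implicit Types (w p : R * R) (u v : int * int) (C D K : set (R * R)).

Definition rays_meet w u v : Prop := exists s t : R,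
  [/\ 0 <= s, 0 <= t, s * u.1%:~R = w.1 + t * v.1%:~R & s * u.2%:~R = w.2 + t * v.2%:~R].

Definition mult w C D p : nat :=
  \sum_(uv \in [set uv : (int * int) * (int * int) |
      [/\ star_rays C p uv.1, star_rays D p uv.2 & rays_meet w uv.1 uv.2]])
    absz (det2 uv.1 uv.2).

Definition total_mult w C D K : nat := \sum_(p \in K) mult w C D p.

(* Tritangency with an arbitrary displacement [w] in the fan displacement rule, so
   that reflections of the plane, which change [w], can be applied. *)
Definition tritangent_disp w C D : Prop := exists Ks : seq (set (R * R)),
  [/\ uniq Ks, [set` Ks] = components (D `&` C) &
      [seq total_mult w C D K | K <- Ks] \in [:: [:: 2; 2; 2]; [:: 2; 4]; [:: 6]]%N].

Lemma tritangentE (c : 'I_4 -> 'I_4 -> R) z :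
  tritangent c z = tritangent_disp (1, Num.sqrt 2) (corner_locus c) (curve11 z).
Proof. by []. Qed.

(** Rational independence of the coordinates: [w] lies on no rational line through the origin. Hence
    parallel rays are disjoint after displacement, and no displaced ray passes through the apex of
    the other star. *)
Definition generic w := forall a b : int,
  a%:~R * w.1 + b%:~R * w.2 = 0 -> a = 0 /\ b = 0.

Lemma sqrt2_irrational (a b : int) : a%:~R + b%:~R * Num.sqrt 2 = 0 :> R -> a = 0 /\ b = 0.
Proof.
move=> h.
have e : (a * a)%:~R = (2 * (b * b))%:~R :> R.
  have ea : a%:~R = - (b%:~R * Num.sqrt 2) :> R by lra.
  have s2 : Num.sqrt 2 * Num.sqrt 2 = 2 :> R by rewrite -expr2 sqr_sqrtr.
  by rewrite !intrM ea; nra.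
move/intr_inj: e => e.
have en : (`|a| * `|a| = 2 * (`|b| * `|b|))%N by rewrite -!abszM e !abszM.
have [b0|b0] := posnP `|b|%N.
  by move: en; rewrite b0 !muln0 => /eqP; rewrite muln_eq0 orbb absz_eq0 => /eqP;
     move/eqP: b0; rewrite absz_eq0 => /eqP.
have a0 : (0 < `|a|)%N by have := muln_gt0 `|b| `|b|; rewrite b0 => h0; case: `|a|%N en => // en; lia.
(* The exponent of 2 is even on the left and odd on the right. *)
have := congr1 (logn 2) en; rewrite !lognM ?muln_gt0 ?b0 // (pfactorK 1) // !addnn.
move=> /(congr1 odd); by rewrite oddD !odd_double.
Qed.

Lemma generic_swap w : generic w -> generic (w.2, w.1).
Proof. by move=> gw a b /= h; have [|] := gw b a; [rewrite addrC|]. Qed.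

Lemma generic_sign (b1 b2 : bool) : generic ((-1) ^+ b1, (-1) ^+ b2 * Num.sqrt 2).
Proof.
move=> a b /= h.
have [] := @sqrt2_irrational ((-1) ^+ b1 * a) ((-1) ^+ b2 * b).
  by rewrite -[RHS]h; case: b1 b2 {h} => -[]; rewrite ?expr1 ?expr0 !intrM ?intrN; ring.
by case: b1 b2 {h} => -[]; rewrite ?expr1 ?expr0 ?mul1r ?mulN1r => /eqP; rewrite ?oppr_eq0 => /eqP-> /eqP;
   rewrite ?oppr_eq0 => /eqP.
Qed.

(** The parity of the entries is all that the exclusion arguments below use of tritangency. *)
Lemma components_even w C D x : tritangent_disp w C D -> (D `&` C) x ->
  ~~ odd (total_mult w C D (connected_component (D `&` C) x)).
Proof.
move=> [Ks [_ eKs hKs]] Xx.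
have : [set` Ks] (connected_component (D `&` C) x) by rewrite eKs; exists x.
rewrite /= => /(map_f (total_mult w C D)) h; move: hKs h; rewrite !inE.
by move=> /or3P[] /eqP->; rewrite !inE => h; repeat (case/orP: h => [/eqP->//|]; move=> h); move/eqP: h => ->.
Qed.

Lemma star_rays_near C D p : (\forall y \near p, C y <-> D y) -> star_rays C p = star_rays D p.
Proof.
move=> h; apply/seteqP.
have key C' D' u : (\forall y \near p, C' y -> D' y) -> star_rays C' p u -> star_rays D' p u.
  move=> h' [cu hu]; split=> //.
  have ct : continuous (fun t : R => (p.1 + t * u.1%:~R, p.2 + t * u.2%:~R)) by cont.
  have : \forall t \near (0 : R), C' (p.1 + t * u.1%:~R, p.2 + t * u.2%:~R) ->
     D' (p.1 + t * u.1%:~R, p.2 + t * u.2%:~R).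
    apply: (near_cont (Q := fun y => C' y -> D' y) ct).
    by rewrite !mul0r !addr0 -surjective_pairing.
  move=> /near0_norm[e e0 he].
  near=> t; have : C' (p.1 + t * u.1%:~R, p.2 + t * u.2%:~R) by near: t.
  apply: he; rewrite gtr0_norm; near: t; [exact: nbhs_right_lt|exact: nbhs_right_gt].
by split=> u; apply: key; apply: nbhs_sub h => y [].
Unshelve. all: by end_near. Qed.

Lemma mult_near w C D D' p : (\forall y \near p, D y <-> D' y) ->
  mult w C D p = mult w C D' p.
Proof. by move=> /star_rays_near h; rewrite /mult h. Qed.

(** * Invariance under lattice symmetries of the plane *)

Section Symmetry.
Variables (phi : R * R -> R * R) (phii : int * int -> int * int).
Hypotheses (phiK : involutive phi) (phic : continuous phi) (phi0 : phi (0, 0) = (0, 0)).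
Hypothesis phi_lin : forall p t u, phi (p.1 + t * u.1%:~R, p.2 + t * u.2%:~R) =
  ((phi p).1 + t * (phii u).1%:~R, (phi p).2 + t * (phii u).2%:~R).
Hypothesis phiiK : involutive phii.
Hypothesis phii_coprime : forall u, coprimez u.1 u.2 -> coprimez (phii u).1 (phii u).2.
Hypothesis phii_det : forall u v, absz (det2 (phii u) (phii v)) = absz (det2 u v).

Lemma star_rays_sym C p u : star_rays C p u -> star_rays (phi @^-1` C) (phi p) (phii u).
Proof.
move=> [cu hu]; split; first exact: phii_coprime.
by move: hu; apply: filterS => t; rewrite /= -phi_lin phiK.
Qed.

Lemma rays_meet_sym w u v : rays_meet w u v -> rays_meet (phi w) (phii u) (phii v).
Proof.
move=> [s [t [s0 t0 e1 e2]]]; exists s, t; split=> //.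
  have := phi_lin (0, 0) s u; rewrite phi0 /= !add0r e1 e2 phi_lin => -[<- _]; ring.
have := phi_lin (0, 0) s u; rewrite phi0 /= !add0r e1 e2 phi_lin => -[_ <-]; ring.
Qed.

Lemma preimageK C : phi @^-1` (phi @^-1` C) = C.
Proof. by apply/seteqP; split=> p; rewrite /= phiK. Qed.

Lemma mult_sym w C D p :
  mult (phi w) (phi @^-1` C) (phi @^-1` D) (phi p) = mult w C D p.
Proof.
pose f (uv : (int * int) * (int * int)) := (phii uv.1, phii uv.2).
pose S w C D p := [set uv : (int * int) * (int * int) |
      [/\ star_rays C p uv.1, star_rays D p uv.2 & rays_meet w uv.1 uv.2]].
have fS w' C' D' p' : forall uv, S w' C' D' p' uv ->
    S (phi w') (phi @^-1` C') (phi @^-1` D') (phi p') (f uv).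
  by move=> uv [h1 h2 h3]; split; [exact: star_rays_sym|exact: star_rays_sym|exact: rays_meet_sym].
have fK : involutive f by move=> [u v]; rewrite /f /= !phiiK.
rewrite /mult (reindex_fsbig f (S w C D p)) /=.
  by apply: eq_fsbigr => -[u v] _; rewrite phii_det.
split; first by move=> uv; apply: fS.
  by move=> x y _ _; apply: (inv_inj fK).
move=> uv /fS; rewrite !preimageK !phiK => h; exists (f uv) => //; exact: fK.
Qed.

Lemma total_mult_sym w C D K :
  total_mult (phi w) (phi @^-1` C) (phi @^-1` D) (phi @^-1` K) = total_mult w C D K.
Proof.
rewrite /total_mult (reindex_fsbig phi K) /=.
  by apply: eq_fsbigr => p _; exact: mult_sym.
split; first by move=> p; rewrite /= phiK.
  by move=> x y _ _; apply: (inv_inj phiK).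
by move=> p Kp; exists (phi p).
Qed.

Lemma connected_component_sym (A : set (R * R)) p :
  connected_component (phi @^-1` A) p = phi @^-1` connected_component A (phi p).
Proof.
apply/seteqP; split=> y /=; first exact: connected_component_map.
move=> h; rewrite -(phiK p) -(phiK y); move: h.
by apply: connected_component_map => // u Au; rewrite /= phiK.
Qed.

Lemma tritangent_disp_sym w C D : tritangent_disp w C D ->
  tritangent_disp (phi w) (phi @^-1` C) (phi @^-1` D).
Proof.
move=> [Ks [uKs eKs hKs]]; exists [seq phi @^-1` K | K <- Ks]; split.
- by rewrite map_inj_uniq // => A B e; rewrite -(preimageK A) e preimageK.
- rewrite -preimage_setI; apply/seteqP; split=> L /=.
    move=> /mapP[K KKs ->]; have : [set` Ks] K by [].
    rewrite eKs => -[x Xx <-]; exists (phi x); first by rewrite /= phiK.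
    by rewrite connected_component_sym phiK.
  move=> [x Xx <-]; rewrite connected_component_sym; apply: map_f.
  have : components (D `&` C) (connected_component (D `&` C) (phi x)) by exists (phi x).
  by rewrite -eKs.
- by rewrite -map_comp (@eq_map _ _ _ (total_mult w C D)) // => K /=; exact: total_mult_sym.
Qed.

End Symmetry.
End Tritangency.

(** * Intersection multiplicities *)

Section Multiplicities.
Variable R : realType.
Implicit Types (w p : R * R) (u v : int * int) (C D K : set (R * R)).

Lemma mult_seq w C D p (su sv : seq (int * int)) :
  star_rays C p = [set` su] -> star_rays D p = [set` sv] -> uniq su -> uniq sv ->
  mult w C D p = (\sum_(u <- su) \sum_(v <- sv)
     if `[< rays_meet w u v >] then absz (det2 u v) else 0)%N.
Proof.
move=> eC eD uu uv.
pose r := [seq x <- [seq (u, v) | u <- su, v <- sv] | `[< rays_meet w x.1 x.2 >]].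
rewrite /mult eC eD (_ : [set _ | _] = [set` r]); last first.
  apply/seteqP; split=> -[u v] /=; rewrite mem_filter /=.
    by move=> [hu hv hm]; rewrite allpairs_f // andbT; apply/asboolP.
  move=> /andP[/asboolP hm /allpairsP[[u' v'] /= [hu hv [eu ev]]]].
  by rewrite eu ev in hm *.
rewrite -fsbig_seq; last first.
  by rewrite filter_uniq // allpairs_uniq // => -[? ?] [? ?] _ _ /= [-> ->].
by rewrite big_filter big_mkcond big_allpairs_dep.
Qed.

Let cross w u : R := w.1 * u.2%:~R - w.2 * u.1%:~R.

(** Cramer's rule: the parameters of the meeting point are [cross w v / det2 u v] and
    [cross w u / det2 u v]. Products replace the quotients, having the same sign. *)
Lemma rays_meetP w u v : det2 u v != 0 ->
  rays_meet w u v <->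
  0 <= cross w v * (det2 u v)%:~R /\ 0 <= cross w u * (det2 u v)%:~R.
Proof.
move=> d0; have d0R : (det2 u v)%:~R != 0 :> R by rewrite intr_eq0.
have dsq : 0 < (det2 u v)%:~R * (det2 u v)%:~R :> R by rewrite -expr2 exprn_even_gt0.
have dE : (det2 u v)%:~R = u.1%:~R * v.2%:~R - u.2%:~R * v.1%:~R :> R.
  by rewrite /det2 intrB !intrM.
split=> [[s [t [s0 t0 e1 e2]]]|[h1 h2]].
  have -> : cross w v = s * (det2 u v)%:~R.
    rewrite /cross dE (_ : w.1 = s * u.1%:~R - t * v.1%:~R); last by rewrite e1; ring.
    by rewrite (_ : w.2 = s * u.2%:~R - t * v.2%:~R); [ring|rewrite e2; ring].
  have -> : cross w u = t * (det2 u v)%:~R.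
    rewrite /cross dE (_ : w.1 = s * u.1%:~R - t * v.1%:~R); last by rewrite e1; ring.
    by rewrite (_ : w.2 = s * u.2%:~R - t * v.2%:~R); [ring|rewrite e2; ring].
  by split; rewrite -mulrA mulr_ge0 // ltW.
exists (cross w v / (det2 u v)%:~R), (cross w u / (det2 u v)%:~R); split.
- by rewrite -(pmulr_lge0 _ dsq) mulrA divfK.
- by rewrite -(pmulr_lge0 _ dsq) mulrA divfK.
- by rewrite /cross dE; field; rewrite -dE.
- by rewrite /cross dE; field; rewrite -dE.
Qed.

(** A meeting would put [w] on the line spanned by [u], which is an integral relation between its
    coordinates. *)
Lemma rays_meet_parallel w u v : generic w -> u != (0, 0) -> det2 u v = 0 -> ~ rays_meet w u v.
Proof.
move=> gw u0 d0 [s [t [_ _ e1 e2]]].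
have dE : u.1%:~R * v.2%:~R - u.2%:~R * v.1%:~R = 0 :> R.
  by rewrite -!intrM -intrB -/(det2 u v) d0.
have [] := gw u.2 (- u.1).
  have -> : w.1 = s * u.1%:~R - t * v.1%:~R by rewrite e1; ring.
  have -> : w.2 = s * u.2%:~R - t * v.2%:~R by rewrite e2; ring.
  rewrite intrN; transitivity (t * (u.1%:~R * v.2%:~R - u.2%:~R * v.1%:~R)); first by ring.
  by rewrite dE mulr0.
move=> h2 /eqP; rewrite oppr_eq0 => /eqP h1; move: u0.
by rewrite (surjective_pairing u) xpair_eqE h1 h2 eqxx.
Qed.

(** All pairs of rays are parallel. This is why stretches where the two curves overlap in a straight
    line drop out of the totals. *)
Lemma mult_parallel w C D p u : generic w -> u != (0, 0) ->
  star_rays C p = [set` [:: u; (- u.1, - u.2)]] ->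
  star_rays D p = [set` [:: u; (- u.1, - u.2)]] -> mult w C D p = 0%N.
Proof.
case: u => a b gw u0 eC eD; rewrite /mult fsbig1 // => -[x y] [].
rewrite /= eC eD /= !inE => hx hy hm; exfalso.
have x0 : x != (0, 0).
  case/orP: hx => /eqP-> //; apply: contra u0 => /eqP[ha hb].
  by rewrite -(opprK a) ha -(opprK b) hb oppr0.
apply: (rays_meet_parallel gw x0 _ hm).
by case/orP: hx => /eqP->; case/orP: hy => /eqP->; rewrite /det2 /=; ring.
Qed.

Lemma generic_neq w : generic w -> [/\ w.1 != 0, w.2 != 0 & w.1 != w.2].
Proof.
move=> gw; split; apply/eqP => h.
- by have [] := gw 1 0; rewrite ?h ?mulr0 ?mul0r ?addr0.
- by have [] := gw 0 1; rewrite ?h ?mulr0 ?mul0r ?addr0.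
- by have [] := gw 1 (-1); rewrite ?h // mul1r intrN mulN1r subrr.
Qed.

(** The star of a (1,1)-curve with l > 0 at [v_0], and also the star of the given curve at a vertex
    dual to the triangle (0,0), (1,0), (0,1). *)
Definition tripod : seq (int * int) := [:: (-1, 0); (0, -1); (1, 1)].

Let meet_case w u v b : det2 u v != 0 ->
  (if 0 < det2 u v then (0 <= cross w v) && (0 <= cross w u)
   else (cross w v <= 0) && (cross w u <= 0)) = b ->
  `[< rays_meet w u v >] = b.
Proof.
move=> d0 <-; suff e : rays_meet w u v <-> (if 0 < det2 u v
    then (0 <= cross w v) && (0 <= cross w u) else (cross w v <= 0) && (cross w u <= 0)).
  by apply/asboolP/idP => /e.
apply: (iff_trans (rays_meetP w d0)); case: ifP => d1.
  by rewrite !pmulr_lge0 ?ltr0z //; split=> [[-> ->]|/andP].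
have d2 : (det2 u v)%:~R < 0 :> R by rewrite ltrz0 lt_neqAle d0 leNgt d1.
by rewrite !nmulr_lge0 //; split=> [[-> ->]|/andP].
Qed.

Ltac cross_compute := rewrite /cross /= ?mulr0z ?mulr1z ?mulrN1z.
Ltac meet_true := apply: meet_case; [by []|cross_compute; apply/andP; split; lra].
Ltac meet_false := apply: meet_case; [by []|cross_compute; apply/negbTE;
  rewrite negb_and -!ltNge; apply/orP; first [left; lra|right; lra]].
Ltac meet_zero gw := apply/asboolPn/(rays_meet_parallel gw); by [].
Ltac meets gw := repeat match goal with |- context [ `[< rays_meet ?w ?u ?v >] ] =>
  first [ have -> : `[< rays_meet w u v >] = false by meet_zero gw
        | have -> : `[< rays_meet w u v >] = true by meet_true
        | have -> : `[< rays_meet w u v >] = false by meet_false ] end.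

Lemma mult_tripod w C D p su : generic w ->
  star_rays C p = [set` su] -> star_rays D p = [set` tripod] ->
  su \in [:: tripod; [:: (1, 1); (-1, -1)]; [:: (0, 1); (0, -1)]] ->
  mult w C D p = 1%N.
Proof.
move=> gw eC eD; have [w1 w2 w12] := generic_neq gw.
rewrite !inE => hs.
have uu : uniq su by case/or3P: hs => /eqP->.
rewrite (mult_seq w eC eD uu) // {uu eC eD}.
case/or3P: hs => /eqP->; rewrite /tripod !big_cons !big_nil;
case: (ltgtP w.1 0) w1 => // w1 _; case: (ltgtP w.2 0) w2 => // w2 _;
case: (ltgtP w.1 w.2) w12 => // w12 _; try (exfalso; lra); meets gw; by [].
Qed.

End Multiplicities.

(** * Stars of the corner locus *)

Definition edge_vec (a b : 'I_4 * 'I_4) : int * int := (b.1%:Z - a.1%:Z, b.2%:Z - a.2%:Z).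

Definition idot (a : 'I_4 * 'I_4) (u : int * int) : int := a.1%:Z * u.1 + a.2%:Z * u.2.

Lemma coprime_orthogonal (u d : int * int) : coprimez u.1 u.2 -> coprimez d.1 d.2 ->
  u.1 * d.1 + u.2 * d.2 = 0 -> u = (d.2, - d.1) \/ u = (- d.2, d.1).
Proof.
case: u d => [u1 u2] [d1 d2] /= cu cd e.
have h1 : (d1 %| u2)%Z.
  by rewrite -(Gauss_dvdzl _ cd); apply/dvdzP; exists (- u1); lia.
have h2 : (u2 %| d1)%Z.
  by rewrite coprimez_sym in cu; rewrite -(Gauss_dvdzr _ cu); apply/dvdzP; exists (- d2); lia.
have h3 : (d2 %| u1)%Z.
  by rewrite coprimez_sym in cd; rewrite -(Gauss_dvdzl _ cd); apply/dvdzP; exists (- u2); lia.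
have h4 : (u1 %| d2)%Z.
  by rewrite -(Gauss_dvdzr _ cu); apply/dvdzP; exists (- d1); lia.
have e1 : `|u1|%N = `|d2|%N by apply/eqP; rewrite eqn_dvd -!dvdzE h3 h4.
have e2 : `|u2|%N = `|d1|%N by apply/eqP; rewrite eqn_dvd -!dvdzE h1 h2.
have s1 : u1 = d2 \/ u1 = - d2 by clear -e1; lia.
have s2 : u2 = d1 \/ u2 = - d1 by clear -e2; lia.
clear h1 h2 h3 h4 e1 e2; case: s1 => s1; case: s2 => s2; subst.
- have h : d2 * d1 = 0 by clear -e; lia.
  have [->|->] : d1 = 0 \/ d2 = 0 by move/eqP: h; rewrite mulf_eq0 => /orP[]/eqP; [right|left].
    by left; rewrite oppr0.
  by right; rewrite oppr0.
- by left.
- by right.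
- have h : d2 * d1 = 0 by clear -e; lia.
  have [->|->] : d1 = 0 \/ d2 = 0 by move/eqP: h; rewrite mulf_eq0 => /orP[]/eqP; [right|left].
    by right; rewrite oppr0.
  by left; rewrite oppr0.
Qed.

Lemma unimodular_triangleP T a b : unimodular_triangle T -> a \in T -> b \in T -> a != b ->
  exists e, T = [set a; b; e]%SET /\ absz (det2 (edge_vec a b) (edge_vec a e)) = 1%N.
Proof.
move=> [p [q [r [-> h]]]]; rewrite !inE => ha hb ab.
have key x y z : [set p; q; r]%SET = [set x; y; z]%SET ->
    det2 (edge_vec x y) (edge_vec x z) = det2 (edge_vec p q) (edge_vec p r) \/
    det2 (edge_vec x y) (edge_vec x z) = - det2 (edge_vec p q) (edge_vec p r) ->
    exists e, [set p; q; r]%SET = [set x; y; e]%SET /\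
      absz (det2 (edge_vec x y) (edge_vec x e)) = 1%N.
  by move=> -> hd; exists z; split=> //; case: hd => ->; rewrite ?abszN.
case/orP: ha ab => [/orP[]|] /eqP->; case/orP: hb => [/orP[]|] /eqP->; rewrite ?eqxx // => _.
- by apply: (key p q r) => //; left.
- apply: (key p r q); last by right; rewrite /det2 /edge_vec /=; ring.
  by apply/setP => x; rewrite !inE orbAC.
- apply: (key q p r); last by right; rewrite /det2 /edge_vec /=; ring.
  by apply/setP => x; rewrite !inE (orbC (x == p)).
- apply: (key q r p); last by left; rewrite /det2 /edge_vec /=; ring.
  by apply/setP => x; rewrite !inE -orbA orbC.
- apply: (key r p q); last by left; rewrite /det2 /edge_vec /=; ring.
  by apply/setP => x; rewrite !inE orbC orbA.
- apply: (key r q p); last by right; rewrite /det2 /edge_vec /=; ring.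
  by apply/setP => x; rewrite !inE; case: (x == p); case: (x == q); case: (x == r).
Qed.

Section CornerStar.
Variables (R : realType) (c : 'I_4 -> 'I_4 -> R).

(** Just after leaving [p] in direction [u], the maximal terms are those of [argmax c p] with the
    largest [idot]; the curve contains this direction when at least two of them tie. *)
Lemma star_cornerP p u : star_rays (corner_locus c) p u <->
  coprimez u.1 u.2 /\ exists a b, [/\ a \in argmax c p, b \in argmax c p, a != b,
    idot a u = idot b u & forall e, e \in argmax c p -> idot e u <= idot a u].
Proof.
pose M := [set a in argmax c p | [forall (b | b \in argmax c p), idot b u <= idot a u]]%SET.
have memM a : (a \in M) = (a \in argmax c p) &&
    [forall (b | b \in argmax c p), idot b u <= idot a u] by rewrite inE.
have hM : \forall t \near (0 : R)^'+, argmax c (p.1 + t * u.1%:~R, p.2 + t * u.2%:~R) = M.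
  have ct : continuous (fun t : R => (p.1 + t * u.1%:~R, p.2 + t * u.2%:~R)) by cont.
  have : \forall t \near (0 : R), argmax c (p.1 + t * u.1%:~R, p.2 + t * u.2%:~R) =
    [set a in argmax c p | [forall (b | b \in argmax c p),
       trop_term c b (p.1 + t * u.1%:~R, p.2 + t * u.2%:~R) <=
       trop_term c a (p.1 + t * u.1%:~R, p.2 + t * u.2%:~R)]]%SET.
    apply: (near_cont (Q := fun y => argmax c y = [set a in argmax c p |
      [forall (b | b \in argmax c p), trop_term c b y <= trop_term c a y]]%SET) ct).
    by rewrite !mul0r !addr0 -surjective_pairing; apply: near_argmax.
  move=> /near0_norm[e e0 he]; near=> t.
  have t0 : 0 < t by [].
  rewrite he; last by rewrite gtr0_norm.
  apply/setP => a; rewrite memM inE; apply: andb_id2l => am; apply: eq_forallb => b.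
  have [bm|//] := boolP (b \in argmax c p); rewrite /= .
  have sl f : slope (u.1%:~R, u.2%:~R) f = (idot f u)%:~R :> R.
    by rewrite /slope /idot intrD !intrM !pmulrn.
  have := trop_term_shift c b p t (u.1%:~R, u.2%:~R); rewrite sl /= => ->.
  have := trop_term_shift c a p t (u.1%:~R, u.2%:~R); rewrite sl /= => ->.
  by rewrite (argmax_eq bm am) lerD2l ler_pM2l // ler_int.
have hM1 : (exists a b, [/\ a \in argmax c p, b \in argmax c p, a != b,
    idot a u = idot b u & forall e, e \in argmax c p -> idot e u <= idot a u]) <-> (1 < #|M|)%N.
  split=> [[a [b [am bm ab eab ha]]]|/card_gt1P[a [b [+ + ab]]]].
    apply/card_gt1P; exists a, b; split=> //; rewrite memM ?am ?bm /=; apply/forallP => e.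
      by apply/implyP => /ha.
    by apply/implyP => /ha; rewrite eab.
  rewrite !memM => /andP[am /forallP ha] /andP[bm /forallP hb].
  exists a, b; split=> //; last by move=> e em; have := ha e; rewrite em.
  apply/eqP; rewrite eq_le; apply/andP; split.
    by have := hb a; rewrite am.
  by have := ha b; rewrite bm.
rewrite hM1; split=> -[cu hu]; split=> //.
  near (0 : R)^'+ => t.
  have : corner_locus c (p.1 + t * u.1%:~R, p.2 + t * u.2%:~R) by near: t.
  rewrite /corner_locus /=.
  have -> // : argmax c (p.1 + t * u.1%:~R, p.2 + t * u.2%:~R) = M by near: t.
near=> t; rewrite /corner_locus /=.
by have -> : argmax c (p.1 + t * u.1%:~R, p.2 + t * u.2%:~R) = M by near: t.
Unshelve. all: end_near. Qed.

Lemma star_corner2 p a b : a != b -> coprimez (edge_vec a b).1 (edge_vec a b).2 ->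
  argmax c p = [set a; b]%SET ->
  star_rays (corner_locus c) p =
  [set` [:: ((edge_vec a b).2, - (edge_vec a b).1); (- (edge_vec a b).2, (edge_vec a b).1)]].
Proof.
move=> ab cab eS; apply/seteqP; split=> u /=.
  move=> /star_cornerP[cu [x [y [xm ym xy exy _]]]].
  have hu : u.1 * (edge_vec a b).1 + u.2 * (edge_vec a b).2 = 0.
    move: xm ym xy exy; rewrite eS !inE => /orP[]/eqP-> /orP[]/eqP->; rewrite ?eqxx // => _;
    rewrite /edge_vec /idot /=; lia.
  by rewrite !inE; have [->|->] := coprime_orthogonal cu cab hu; rewrite eqxx ?orbT.
move=> hu; apply/star_cornerP; split.
  move: hu; rewrite !inE => /orP[]/eqP->; rewrite /= coprimez_sym ?coprimeNz ?coprimezN //.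
exists a, b; rewrite eS !inE !eqxx orbT; split=> //.
  by move: hu; rewrite !inE => /orP[]/eqP->; rewrite /edge_vec /idot /=; ring.
move=> e; rewrite !inE => /orP[]/eqP-> //.
by move: hu; rewrite !inE => /orP[]/eqP->; rewrite /edge_vec /idot /= le_eqVlt; apply/orP; left;
   apply/eqP; ring.
Qed.

(** The edge vector turned by a right angle. When [s] is the orientation of the unimodular triangle,
    this is the primitive normal pointing away from the third vertex, which in the max convention is
    the direction of the dual ray. *)
Definition outer_normal (s : int) (a b : 'I_4 * 'I_4) : int * int :=
  (s * (edge_vec a b).2, - s * (edge_vec a b).1).

Lemma star_corner3 p a b e (s : int) : s = 1 \/ s = -1 ->
  det2 (edge_vec a b) (edge_vec a e) = s ->
  argmax c p = [set a; b; e]%SET ->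
  star_rays (corner_locus c) p =
  [set` [:: outer_normal s a b; outer_normal s b e; outer_normal s e a]].
Proof.
move=> s1 det_s eS.
have s2 : s * s = 1 by case: s1 => ->.
have half x y z u : det2 (edge_vec x y) (edge_vec x z) = s -> coprimez u.1 u.2 ->
    idot x u = idot y u -> idot z u <= idot x u -> u = outer_normal s x y.
  move=> dxyz cu exy hz.
  (* A determinant equal to 1 or -1 is a Bezout relation for the edge vector. *)
  have cd : coprimez (edge_vec x y).1 (edge_vec x y).2.
    apply/coprimezP; exists (s * (edge_vec x z).2, - s * (edge_vec x z).1) => /=.
    by rewrite -s2 -{3}dxyz /det2 /=; ring.
  have hu : u.1 * (edge_vec x y).1 + u.2 * (edge_vec x y).2 = 0.
    by move: exy; rewrite /idot /edge_vec /=; lia.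
  have hz' : idot z u - idot x u <= 0 by rewrite subr_le0.
  have := coprime_orthogonal cu cd hu; case: s1 => es; rewrite /outer_normal es => -[] eu.
  - by rewrite eu mul1r mulN1r.
  - exfalso; move: hz'; rewrite (_ : _ - _ = s); first by rewrite es.
    by rewrite -dxyz eu /idot /det2 /edge_vec /=; ring.
  - exfalso; move: hz'; rewrite (_ : _ - _ = - s); first by rewrite es.
    by rewrite -dxyz eu /idot /det2 /edge_vec /=; ring.
  - by rewrite eu opprK mul1r mulN1r.
have d2 : det2 (edge_vec b e) (edge_vec b a) = s by rewrite -det_s /det2 /edge_vec /=; ring.
have d3 : det2 (edge_vec e a) (edge_vec e b) = s by rewrite -det_s /det2 /edge_vec /=; ring.
apply/seteqP; split=> u /=.
  move=> /star_cornerP[cu [x [y [xm ym xy exy hm]]]].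
  have hx z : z \in [set a; b; e]%SET -> idot z u <= idot x u by rewrite -eS; apply: hm.
  have ha := hx a; have hb := hx b; have he := hx e.
  move: ha hb he; rewrite !inE !eqxx ?orbT => /(_ isT) ha /(_ isT) hb /(_ isT) he {hx hm}.
  move: xm ym xy exy ha hb he; rewrite eS !inE.
  move=> /orP[/orP[]|]/eqP-> /orP[/orP[]|]/eqP->; rewrite ?eqxx // => _ exy ha hb he.
  - by rewrite (half a b e u) ?eqxx.
  - by rewrite (half e a b u) ?eqxx ?orbT // -exy.
  - by rewrite (half a b e u) ?eqxx // -exy.
  - by rewrite (half b e a u) ?eqxx ?orbT.
  - by rewrite (half e a b u) ?eqxx ?orbT.
  - by rewrite (half b e a u) ?eqxx ?orbT // -exy.
have back x y z : det2 (edge_vec x y) (edge_vec x z) = s ->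
    argmax c p = [set x; y; z]%SET -> star_rays (corner_locus c) p (outer_normal s x y).
  move=> dxyz eS'; apply/star_cornerP; split.
    apply/coprimezP; exists (- (edge_vec x z).1, - (edge_vec x z).2) => /=.
    by rewrite -s2 -{3}dxyz /det2 /=; ring.
  exists x, y; rewrite eS' !inE !eqxx /= orbT; split=> //.
  - apply/eqP => exy; move: dxyz; rewrite exy /det2 /edge_vec /= !subrr !mul0r subrr.
    by move=> h; case: s1; rewrite -h.
  - by rewrite /idot /outer_normal /edge_vec /=; ring.
  move=> f; rewrite !inE => /orP[/orP[]|]/eqP-> //.
    by rewrite le_eqVlt; apply/orP; left; apply/eqP; rewrite /idot /outer_normal /edge_vec /=; ring.
  rewrite -subr_le0 (_ : _ - _ = - (s * s)); first by rewrite s2.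
  transitivity (- (s * det2 (edge_vec x y) (edge_vec x z))); last by rewrite dxyz.
  by rewrite /idot /outer_normal /det2 /edge_vec /=; ring.
rewrite !inE => /or3P[]/eqP->.
- exact: (back a b e).
- by apply: (back b e a) => //; rewrite eS; apply/setP => x; rewrite !inE -orbA orbC.
- by apply: (back e a b) => //; rewrite eS; apply/setP => x; rewrite !inE orbC orbA.
Qed.

End CornerStar.

(* Both sides of the vertical line at abscissa [i + 1/2] contain points of [S]. *)
Definition sep (S : {set 'I_4 * 'I_4}) (i : nat) : bool :=
  [exists a in S, (a.1 <= i)%N] && [exists a in S, (i < a.1)%N].

Lemma sep2 a b i : sep [set a; b]%SET i = ((minn a.1 b.1 <= i) && (i < maxn a.1 b.1))%N.
Proof.
rewrite geq_min leq_max; congr (_ && _); apply/existsP/orP.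
- by move=> [x /andP[]]; rewrite !inE => /orP[]/eqP-> h; [left|right].
- by case=> h; [exists a|exists b]; rewrite !inE eqxx ?orbT.
- by move=> [x /andP[]]; rewrite !inE => /orP[]/eqP-> h; [left|right].
- by case=> h; [exists a|exists b]; rewrite !inE eqxx ?orbT.
Qed.

Lemma sep3 a b e i : sep [set a; b; e]%SET i =
  ((minn (minn a.1 b.1) e.1 <= i) && (i < maxn (maxn a.1 b.1) e.1))%N.
Proof.
rewrite !geq_min !leq_max -!orbA; congr (_ && _); apply/existsP/or3P.
- by move=> [x /andP[]]; rewrite !inE => /orP[/orP[]|]/eqP-> h; [apply: Or31|apply: Or32|apply: Or33].
- by case=> h; [exists a|exists b|exists e]; rewrite !inE eqxx ?orbT.
- by move=> [x /andP[]]; rewrite !inE => /orP[/orP[]|]/eqP-> h; [apply: Or31|apply: Or32|apply: Or33].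
- by case=> h; [exists a|exists b|exists e]; rewrite !inE eqxx ?orbT.
Qed.

Lemma sum_between (m M : nat) : (m <= M)%N -> (M < 4)%N ->
  (\sum_(i < 3) ((m <= i) && (i < M)) = M - m)%N.
Proof.
by rewrite !big_ord_recr big_ord0 /=; case: M => [|[|[|[|]]]] //; case: m => [|[|[|[|]]]].
Qed.

(** * Intersection with a horizontal line *)

Definition horizontal : seq (int * int) := [:: (1, 0); (-1, 0)].

Lemma opposite_pair (d : int * int) : coprimez d.1 d.2 ->
  uniq [:: (d.2, - d.1); (- d.2, d.1)] /\
  forall u, u \in [:: (d.2, - d.1); (- d.2, d.1)] -> u != (0, 0).
Proof.
case: d => d1 d2 /= cd; have d0 : ~ (d1 = 0 /\ d2 = 0) by move=> [e1 e2]; rewrite e1 e2 in cd.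
split.
  rewrite inE andbT; apply/eqP => -[h1 h2]; apply: d0; split; clear -h1 h2; lia.
move=> u; rewrite !inE => /orP[]/eqP->; apply/eqP => -[h1 h2]; apply: d0; split; clear -h1 h2; lia.
Qed.

Section Horizontal.
Variables (R : realType) (c : 'I_4 -> 'I_4 -> R) (w : R * R).
Hypothesis gw : generic w.

(** The contribution of a ray with vertical component [x]. The displacement moves the horizontal
    line to height [w.2]; the ray reaches it when [x] has the sign of [w.2], then meets exactly one
    of its two halves, with lattice index the absolute value of [x]. *)
Let up (x : int) : nat := if (0 < w.2) == (0 < x) then absz x else 0.

Lemma mult_horizontal C D p su : uniq su -> (forall u, u \in su -> u != (0, 0)) ->
  star_rays C p = [set` su] -> star_rays D p = [set` horizontal] ->
  mult w C D p = (\sum_(u <- su) up u.2)%N.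
Proof.
move=> uu u0 eC eD; rewrite (mult_seq w eC eD uu) //.
rewrite !big_seq; apply: eq_bigr => u us; rewrite /horizontal !big_cons big_nil addn0.
have [_ w20 _] := generic_neq gw.
have d1 : det2 u (1, 0) = - u.2 by rewrite /det2 /=; ring.
have d2 : det2 u (-1, 0) = u.2 by rewrite /det2 /=; ring.
rewrite d1 d2 abszN /up.
have [e|un] := eqVneq u.2 0; first by rewrite e absz0 !if_same.
have m1 := @rays_meetP R w u (1, 0); rewrite d1 oppr_eq0 in m1.
have m2 := @rays_meetP R w u (-1, 0); rewrite d2 in m2.
have {}m1 := m1 un; have {}m2 := m2 un.
set X := w.1 * u.2%:~R - w.2 * u.1%:~R in m1 m2.
have X0 : X != 0.
  apply/eqP => h; have [|hu _] := gw (a := u.2) (b := - u.1); last by rewrite hu eqxx in un.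
  by rewrite -[RHS]h /X intrN; ring.
have uR : u.2%:~R != 0 :> R by rewrite intr_eq0.
have us2 : (0 < u.2%:~R :> R) = (0 < u.2) by rewrite ltr0z.
have hs : (0 < w.2) = (0 < u.2) ->
    (`[< rays_meet w u (1, 0)%R >] + `[< rays_meet w u (-1, 0)%R >])%N = 1%N.
  rewrite -us2 => h.
  have wu : 0 < w.2 * u.2%:~R.
    case: (ltgtP w.2 0) w20 h => // hw _; case: (ltgtP (u.2%:~R : R) 0) uR => // hu' _ //= _.
      by rewrite nmulr_rgt0.
    by rewrite pmulr_rgt0.
  have {}m1 : rays_meet w u (1, 0) <-> 0 <= X * - u.2%:~R.
    rewrite m1 /= mulr0z mulr1z intrN; split=> [[]//|h']; split=> //.
    by rewrite mulr0 sub0r mulr1 mulrNN ltW.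
  have {}m2 : rays_meet w u (-1, 0) <-> 0 <= X * u.2%:~R.
    rewrite m2 /= mulr0z mulrN1z; split=> [[]//|h']; split=> //.
    by rewrite mulr0 sub0r mulrN1 opprK ltW.
  have XU : X * u.2%:~R != 0 by rewrite mulf_neq0.
  case: (ltgtP (X * u.2%:~R) 0) XU => // hX _.
    have r1 : rays_meet w u (1, 0) by apply/m1; rewrite mulrN oppr_ge0 ltW.
    have r2 : ~ rays_meet w u (-1, 0) by move/m2; rewrite leNgt hX.
    by rewrite (asboolT r1) (asboolF r2).
  have r1 : ~ rays_meet w u (1, 0) by move/m1; rewrite mulrN oppr_ge0 leNgt hX.
  have r2 : rays_meet w u (-1, 0) by apply/m2; rewrite ltW.
  by rewrite (asboolF r1) (asboolT r2).
have hs0 : (0 < w.2) != (0 < u.2) ->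
    ~ rays_meet w u (1, 0) /\ ~ rays_meet w u (-1, 0).
  rewrite -us2 => h.
  have wu : w.2 * u.2%:~R < 0.
    case: (ltgtP w.2 0) w20 h => // hw _; case: (ltgtP (u.2%:~R : R) 0) uR => // hu' _ //= _.
      by rewrite nmulr_rlt0.
    by rewrite pmulr_rlt0.
  split; [move/m1|move/m2] => /= -[].
    by rewrite mulr0z mulr1z intrN mulr0 sub0r mulr1 mulrNN leNgt wu.
  by rewrite mulr0z mulrN1z mulr0 sub0r mulrN1 opprK leNgt wu.
case: eqP => [/hs|/eqP/hs0[n1 n2]]; last by rewrite !asboolF.
by case: asboolP => _; case: asboolP => _ //= _; rewrite ?addn0 ?add0n.
Qed.

Let up_opp2 x : (up x + up (- x) = absz x)%N.
Proof.
have [_ w20 _] := generic_neq gw.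
rewrite /up abszN oppr_gt0; case: (ltgtP x 0) => [||->]; last by rewrite !if_same.
  by case: (ltgtP w.2 0) w20 => // _ _ _ /=; rewrite ?addn0.
by case: (ltgtP w.2 0) w20 => // _ _ _ /=; rewrite ?addn0.
Qed.

(** Around a closed cycle of three numbers the increases add up to the range, and so do the
    decreases. *)
Let sum_up_cycle (a b e : nat) (s : int) : s = 1 \/ s = -1 ->
  (up (s * (a%:Z - b%:Z)) + up (s * (b%:Z - e%:Z)) + up (s * (e%:Z - a%:Z)) =
   maxn (maxn a b) e - minn (minn a b) e)%N.
Proof.
have [_ w20 _] := generic_neq gw.
rewrite /up; move=> [] ->; case: (ltgtP w.2 0) w20 => // _ _;
  rewrite ?mul1r ?mulN1r /maxn /minn;
  repeat case: ifP; lia.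
Qed.

(* The multiplicity is the horizontal width of the dual cell, because the rays above
   (or below) the horizontal line are dual to a monotone half of its boundary. *)
Lemma mult_horizontal_corner D p T : unimodular_triangle T -> argmax c p \subset T ->
  corner_locus c p -> star_rays D p = [set` horizontal] ->
  mult w (corner_locus c) D p = (\sum_(i < 3) sep (argmax c p) i)%N.
Proof.
move=> uT /fintype.subsetP sT corner eD.
have /card_gt1P[a [b [am bm ab]]] := corner.
have [e [eT det1]] := unimodular_triangleP uT (sT _ am) (sT _ bm) ab.
have sab : {subset argmax c p <= [set a; b; e]%SET} by rewrite -eT.
have [em|em] := boolP (e \in argmax c p); last first.
  have eS : argmax c p = [set a; b]%SET.
    apply/setP => x; rewrite in_set2; apply/idP/orP => [xm|[]/eqP->//].
    have := sab _ xm; rewrite !inE => /orP[/orP//|/eqP ex]; by rewrite -ex xm in em.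
  have cab : coprimez (edge_vec a b).1 (edge_vec a b).2.
    apply/coprimezP; exists ((edge_vec a e).2 * sgz (det2 (edge_vec a b) (edge_vec a e)),
      - (edge_vec a e).1 * sgz (det2 (edge_vec a b) (edge_vec a e))) => /=.
    transitivity (det2 (edge_vec a b) (edge_vec a e) * sgz (det2 (edge_vec a b) (edge_vec a e))).
      by move: (sgz _) => x; rewrite /det2 /edge_vec /=; ring.
    by rewrite mulrC -abszEsg det1.
  have hst := star_corner2 ab cab eS.
  have [uq nz] := opposite_pair cab.
  rewrite (mult_horizontal uq nz hst eD).
  rewrite !big_cons big_nil /= addn0 addnC up_opp2 eS.
  under eq_bigr do rewrite sep2.
  by rewrite sum_between ?gtn_max ?ltn_ord // /edge_vec /=; lia.
have eS : argmax c p = [set a; b; e]%SET.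
  apply/setP => x; apply/idP/idP => [xm|]; first exact: sab.
  by move=> /finset.setUP[/finset.set2P[]|/finset.set1P] ->.
have [s s1 ds] : exists2 s, s = 1 \/ s = -1 & det2 (edge_vec a b) (edge_vec a e) = s.
  by exists (det2 (edge_vec a b) (edge_vec a e)) => //; clear -det1; lia.
have hst := star_corner3 s1 ds eS.
have s0 : s != 0 by case: s1 => ->.
have neq0 x y z : det2 (edge_vec x y) (edge_vec x z) = s -> outer_normal s x y != (0, 0).
  move=> dxyz; apply/eqP => -[/eqP h1 /eqP h2]; move: h1 h2.
  rewrite !mulf_eq0 oppr_eq0 (negbTE s0) /= => /eqP h1 /eqP h2.
  by move: s0; rewrite -dxyz /det2 /edge_vec /= h1 h2 !mul0r subrr eqxx.
have d2 : det2 (edge_vec b e) (edge_vec b a) = s by rewrite -ds /det2 /edge_vec /=; ring.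
have d3 : det2 (edge_vec e a) (edge_vec e b) = s by rewrite -ds /det2 /edge_vec /=; ring.
have dist x y z : det2 (edge_vec x y) (edge_vec x z) = s -> outer_normal s x y != outer_normal s y z.
  move=> dxyz; apply/eqP => -[h1 h2]; move: (s0); rewrite -dxyz.
  have {}h1 : (edge_vec x y).2 = (edge_vec y z).2 by apply: (mulfI s0).
  have {}h2 : (edge_vec x y).1 = (edge_vec y z).1.
    by apply: (mulfI (x := - s)); rewrite ?oppr_eq0.
  rewrite /det2 (_ : (edge_vec x z).1 = (edge_vec x y).1 + (edge_vec y z).1); last first.
    by rewrite /edge_vec /=; ring.
  rewrite (_ : (edge_vec x z).2 = (edge_vec x y).2 + (edge_vec y z).2); last first.
    by rewrite /edge_vec /=; ring.
  by move/eqP; apply; rewrite -h1 -h2; ring.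
rewrite (mult_horizontal _ _ hst eD); last 2 first.
- by rewrite /= !inE negb_or (dist a b e) // (dist b e a) // eq_sym (dist e a b).
- by move=> u; rewrite !inE => /or3P[]/eqP->; [exact: (neq0 a b e)|exact: (neq0 b e a)|exact: (neq0 e a b)].
rewrite !big_cons big_nil /= addn0 addnA eS.
under [RHS]eq_bigr do rewrite sep3.
rewrite sum_between ?gtn_max ?ltn_ord //; last by lia.
rewrite -(sum_up_cycle _ _ _ s1) /edge_vec /=.
by congr (up _ + up _ + up _)%N; ring.
Qed.

End Horizontal.

(** * Legs with an odd number of crossings *)

(** Smoothness in terms of exponents instead of polytopes. The multiplicity computations work with
    this form, and it is stable under relabelling of the exponents. *)
Definition fits_unimodular (R : realType) (c : 'I_4 -> 'I_4 -> R) :=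
  forall v, exists T, unimodular_triangle T /\ argmax c v \subset T.

Section Curves.
Variable R : realType.
Implicit Types (p q v w : R * R) (z : R * R * R) (C D K X : set (R * R)).

(** Replaces the parameters of rays and segments by linear conditions, on which linear arithmetic
    can decide. At l = 0 the edge degenerates to a point, so the description still holds. *)
Lemma curve11_ge0 z p : 0 <= z.2 -> curve11 z p <->
  [\/ z.1.1 <= p.1 <= z.1.1 + z.2 /\ p.2 - z.1.2 = p.1 - z.1.1,
      p.1 <= z.1.1 /\ p.2 = z.1.2, p.1 = z.1.1 /\ p.2 <= z.1.2 |
      (z.1.1 + z.2 <= p.1 /\ p.2 = z.1.2 + z.2) \/
      (p.1 = z.1.1 + z.2 /\ z.1.2 + z.2 <= p.2)].
Proof.
case: z p => [[x y] l] [p1 p2] /= l0.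
rewrite /curve11 /vertex0 /vertex1 /= l0; split.
  move=> [[t t01 [e1 e2]]|[[[]|]|] [t t0 [e1 e2]]]; move: e1 e2 => /= -> ->.
  - by apply: Or41; split; [apply/andP; split; nra|ring].
  - by apply: Or42; split; nra.
  - by apply: Or43; split; nra.
  - by apply: Or44; left; split; nra.
  - by apply: Or44; right; split; nra.
move=> [[h1 h2]|[h1 h2]|[h1 h2]|[[h1 h2]|[h1 h2]]].
- left; have [e|l1] := eqVneq l 0.
    by exists 0; rewrite ?lexx ?ler01 //= !mul0r; congr (_, _); rewrite e in h1; lra.
  have l2 : 0 < l by rewrite lt_neqAle eq_sym l1.
  exists ((p1 - x) / l); first by rewrite ler_pdivrMr // ler_pdivlMr //; lra.
  have -> : p2 = y + (p1 - x) by lra.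
  by congr (_, _) => /=; field.
- right; do 3 left; exists (x - p1) => /=; first by lra.
  by congr (_, _); lra.
- right; do 2 left; right; exists (y - p2) => /=; first by lra.
  by congr (_, _); lra.
- right; left; right; exists (p1 - (x + l)) => /=; first by lra.
  by congr (_, _); lra.
- right; right; exists (p2 - (y + l)) => /=; first by lra.
  by congr (_, _); lra.
Qed.

Lemma star_line p (a : int * int) : coprimez a.1 a.2 ->
  star_rays [set q : R * R | a.1%:~R * (q.1 - p.1) + a.2%:~R * (q.2 - p.2) = 0] p =
  [set` [:: (a.2, - a.1); (- a.2, a.1)]].
Proof.
move=> ca; have key (t : R) (u : int * int) :
    a.1%:~R * (p.1 + t * u.1%:~R - p.1) + a.2%:~R * (p.2 + t * u.2%:~R - p.2) =
    t * (u.1 * a.1 + u.2 * a.2)%:~R by rewrite intrD !intrM; ring.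
apply/seteqP; split=> u /=.
  move=> [cu hu]; have h0 : u.1 * a.1 + u.2 * a.2 = 0.
    near (0 : R)^'+ => t.
    have /eqP : [set q : R * R | a.1%:~R * (q.1 - p.1) + a.2%:~R * (q.2 - p.2) = 0]
      (p.1 + t * u.1%:~R, p.2 + t * u.2%:~R) by near: t.
    rewrite /= key mulf_eq0 intr_eq0 => /orP[/eqP t0|/eqP//].
    have : 0 < t by [].
    by rewrite t0 ltxx.
  by rewrite !inE; have [->|->] := coprime_orthogonal cu ca h0; rewrite eqxx ?orbT.
move=> hu; split.
  by move: hu; rewrite !inE => /orP[]/eqP->; rewrite /= coprimez_sym ?coprimeNz ?coprimezN.
near=> t; rewrite /= key; move: hu; rewrite !inE => /orP[]/eqP-> /=.
  by rewrite (_ : _ + _ = 0) ?mulr0 //; ring.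
by rewrite (_ : _ + _ = 0) ?mulr0 //; ring.
Unshelve. all: by end_near. Qed.

Lemma connected_side (T : topologicalType) (K : set T) (f : T -> R) (m : R) x y :
  connected K -> continuous f -> (forall u, K u -> f u != m) ->
  K x -> K y -> f x < m -> f y < m.
Proof.
move=> cK cf fm Kx Ky fx; rewrite ltNge; apply/negP => fy.
have /connected_intervalP I : connected (f @` K).
  by apply: connected_continuous_connected => //; apply: continuous_subspaceT.
have [] := I (f x) (f y) _ _ m.
- by exists x.
- by exists y.
- by rewrite ltW.
by move=> u Ku fu; have := fm u Ku; rewrite fu eqxx.
Qed.

Lemma near_lt (T : topologicalType) (f : T -> R) (x : T) (m : R) :
  continuous f -> f x < m -> \forall y \near x, f y < m.
Proof. by move=> cf; apply: cvgr_lt; exact: cf. Qed.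

Lemma near_gt (T : topologicalType) (f : T -> R) (x : T) (m : R) :
  continuous f -> m < f x -> \forall y \near x, m < f y.
Proof. by move=> cf; apply: cvgr_gt; exact: cf. Qed.

Lemma fst_continuous : continuous (fun p : R * R => p.1).
Proof. by cont. Qed.

Lemma snd_continuous : continuous (fun p : R * R => p.2).
Proof. by cont. Qed.

(** The points [q i] may coincide; a multiple point is then counted once for each index. *)
Lemma total_mult_points w C D K n (q : 'I_n -> R * R) :
  (forall p, K p -> mult w C D p = \sum_(i < n) (p == q i))%N ->
  total_mult w C D K = (\sum_(i < n) (q i \in K))%N.
Proof.
move=> hK; pose r := undup [seq q i | i <- enum 'I_n].
have qr i : q i \in r by rewrite mem_undup map_f // mem_enum.
transitivity (\sum_(p \in K) mult w C D p)%N; first by [].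
rewrite (eq_fsbigr (fun p => \sum_(i < n) (p == q i))%N); last first.
  by move=> p; rewrite inE => /hK.
rewrite -(@fsbig_widen _ _ _ _ (K `&` [set` r]) K); last 2 first.
- by move=> p [].
- move=> p [Kp np] /=; apply: big1 => i _; case: eqP => // e.
  by exfalso; apply: np; split=> //=; rewrite e.
have -> : (\sum_(p \in K `&` [set` r]) \sum_(i < n) (p == q i))%N =
   (\sum_(p <- [seq x <- r | x \in K]) \sum_(i < n) (p == q i))%N.
  rewrite [RHS](fsbig_seq addn) ?filter_uniq ?undup_uniq //; apply: eq_fsbigl.
  apply/seteqP; split=> p /=; rewrite mem_filter.
    by move=> [Kp ->]; rewrite andbT inE.
  by move=> /andP[]; rewrite inE.
rewrite exchange_big; apply: eq_bigr => i _ /=.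
have [qK|qK] := boolP (q i \in K).
  rewrite (bigD1_seq (q i)) ?mem_filter ?qK ?filter_uniq ?undup_uniq //= ?eqxx big1 ?addn0 //.
  by move=> p /negbTE ->.
rewrite big_seq big1 // => p; rewrite mem_filter => /andP[pK _].
by case: eqP => // e; rewrite -e pK in qK.
Qed.

End Curves.

Section OddLeft.
Variables (R : realType) (c : 'I_4 -> 'I_4 -> R) (w : R * R) (z : R * R * R).
Hypotheses (gw : generic w) (smooth : fits_unimodular c) (l0 : 0 <= z.2).

Let Gamma := corner_locus c.
Let Lambda := curve11 z.
Let X := Lambda `&` Gamma.

Lemma left_leg_star p : p.1 < z.1.1 -> p.2 = z.1.2 ->
  star_rays Lambda p = [set` horizontal].
Proof.
have l0' := l0; move=> p1 p2; have := star_line p (a := (0, 1)) isT.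
rewrite /= oppr0 => <-; apply: star_rays_near.
apply: nbhs_sub (near_lt (@fst_continuous R) p1) => q /= q1.
rewrite mul0r add0r mul1r p2 /Lambda (curve11_ge0 _ l0); split.
  move=> [[/andP[h _] _]|[_ h]|[h _]|[[h _]|[h _]]]; lra.
by move=> h; apply: Or42; split; lra.
Qed.

(** On the (1,1)-curve the function [f] is negative on the open left leg, vanishes only at [v_0],
    and is positive elsewhere. Since [v_0] is off the given curve, a component of the intersection
    cannot change sign. *)
Lemma left_leg_component p q : ~ Gamma z.1 -> X p -> p.1 < z.1.1 -> p.2 = z.1.2 ->
  connected_component X p q -> [/\ X q, q.1 < z.1.1 & q.2 = z.1.2].
Proof.
have l0' := l0; move=> vG Xp p1 p2 Kq; have Xq := connected_component_sub Kq.
pose f (q : R * R) : R := q.1 - z.1.1 + 2 * `|q.2 - z.1.2|.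
have cf : continuous f by rewrite /f; cont.
have fm u : X u -> f u != 0.
  move=> [Lu Gu]; apply/eqP; rewrite /f => fu; apply: vG.
  suff -> : z.1 = u by [].
  have := normr_ge0 (u.2 - z.1.2); move: Lu fu; rewrite /Lambda (curve11_ge0 _ l0) => Lu fu h.
  have a1 := ler_norm (u.2 - z.1.2); have a2 := ler_norm (- (u.2 - z.1.2)).
  rewrite normrN in a2.
  rewrite [z.1]surjective_pairing [u]surjective_pairing; move: Lu.
  case=> [[/andP[h1 _] h2]|[h1 h2]|[h1 h2]|[[h1 h2]|[h1 h2]]].
  - by congr (_, _); lra.
  - by rewrite h2 subrr normr0 in fu; congr (_, _); lra.
  - by congr (_, _); lra.
  - by congr (_, _); lra.
  - by congr (_, _); lra.
have fq : f q < 0.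
  apply: (@connected_side _ _ (connected_component X p) f 0 p q) => //.
  - exact: component_connected.
  - by move=> u /connected_component_sub/fm.
  - exact: connected_component_refl.
  - by rewrite /f p2 subrr normr0; lra.
split=> //; have := normr_ge0 (q.2 - z.1.2).
  by rewrite /f in fq; lra.
case: Xq => [+ _]; rewrite /Lambda (curve11_ge0 _ l0) /f in fq * => Lq h.
by move: Lq => [[/andP[h1 _] h2]|[h1 h2]|[h1 h2]|[[h1 h2]|[h1 h2]]] //; lra.
Qed.

Let left_half (i : nat) : {set 'I_4 * 'I_4} := [set b : 'I_4 * 'I_4 | (b.1 <= i)%N].

(** The abscissa relative to [v_0] at which, on the horizontal line through [v_0], the first
    exponent of the maximal terms jumps from at most [i] to more than [i]. *)
Let tau (i : nat) := crossing c (left_half i) (ord0, ord0) (ord_max, ord0) (1, 0) z.1.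

Let slope_left (i : nat) (a b : 'I_4 * 'I_4) : a \in left_half i -> b \notin left_half i ->
  slope (1, 0) a < slope (1, 0) b :> R.
Proof.
rewrite !inE -ltnNge /slope /= !mulr1 !mulr0 !addr0 ltr_nat => h1 h2.
exact: leq_ltn_trans h1 h2.
Qed.

Let tau_shift (t : R) : (z.1.1 + t * 1, z.1.2 + t * 0) = (z.1.1 + t, z.1.2).
Proof. by rewrite mulr1 mulr0 addr0. Qed.

(** [sep] says that neither the left half nor its complement contains all maximal terms; by
    [crossing_gt] and [crossing_lt] this excludes both strict inequalities between the abscissa and
    [tau i]. *)
Let sep_tau (i : 'I_3) p : p.2 = z.1.2 ->
  sep (argmax c p) i = (p == (z.1.1 + tau i, z.1.2)).
Proof.
move=> p2; pose t := p.1 - z.1.1.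
have ep : p = (z.1.1 + t, z.1.2).
  by rewrite [p]surjective_pairing p2 /t addrC subrK.
have i1 : (ord0, ord0) \in left_half i by rewrite inE.
have i2 : (ord_max, ord0) \notin left_half i by rewrite inE /= -ltnNge.
have gtt := crossing_gt c i1 i2 (@slope_left i) z.1 t.
have ltt := crossing_lt c i1 i2 (@slope_left i) z.1 t.
rewrite /= tau_shift -ep -/(tau i) in gtt ltt.
have -> : (p == (z.1.1 + tau i, z.1.2)) = (t == tau i).
  by rewrite ep xpair_eqE eqxx andbT (inj_eq (addrI _)).
have -> : sep (argmax c p) i = ~~ (argmax c p \subset ~: left_half i) &&
                               ~~ (argmax c p \subset left_half i).
  rewrite /sep; congr (_ && _).
    apply/existsP/subsetPn => [[a /andP[am h]]|[a am h]]; exists a => //.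
      by rewrite !inE negbK.
    by rewrite am; move: h; rewrite !inE negbK.
  apply/existsP/subsetPn => [[a /andP[am h]]|[a am h]]; exists a => //.
    by rewrite !inE -ltnNge.
  by rewrite am; move: h; rewrite !inE -ltnNge.
by rewrite -gtt -ltt -!leNgt eq_le andbC.
Qed.

(* The left leg crosses the curve [a.1] times with multiplicity, once per crossing
   [q i] between exponents [i] and [i + 1], and its components avoid the rest of the
   curve; an odd number of points cannot be grouped into components of even total. *)
Lemma odd_left a : argmax c z.1 = [set a]%SET -> odd a.1 ->
  ~ tritangent_disp w Gamma Lambda.
Proof.
have l0' := l0; move=> ea oa tri.
have vG : ~ Gamma z.1 by apply: notin_corner ea.
pose q (i : 'I_3) : R * R := (z.1.1 + tau i, z.1.2).
(* At [v_0] the term [a] alone is maximal, so jump number [i] lies to the left of [v_0] exactly when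
   [i < a.1]. *)
have tau0 (i : 'I_3) : (tau i < 0) = (i < a.1)%N.
  have i1 : (ord0, ord0) \in left_half i by rewrite inE.
  have i2 : (ord_max, ord0) \notin left_half i by rewrite inE /= -ltnNge.
  have ltt := crossing_lt c i1 i2 (@slope_left i) z.1 0.
  rewrite /tau ltt /= tau_shift addr0 -surjective_pairing ea finset.sub1set !inE.
  by rewrite -ltnNge.
have sepq (i : 'I_3) : sep (argmax c (q i)) i by rewrite sep_tau //= eqxx.
have Gq (i : 'I_3) : Gamma (q i).
  have /andP[/existsP[x /andP[xm hx]] /existsP[y /andP[ym hy]]] := sepq i.
  apply/card_gt1P; exists x, y; split=> //; apply/eqP => exy.
  by move: hy; rewrite ltnNge -exy hx.
have Xq (i : 'I_3) : (i < a.1)%N -> X (q i).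
  move=> ia; split; last exact: Gq.
  rewrite /Lambda (curve11_ge0 _ l0); apply: Or42; split=> //=.
  by have := tau0 i; rewrite ia; lra.
pose K i := connected_component X (q i).
have Kleft (i : 'I_3) p : (i < a.1)%N -> K i p -> [/\ X p, p.1 < z.1.1 & p.2 = z.1.2].
  move=> ia; apply: left_leg_component => //; first exact: Xq.
  by rewrite /=; have := tau0 i; rewrite ia; lra.
have totalK (i : 'I_3) : (i < a.1)%N ->
    total_mult w Gamma Lambda (K i) = (\sum_(j < 3) (q j \in K i))%N.
  move=> ia; apply: total_mult_points => p /(Kleft i p ia)[[Lp Gp] p1 p2].
  have [T [uT sT]] := smooth p.
  rewrite (mult_horizontal_corner gw uT sT Gp (left_leg_star p1 p2)).
  by apply: eq_bigr => j _; rewrite sep_tau.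
have evenK (i : 'I_3) : (i < a.1)%N -> ~~ odd (\sum_(j < 3) (q j \in K i))%N.
  by move=> ia; rewrite -totalK //; apply: components_even => //; exact: Xq.
have outK (i j : 'I_3) : (i < a.1)%N -> (a.1 <= j)%N -> (q j \in K i) = false.
  move=> ia ja; apply/negP; rewrite inE => /(Kleft i _ ia)[_ + _] /=.
  by have := tau0 j; rewrite ltnNge ja /=; lra.
have selfK (i : 'I_3) : (i < a.1)%N -> (q i \in K i) = true.
  by move=> ia; apply: mem_set; apply: connected_component_refl; exact: Xq.
have symK (i j : 'I_3) : q j \in K i -> K i = K j.
  by rewrite inE => /same_connected_component.
have := oa; have : (a.1 < 4)%N by exact: ltn_ord.
pose i0 : 'I_3 := @Ordinal 3 0 isT; pose i1 : 'I_3 := @Ordinal 3 1 isT.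
pose i2 : 'I_3 := @Ordinal 3 2 isT.
have sum3 (F : 'I_3 -> nat) : (\sum_(j < 3) F j = F i0 + F i1 + F i2)%N.
  rewrite !big_ord_recl big_ord0 addn0 addnA.
  by congr (F _ + F _ + F _)%N; apply: val_inj.
case ea1 : (a.1 : nat) => [|[|[|[|]]]] // _ _.
  have := evenK i0; rewrite ea1 => /(_ isT).
  by rewrite sum3 selfK ?ea1 // !outK ?ea1.
have ii (i : 'I_3) : (i < a.1)%N by rewrite ea1 ltn_ord.
have E0 := evenK i0 (ii _); have E1 := evenK i1 (ii _); have E2 := evenK i2 (ii _).
rewrite !sum3 !selfK // in E0 E1 E2.
(* Now [a.1 = 3]. The component of the first point holds exactly one of the two other points by
   parity, and the component of the remaining point then contains that point alone. *)
have [h01|h01] := boolP (q i1 \in K i0).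
  have e01 := symK _ _ h01.
  have h02 : (q i2 \in K i0) = false by apply/negbTE; move: E0; rewrite h01; case: (_ \in _).
  have h20 : (q i0 \in K i2) = false.
    by apply/negbTE; apply: contraFN h02 => h; rewrite -(symK _ _ h) selfK.
  have h21 : (q i1 \in K i2) = false.
    by apply/negbTE; apply: contraFN h02 => h; rewrite e01 -(symK _ _ h) selfK.
  by rewrite h20 h21 in E2.
have h02 : (q i2 \in K i0) by move: E0; rewrite (negbTE h01); case: (_ \in _).
have e02 := symK _ _ h02.
have h10 : (q i0 \in K i1) = false.
  by apply/negbTE; apply: contra h01 => h; rewrite -(symK _ _ h) selfK.
have h12 : (q i2 \in K i1) = false.
  by apply/negbTE; apply: contra h01 => h; rewrite e02 -(symK _ _ h) selfK.
by rewrite h10 h12 in E1.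
Qed.

End OddLeft.

(** * Lowest vertices with maximal terms among (0,0), (1,0), (0,1) *)

Definition one4 : 'I_4 := @Ordinal 4 1 isT.
Definition p00 : 'I_4 * 'I_4 := (ord0, ord0).
Definition p10 : 'I_4 * 'I_4 := (one4, ord0).
Definition p01 : 'I_4 * 'I_4 := (ord0, one4).
Definition low : {set 'I_4 * 'I_4} := [set a : 'I_4 * 'I_4 | (a.1 + a.2 <= 1)%N]%SET.

Lemma lowP a : a \in low -> [\/ a = p00, a = p10 | a = p01].
Proof.
case: a => [[[|[|i]] hi] [[|[|j]] hj]]; rewrite inE //= => _.
- by apply: Or31; congr (_, _); apply: val_inj.
- by apply: Or33; congr (_, _); apply: val_inj.
- by apply: Or32; congr (_, _); apply: val_inj.
Qed.

Lemma pair_swap_set (T : eqType) (x y : T) : [set` [:: x; y]] = [set` [:: y; x]].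
Proof. by apply/seteqP; split=> u; rewrite /= !inE orbC. Qed.

Section LowCells.
Variables (R : realType) (c : 'I_4 -> 'I_4 -> R).
Implicit Types (p q v w : R * R) (z : R * R * R) (t : R).

(** The maximal term [a] has the largest slope of all, so no new term can catch up at any distance;
    the ties at [v] are broken by slope. *)
Lemma argmax_direction a v d t : a \in argmax c v ->
  (forall b, slope d b <= slope d a) -> 0 < t ->
  argmax c (v.1 + t * d.1, v.2 + t * d.2) =
  [set b in argmax c v | slope d b == slope d a]%SET.
Proof.
move=> am da t0; apply/setP => b; rewrite [RHS]inE; apply/argmaxP/andP => [h|[bm /eqP e] f].
  have := h a; rewrite !trop_term_shift => hab; have := da b => sab.
  have ba : trop_term c b v <= trop_term c a v by move/argmaxP: am.
  have sba : slope d b = slope d a by nra.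
  by split; [apply: (argmax_in am); rewrite sba in hab; lra|rewrite sba].
rewrite !trop_term_shift e (argmax_eq bm am).
have fa : trop_term c f v <= trop_term c a v by move/argmaxP: am.
by have := da f; nra.
Qed.

Lemma argmax_left a v t : a \in argmax c v -> a.1 = ord0 -> 0 < t ->
  argmax c (v.1 - t, v.2) = [set b in argmax c v | b.1 == ord0]%SET.
Proof.
move=> am a1 t0; pose d : R * R := (-1, 0).
have sd (b : 'I_4 * 'I_4) : slope d b = - b.1%:R by rewrite /slope /d /=; ring.
rewrite (_ : (v.1 - t, v.2) = (v.1 + t * d.1, v.2 + t * d.2)); last by congr (_, _) => /=; ring.
rewrite (argmax_direction am _ t0).
  by apply/setP => b; rewrite [LHS]inE [RHS]inE !sd a1 oppr0 oppr_eq0 pnatr_eq0.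
by move=> b; rewrite !sd a1 oppr0 oppr_le0 ler0n.
Qed.

Lemma argmax_down a v t : a \in argmax c v -> a.2 = ord0 -> 0 < t ->
  argmax c (v.1, v.2 - t) = [set b in argmax c v | b.2 == ord0]%SET.
Proof.
move=> am a1 t0; pose d : R * R := (0, -1).
have sd (b : 'I_4 * 'I_4) : slope d b = - b.2%:R by rewrite /slope /d /=; ring.
rewrite (_ : (v.1, v.2 - t) = (v.1 + t * d.1, v.2 + t * d.2)); last by congr (_, _) => /=; ring.
rewrite (argmax_direction am _ t0).
  by apply/setP => b; rewrite [LHS]inE [RHS]inE !sd a1 oppr0 oppr_eq0 pnatr_eq0.
by move=> b; rewrite !sd a1 oppr0 oppr_le0 ler0n.
Qed.

(** In direction (1,1) the slope of an exponent is the sum of its coordinates, at most 1 on [low]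
    and at least 2 elsewhere, as the crossing time requires. *)
Definition sigma v : R := crossing c low p00 (ord_max, ord0) (1, 1) v.

Let slope_low (a b : 'I_4 * 'I_4) : a \in low -> b \notin low ->
  slope (1, 1) a < slope (1, 1) b :> R.
Proof.
rewrite !inE -ltnNge /slope /= !mulr1 -!natrD ltr_nat => h1 h2.
exact: leq_ltn_trans h1 h2.
Qed.

Let low0 : p00 \in low. Proof. by rewrite inE. Qed.
Let lown : (ord_max, ord0) \notin low. Proof. by rewrite inE. Qed.

Lemma sigma_gt v t : (t < sigma v) = (argmax c (v.1 + t, v.2 + t) \subset low).
Proof. by rewrite (crossing_gt c low0 lown slope_low) /= mulr1. Qed.

Lemma sigma_gt0 v : (0 < sigma v) = (argmax c v \subset low).
Proof. by rewrite sigma_gt !addr0 -surjective_pairing. Qed.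

Lemma sigma_shift v t : sigma (v.1 + t, v.2 + t) = sigma v - t.
Proof. by have := crossing_shift c low0 lown slope_low v t; rewrite /= mulr1. Qed.

Lemma sigma_continuous : continuous sigma.
Proof. exact: crossing_continuous. Qed.

(** Before time [sigma] only terms of [low] compete. Those with coordinate sum 1 grow faster than
    (0,0), and one of them is already maximal at [v], so (0,0) loses at once. *)
Lemma argmax_diagonal a v t : a \in argmax c v -> (a.1 + a.2 = 1)%N -> 0 < t < sigma v ->
  argmax c (v.1 + t, v.2 + t) = [set b in argmax c v | (b.1 + b.2 == 1)%N]%SET.
Proof.
move=> am a1 /andP[t0]; rewrite sigma_gt => /fintype.subsetP sl.
have sh b : trop_term c b (v.1 + t, v.2 + t) = trop_term c b v + t * (b.1 + b.2)%N%:R.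
  by have := trop_term_shift c b v t (1, 1); rewrite /slope /= !mulr1 natrD.
have le_a b : b \in low -> trop_term c b (v.1 + t, v.2 + t) <= trop_term c a (v.1 + t, v.2 + t).
  rewrite inE !sh a1 => b1; have : (b.1 + b.2)%N%:R <= 1 :> R by rewrite (ler_nat R _ 1).
  by have : trop_term c b v <= trop_term c a v by [move/argmaxP: am]; nra.
have am' : a \in argmax c (v.1 + t, v.2 + t).
  have [e em] := argmax_ex c (v.1 + t, v.2 + t); apply/argmaxP => b.
  by apply: le_trans (le_a e (sl _ em)); move/argmaxP: em.
apply/setP => b; rewrite [RHS]inE; apply/idP/andP => [bm|[bm /eqP b1]].
  have := argmax_eq bm am'; rewrite !sh a1 => e.
  have := sl _ bm; rewrite inE => b1; have b1R : (b.1 + b.2)%N%:R <= 1 :> R by rewrite (ler_nat R _ 1).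
  have ba : trop_term c b v <= trop_term c a v by move/argmaxP: am.
  have b1e : (b.1 + b.2)%N%:R = 1 :> R by nra.
  split; last by move/eqP: b1e; rewrite (eqr_nat R _ 1).
  by apply: (argmax_in am); rewrite b1e in e; lra.
by apply: (argmax_in am'); rewrite !sh b1 a1 (argmax_eq bm am).
Qed.

End LowCells.

Section CurveStars.
Variables (R : realType) (z : R * R * R).
Implicit Types (p q : R * R).

Lemma down_leg_star p : 0 <= z.2 -> p.2 < z.1.2 -> p.1 = z.1.1 ->
  star_rays (curve11 z) p = [set` [:: (0, 1); (0, -1)]].
Proof.
move=> l0 p2 p1; have := star_line p (a := (1, 0)) isT.
rewrite /= oppr0 pair_swap_set => <-; apply: star_rays_near.
apply: nbhs_sub (near_lt (@snd_continuous R) p2) => q /= q1.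
rewrite mul0r addr0 mul1r p1 (curve11_ge0 _ l0); split.
  move=> [[/andP[h h'] h'']|[_ h]|[h _]|[[_ h]|[_ h]]]; lra.
by move=> h; apply: Or43; split; lra.
Qed.

Lemma edge_star p : z.1.1 < p.1 < z.1.1 + z.2 -> p.2 - z.1.2 = p.1 - z.1.1 ->
  star_rays (curve11 z) p = [set` [:: (1, 1); (-1, -1)]].
Proof.
move=> /andP[p1 p1'] p2; have l0 : 0 <= z.2 by lra.
have := star_line p (a := (-1, 1)) isT.
rewrite /= opprK => <-; apply: star_rays_near.
apply: nbhs_sub (nbhs_and (near_lt (@fst_continuous R) p1') (near_gt (@fst_continuous R) p1)) => q /= [q1 q1'].
rewrite mulrN1z mul1r (curve11_ge0 _ l0); split.
  move=> [[h h'']|[h h']|[h _]|[[h _]|[h _]]]; lra.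
by move=> h; apply: Or41; split; lra.
Qed.

Lemma vertex_star : 0 < z.2 -> star_rays (curve11 z) z.1 = [set` tripod].
Proof.
move=> l0; have l0' := ltW l0.
have := @star_rays_near R (curve11 z) [set q : R * R | [\/ z.1.1 <= q.1 /\ q.2 - z.1.2 = q.1 - z.1.1,
  q.1 <= z.1.1 /\ q.2 = z.1.2 | q.1 = z.1.1 /\ q.2 <= z.1.2]] z.1.
have xl : z.1.1 < z.1.1 + z.2 by lra.
have near_v := near_lt (@fst_continuous R) xl.
move=> ->; last first.
  apply: nbhs_sub near_v => q /= q1; rewrite (curve11_ge0 _ l0'); split.
    move=> [[/andP[h _] h']|[h h']|[h h']|[[h _]|[h _]]].
    - by apply: Or31; split; lra.
    - by apply: Or32; split; lra.
    - by apply: Or33; split; lra.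
    - by exfalso; lra.
    - by exfalso; lra.
  move=> [[h h']|[h h']|[h h']].
  - by apply: Or41; split; lra.
  - by apply: Or42; split; lra.
  - by apply: Or43; split; lra.
apply/seteqP; split=> [[u1 u2]|u] /=.
  move=> [/= cu hu]; near (0 : R)^'+ => t.
  have t0 : 0 < t by [].
  have : [\/ z.1.1 <= z.1.1 + t * u1%:~R /\ z.1.2 + t * u2%:~R - z.1.2 = z.1.1 + t * u1%:~R - z.1.1,
     z.1.1 + t * u1%:~R <= z.1.1 /\ z.1.2 + t * u2%:~R = z.1.2 |
     z.1.1 + t * u1%:~R = z.1.1 /\ z.1.2 + t * u2%:~R <= z.1.2] by near: t.
  case=> -[h h'].
  - have u12 : u1 = u2.
      have : t * u1%:~R = t * u2%:~R by lra.
      by move/(mulfI (lt0r_neq0 t0))/intr_inj.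
    have u10 : 0 <= u1 by rewrite -(ler0z R) -(pmulr_rge0 _ t0); lra.
    rewrite /tripod !inE; apply/orP; right; apply/orP; right; apply/eqP.
    by move: cu; rewrite -u12 /coprimez gcdzz => /eqP cu; congr (_, _); clear -cu u10; lia.
  - have u20 : u2 = 0.
      have : t * u2%:~R = t * 0 by lra.
      by move/(mulfI (lt0r_neq0 t0)) => /eqP; rewrite intr_eq0 => /eqP.
    have u10 : u1 <= 0 by rewrite -(lerz0 R) -(pmulr_rle0 _ t0); lra.
    rewrite /tripod !inE; apply/orP; left; apply/eqP; rewrite u20 in cu *.
    by move: cu; rewrite /coprimez gcdz0 => /eqP cu; congr (_, _); clear -cu u10; lia.
  - have u20 : u1 = 0.
      have : t * u1%:~R = t * 0 by lra.
      by move/(mulfI (lt0r_neq0 t0)) => /eqP; rewrite intr_eq0 => /eqP.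
    have u10 : u2 <= 0 by rewrite -(lerz0 R) -(pmulr_rle0 _ t0); lra.
    rewrite /tripod !inE; apply/orP; right; apply/orP; left; apply/eqP; rewrite u20 in cu *.
    by move: cu; rewrite /coprimez gcd0z => /eqP cu; congr (_, _); clear -cu u10; lia.
rewrite /tripod !inE => /or3P[]/eqP->; split=> //; near=> t; have t0 : 0 < t by [].
- by apply: Or32 => /=; rewrite mulrN1z mulr0z; split; lra.
- by apply: Or33 => /=; rewrite mulrN1z mulr0z; split; lra.
- by apply: Or31 => /=; rewrite mulr1z; split; lra.
Unshelve. all: by end_near. Qed.

End CurveStars.

(** * Relabelling of the exponents *)

Section Relabelling.
Variables (R : realType) (c c' : 'I_4 -> 'I_4 -> R).
Variables (sg : 'I_4 * 'I_4 -> 'I_4 * 'I_4) (phi : R * R -> R * R) (k : R * R -> R).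
Hypothesis sgK : involutive sg.
Hypothesis phiK : involutive phi.
Hypothesis term_relabel : forall a v, trop_term c' a (phi v) = trop_term c (sg a) v + k v.

Lemma argmax_relabel v a : (a \in argmax c' (phi v)) = (sg a \in argmax c v).
Proof.
apply/argmaxP/argmaxP => h b; last by rewrite !term_relabel lerD2r.
by have := h (sg b); rewrite !term_relabel sgK lerD2r.
Qed.

Lemma corner_relabel : corner_locus c' = phi @^-1` corner_locus c.
Proof.
apply/seteqP; split=> v; rewrite /corner_locus /=.
  rewrite -{1}(phiK v) => /card_gt1P[a [b [am bm ab]]].
  apply/card_gt1P; exists (sg a), (sg b).
  by rewrite -!argmax_relabel am bm (inj_eq (inv_inj sgK)).
move=> /card_gt1P[a [b [am bm ab]]]; apply/card_gt1P; exists (sg a), (sg b).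
by rewrite -(phiK v) !argmax_relabel !sgK am bm (inj_eq (inv_inj sgK)).
Qed.

Hypothesis det_relabel : forall p q r,
  absz (det2 (edge_vec (sg p) (sg q)) (edge_vec (sg p) (sg r))) =
  absz (det2 (edge_vec p q) (edge_vec p r)).

Lemma fits_relabel : fits_unimodular c -> fits_unimodular c'.
Proof.
move=> h v; have [T [[p [q [r [eT dT]]]] /fintype.subsetP sT]] := h (phi v).
exists [set sg p; sg q; sg r]%SET; split.
  by exists (sg p), (sg q), (sg r); split=> //; exact: etrans (det_relabel p q r) dT.
apply/fintype.subsetP => a; rewrite -(phiK v) argmax_relabel => /sT.
rewrite eT !inE => /orP[/orP[]|]/eqP e; rewrite -e sgK eqxx ?orbT //.
Qed.

End Relabelling.

Section LowVertex.
Variable R : realType.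
Implicit Types (c : 'I_4 -> 'I_4 -> R) (z : R * R * R) (w p : R * R).

(* Either the left leg crosses the curve exactly once, or the vertex lies on the unbounded
   vertical edge and together with the down leg forms a component of multiplicity 1. *)
Lemma low_right_not_tritangent c w z : generic w -> fits_unimodular c -> 0 < z.2 ->
  argmax c z.1 \subset low -> p10 \in argmax c z.1 -> p01 \notin argmax c z.1 ->
  ~ tritangent_disp w (corner_locus c) (curve11 z).
Proof.
move=> gw smooth l0 slow m10 m01 tri; have l0' := ltW l0.
have lowS a : a \in argmax c z.1 -> a = p00 \/ a = p10.
  move=> am; have [->|->|ea] := lowP (fintype.subsetP slow _ am); [by left|by right|].
  by rewrite ea (negbTE m01) in am.
have [m00|m00] := boolP (p00 \in argmax c z.1); last first.
  apply: (@odd_left R c w z gw smooth l0' p10) => //.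
  apply/setP => a; rewrite finset.in_set1; apply/idP/eqP => [am|->//].
  by case: (lowS a am) => // ea; rewrite -ea am in m00.
have eS : argmax c z.1 = [set p10; p00]%SET.
  apply/setP => a; rewrite finset.in_set2; apply/idP/orP => [/lowS[->|->]|[]/eqP->//].
    by right.
  by left.
set Gamma := corner_locus c; set Lambda := curve11 z in tri *.
pose X := Lambda `&` Gamma.
have Xv : X z.1.
  split; last by apply/card_gt1P; exists p10, p00; rewrite eS !inE !eqxx.
  by rewrite /Lambda (curve11_ge0 _ l0'); apply: Or42.
have s0 : 0 < sigma c z.1 by rewrite sigma_gt0.
have diag t : 0 < t < sigma c z.1 -> argmax c (z.1.1 + t, z.1.2 + t) = [set p10]%SET.
  move=> ht; rewrite (argmax_diagonal m10 _ ht) // eS; apply/setP => a; rewrite !inE.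
  by apply/andP/eqP => [[/orP[]/eqP-> //]|->].
have left_cell t : 0 < t -> argmax c (z.1.1 - t, z.1.2) = [set p00]%SET.
  move=> ht; rewrite (argmax_left m00 _ ht) // eS; apply/setP => a; rewrite !inE.
  by apply/andP/eqP => [[/orP[]/eqP-> //]|->].
have down_cell t : 0 <= t -> argmax c (z.1.1, z.1.2 - t) = [set p10; p00]%SET.
  rewrite le_eqVlt => /predU1P[<-|ht]; first by rewrite subr0 -surjective_pairing.
  rewrite (argmax_down m00 _ ht) // eS; apply/setP => a; rewrite !inE.
  by apply/andP/idP => [[]//|h]; split=> //; case/orP: h => /eqP->.
pose K := connected_component X z.1.
have KX p : K p -> X p by apply: connected_component_sub.
have K1 p : K p -> p.1 <= z.1.1.
  move=> Kp; rewrite leNgt; apply/negP => p1.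
  (* Within the (1,1)-curve the abscissa [z.1.1 + t] occurs only inside the edge, at a point of the
     region of (1,0). It therefore separates [p] from [v_0] in the intersection. *)
  pose t := Num.min (Num.min z.2 (sigma c z.1)) (p.1 - z.1.1) / 2.
  have : 0 < Num.min (Num.min z.2 (sigma c z.1)) (p.1 - z.1.1).
    by rewrite !lt_min l0 s0 subr_gt0.
  have : Num.min (Num.min z.2 (sigma c z.1)) (p.1 - z.1.1) <= p.1 - z.1.1.
    by rewrite ge_min lexx orbT.
  have : Num.min (Num.min z.2 (sigma c z.1)) (p.1 - z.1.1) <= z.2.
    by rewrite !ge_min lexx.
  have : Num.min (Num.min z.2 (sigma c z.1)) (p.1 - z.1.1) <= sigma c z.1.
    by rewrite !ge_min lexx orbT.
  move=> h1 h2 h3 h4.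
  have t1 : 0 < t by rewrite /t; lra.
  have t2 : t < sigma c z.1 by rewrite /t; lra.
  have t3 : t < z.2 by rewrite /t; lra.
  have t4 : t < p.1 - z.1.1 by rewrite /t; lra.
  have side : p.1 < z.1.1 + t.
    apply: (@connected_side R _ K (fun q => q.1) _ z.1 p) => //.
    - exact: component_connected.
    - exact: fst_continuous.
    - move=> u /KX[Lu Gu]; apply/eqP => ut; move: Lu; rewrite /Lambda (curve11_ge0 _ l0').
      case=> [[h h']|[h h']|[h h']|[[h h']|[h h']]]; try by lra.
      have eu : u = (z.1.1 + t, z.1.2 + t).
        by rewrite [u]surjective_pairing ut; congr (_, _); lra.
      by move: Gu; rewrite eu; apply: notin_corner; apply: diag; rewrite t1 t2.
    - exact: connected_component_refl.
    - by lra.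
  by lra.
have Kdown p : K p -> exists2 t, 0 <= t & p = (z.1.1, z.1.2 - t).
  move=> Kp; have [Lp Gp] := KX p Kp; have p1 := K1 p Kp.
  move: Lp; rewrite /Lambda (curve11_ge0 _ l0').
  case=> [[/andP[h h2] h']|[h h']|[h h']|[[h h']|[h h']]]; try by (exfalso; lra).
  - exists 0; rewrite ?lexx // subr0 [p]surjective_pairing; congr (_, _); lra.
  - have [ht|ht] := ltP p.1 z.1.1; last first.
      by exists 0; rewrite ?lexx // subr0 [p]surjective_pairing; congr (_, _); lra.
    have ep : p = (z.1.1 - (z.1.1 - p.1), z.1.2).
      by rewrite [LHS]surjective_pairing; congr (_, _); lra.
    exfalso; move: Gp; rewrite ep; apply: notin_corner; apply: left_cell; lra.
  - exists (z.1.2 - p.2); first by lra.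
    by rewrite [LHS]surjective_pairing; congr (_, _); lra.
have starG t : 0 <= t -> star_rays Gamma (z.1.1, z.1.2 - t) = [set` [:: (0, 1); (0, -1)]].
  by move=> ht; rewrite (@star_corner2 _ _ _ p10 p00) // down_cell.
have total1 : total_mult w Gamma Lambda K = (\sum_(i < 1) (z.1 \in K))%N.
  apply: (@total_mult_points _ _ _ _ _ 1 (fun=> z.1)) => p /Kdown[t ht ->].
  rewrite big_ord1; move: ht; rewrite le_eqVlt => /predU1P[<-|ht].
    rewrite subr0 -surjective_pairing eqxx.
    apply: (@mult_tripod _ _ _ _ _ [:: (0, 1); (0, -1)]) => //.
      by have := starG 0 (lexx 0); rewrite subr0 -surjective_pairing.
    exact: vertex_star.
  have -> : ((z.1.1, z.1.2 - t) == z.1) = false.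
    by apply/eqP => e; have := congr1 snd e => /=; lra.
  apply: (@mult_parallel _ _ _ _ _ (0, 1)) => //=; rewrite oppr0.
    exact: starG (ltW ht).
  by apply: down_leg_star => //=; lra.
have := components_even tri Xv; rewrite -/K total1 big_ord1 mem_set //.
exact: connected_component_refl.
Qed.

Definition transpose_pair (T : Type) (p : T * T) : T * T := (p.2, p.1).

Lemma transpose_pairK T : involutive (@transpose_pair T).
Proof. by case. Qed.

(** Transposing the plane exchanges (1,0) and (0,1) and maps curves with l > 0 to curves of the same
    kind. *)
Lemma low_above_not_tritangent c w z : generic w -> fits_unimodular c -> 0 < z.2 ->
  argmax c z.1 \subset low -> p01 \in argmax c z.1 -> p10 \notin argmax c z.1 ->
  ~ tritangent_disp w (corner_locus c) (curve11 z).
Proof.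
move=> gw smooth l0 slow m01 m10 tri.
pose phi := @transpose_pair R; pose c' i j := c j i.
have phiK : involutive phi := @transpose_pairK R.
have sgK := @transpose_pairK 'I_4.
have rel a v : trop_term c' a (phi v) = trop_term c (transpose_pair a) v + 0.
  by rewrite /trop_term /c' /phi /=; ring.
have amx := argmax_relabel sgK rel.
apply: (@low_right_not_tritangent c' (phi w) (phi z.1, z.2)) => //.
- exact: generic_swap.
- apply: (fits_relabel sgK phiK rel) => // p q r.
  rewrite (_ : det2 _ _ = - det2 (edge_vec p q) (edge_vec p r)) ?abszN //.
  by rewrite /det2 /edge_vec /transpose_pair /=; ring.
- apply/fintype.subsetP => a; rewrite amx => /(fintype.subsetP slow).
  by rewrite !inE addnC.
- by rewrite amx.
- by rewrite amx.
rewrite (corner_relabel sgK phiK rel).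
have -> : curve11 (phi z.1, z.2) = phi @^-1` curve11 z.
  have l0' := ltW l0.
  apply/seteqP; split=> p; rewrite /phi /=; rewrite (curve11_ge0 _ l0') (curve11_ge0 (z := (_, _)) _ l0') /=.
    case=> [[h h']|[h h']|[h h']|[[h h']|[h h']]].
    - by apply: Or41; split; lra.
    - by apply: Or43; split; lra.
    - by apply: Or42; split; lra.
    - by apply: Or44; right; split; lra.
    - by apply: Or44; left; split; lra.
  case=> [[h h']|[h h']|[h h']|[[h h']|[h h']]].
  - by apply: Or41; split; lra.
  - by apply: Or43; split; lra.
  - by apply: Or42; split; lra.
  - by apply: Or44; right; split; lra.
  - by apply: Or44; left; split; lra.
apply: (@tritangent_disp_sym R phi (@transpose_pair int)) => //.
- by rewrite /phi; apply: cont_pair; [exact: snd_continuous|exact: fst_continuous].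
- exact: transpose_pairK.
- by move=> u; rewrite coprimez_sym.
- move=> u v; rewrite (_ : det2 _ _ = - det2 u v) ?abszN //.
  by rewrite /det2 /=; ring.
Qed.

(** Parity excludes the subsets of [low] containing exactly one of (1,0) and (0,1). The two
    alternatives left are the situations of (U1) and (R1). *)
Lemma low_vertex c w z : generic w -> fits_unimodular c -> 0 < z.2 ->
  argmax c z.1 \subset low -> tritangent_disp w (corner_locus c) (curve11 z) ->
  argmax c z.1 = [set p00]%SET \/ (p10 \in argmax c z.1 /\ p01 \in argmax c z.1).
Proof.
move=> gw smooth l0 slow tri.
have [m10|m10] := boolP (p10 \in argmax c z.1); have [m01|m01] := boolP (p01 \in argmax c z.1).
- by right.
- by exfalso; apply: low_right_not_tritangent tri.
- by exfalso; apply: low_above_not_tritangent tri.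
left; apply/setP => a; rewrite finset.in_set1.
have lowS b : b \in argmax c z.1 -> b = p00.
  move=> bm; have [//|eb|eb] := lowP (fintype.subsetP slow _ bm).
    by rewrite eb (negbTE m10) in bm.
  by rewrite eb (negbTE m01) in bm.
apply/idP/eqP => [/lowS//|->].
by have [b bm] := argmax_ex c z.1; rewrite -(lowS b bm).
Qed.

End LowVertex.

(** * Sliding the lowest vertex *)

Section Slide.
Variable R : realType.
Implicit Types (c : 'I_4 -> 'I_4 -> R) (z : R * R * R) (w p q : R * R) (t : R).

Definition slide z t : R * R * R := ((z.1.1 + t, z.1.2 + t), z.2 - t).

Lemma curve_slide z t p : 0 < t < z.2 -> z.1.1 + t < p.1 ->
  curve11 (slide z t) p <-> curve11 z p.
Proof.
move=> /andP[t0 tl] p1; have l0 : 0 <= z.2 by lra.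
have l0' : 0 <= (slide z t).2 by rewrite /slide /=; lra.
rewrite (curve11_ge0 _ l0) (curve11_ge0 _ l0') /slide /=; split.
  case=> [[h h']|[h h']|[h h']|[[h h']|[h h']]]; try by (exfalso; lra).
  - by apply: Or41; split; lra.
  - by apply: Or44; left; split; lra.
  - by apply: Or44; right; split; lra.
case=> [[h h']|[h h']|[h h']|[[h h']|[h h']]]; try by (exfalso; lra).
- by apply: Or41; split; lra.
- by apply: Or44; left; split; lra.
- by apply: Or44; right; split; lra.
Qed.

Lemma connected_component_segment (X : set (R * R)) p q :
  (forall s, 0 <= s <= 1 -> X (p.1 + s * (q.1 - p.1), p.2 + s * (q.2 - p.2))) ->
  connected_component X p q.
Proof.
move=> hX; pose f (s : R) : R * R := (p.1 + s * (q.1 - p.1), p.2 + s * (q.2 - p.2)).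
have f0 : f 0 = p by rewrite /f !mul0r !addr0 -surjective_pairing.
have f1 : f 1 = q by rewrite [q]surjective_pairing /f; congr (_, _); ring.
have I0 : [set s : R | 0 <= s <= 1] 0 by rewrite /= lexx ler01.
have I1 : [set s : R | 0 <= s <= 1] 1 by rewrite /= lexx ler01.
apply: (@connected_component_max _ X (f @` [set s | 0 <= s <= 1])).
- by exists 0.
- by move=> _ [s hs <-]; exact: hX.
- apply: connected_continuous_connected.
    apply/connected_intervalP => a b /= /andP[a0 _] /andP[_ b1] s /andP[sa sb].
    by rewrite (le_trans a0 sa) (le_trans sb b1).
  by apply: continuous_subspaceT; rewrite /f; cont.
- by exists 1.
Qed.

(** * Transfer of tritangency along a slide *)

Section Transfer.
Variables (c : 'I_4 -> 'I_4 -> R) (w : R * R) (z : R * R * R) (t : R).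
Hypothesis tl : 0 < t < z.2.
Let q : R * R := (z.1.1 + t, z.1.2 + t).
Let Gamma := corner_locus c.
Let Lambda := curve11 z.
Let Lambda' := curve11 (slide z t).
Let X := Lambda `&` Gamma.
Let X' := Lambda' `&` Gamma.

(** These conditions cover both kinds of slide. Inside the region of (0,0) all but the first hold
    vacuously; along the edge dual to (1,0) and (0,1) they say that what is left behind collapses to
    [q] and that the multiplicity of [z.1] moves to [q]. *)
Hypothesis new_legs : forall p, X' p -> q.1 < p.1 \/ p = q.
Hypothesis old_part : forall p, X p -> p.1 <= q.1 -> connected_component X p q.
Hypothesis vertex_corner : Gamma q -> Gamma z.1.
Hypothesis vertex_mult : Gamma q -> mult w Gamma Lambda z.1 = mult w Gamma Lambda' q.
Hypothesis old_mult : forall p, X p -> p.1 <= q.1 -> p != z.1 -> mult w Gamma Lambda p = 0%N.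

(* Retraction of the old intersection onto the new one. *)
Let r p : R * R := (Num.max p.1 q.1, Num.max p.2 q.2).

Let tl12 : 0 < t /\ t < z.2. Proof. by case/andP: tl. Qed.

Let Lq : Lambda q.
Proof.
have [t0 t1] := tl12; have l0 : 0 <= z.2 by lra.
by rewrite /Lambda (curve11_ge0 _ l0); apply: Or41; rewrite /q /=; split; lra.
Qed.

Let Lq' : Lambda' q.
Proof.
have [t0 t1] := tl12; have l0 : 0 <= (slide z t).2 by rewrite /=; lra.
by rewrite /Lambda' (curve11_ge0 _ l0); apply: Or41; rewrite /q /=; split; lra.
Qed.

Let right_p2 p : Lambda p -> q.1 < p.1 -> q.2 < p.2.
Proof.
have [t0 t1] := tl12; have l0 : 0 <= z.2 by lra.
rewrite /Lambda (curve11_ge0 _ l0) /q /= => -[[h h']|[h h']|[h h']|[[h h']|[h h']]]; lra.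
Qed.

Let left_p2 p : Lambda p -> p.1 <= q.1 -> p.2 <= q.2.
Proof.
have [t0 t1] := tl12; have l0 : 0 <= z.2 by lra.
rewrite /Lambda (curve11_ge0 _ l0) /q /= => -[[h h']|[h h']|[h h']|[[h h']|[h h']]]; lra.
Qed.

Let X'X p : X' p -> X p.
Proof.
move=> X'p; have [Lp Gp] := X'p; split=> //; case: (new_legs X'p) => [p1|->//].
exact/(curve_slide tl).
Qed.

Let r_right p : X p -> q.1 < p.1 -> r p = p.
Proof.
move=> [Lp _] p1; have p2 := right_p2 Lp p1.
by rewrite /r !max_l ?ltW // -surjective_pairing.
Qed.

Let r_left p : X p -> p.1 <= q.1 -> r p = q.
Proof.
move=> [Lp _] p1; have p2 := left_p2 Lp p1.
by rewrite /r !max_r // -surjective_pairing.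
Qed.

Let r_fix p : X' p -> r p = p.
Proof.
move=> X'p; case: (new_legs X'p) => [p1|->]; first exact: r_right (X'X X'p) p1.
by rewrite /r !maxxx -surjective_pairing.
Qed.

Let Xq p : X p -> p.1 <= q.1 -> X' q.
Proof. by move=> Xp p1; have [_ Gq] := connected_component_sub (old_part Xp p1); split=> //; exact: Lq'. Qed.

Let rX p : X p -> X' (r p).
Proof.
move=> Xp; have [p1|p1] := leP p.1 q.1; first by rewrite r_left //; exact: Xq p1.
by rewrite r_right //; have [Lp Gp] := Xp; split=> //; apply/(curve_slide tl).
Qed.

Let r_connected p : X p -> connected_component X p (r p).
Proof.
move=> Xp; have [p1|p1] := leP p.1 q.1; first by rewrite r_left //; exact: old_part.
by rewrite r_right //; exact: connected_component_refl.
Qed.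

Let rc : continuous r. Proof. by rewrite /r; cont. Qed.

(** The map [r] is continuous, restricts to the identity on [X'], and moves each point within its
    component of [X]. So two points of [X'] in one component of [X] are in one component of [X']. *)
Let component_slide p : X p ->
  connected_component X' (r p) = connected_component X p `&` X'.
Proof.
move=> Xp; rewrite (same_connected_component (r_connected Xp)).
apply/seteqP; split=> y.
  move=> h; split; last exact: connected_component_sub h.
  by apply: (connected_component_map (f := id)) h; [exact: cont_id|exact: X'X].
move=> [h X'y]; rewrite -(r_fix X'y) -[X in connected_component _ X](r_fix (rX Xp)).
by apply: connected_component_map h; [exact: rc|exact: rX].
Qed.

Let total_slide p : X p -> total_mult w Gamma Lambda (connected_component X p) =
  total_mult w Gamma Lambda' (connected_component X p `&` X').
Proof.
move=> Xp; have [t0 t1] := tl12; set K := connected_component X p.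
have Kc y : K y -> connected_component X y = K.
  by move=> /same_connected_component.
have KX y : K y -> X y by apply: connected_component_sub.
(* Matches points of equal multiplicity: what the new curve has at [q] the old one has at its
   vertex, and the other new points are unchanged. Points of [K] outside the image of [tau] have
   multiplicity 0. *)
pose tau (y : R * R) := if y == q then z.1 else y.
have v_left : z.1.1 <= q.1 by rewrite /q /=; lra.
have Kq_v : K q -> Gamma q -> K z.1.
  move=> Kq Gq; rewrite -(Kc _ Kq).
  have Xv : X z.1.
    split; last exact: vertex_corner.
    have l0 : 0 <= z.2 by lra.
    by rewrite /Lambda (curve11_ge0 _ l0); apply: Or42.
  have h := old_part Xv v_left; rewrite -(same_connected_component h).
  exact: connected_component_refl.
have v_notX' : ~ X' z.1.
  by move=> /new_legs; rewrite /q /= => -[|/(congr1 fst) /=]; lra.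
transitivity (\sum_(y \in [set tau y | y in K `&` X']) mult w Gamma Lambda y).
  symmetry; apply: fsbig_widen.
    move=> _ [y [Ky X'y] <-]; rewrite /tau; case: eqP => // ey.
    by rewrite ey in Ky X'y; apply: Kq_v => //; case: X'y.
  move=> y [Ky ny] /=; have Xy := KX y Ky; have [y1|y1] := leP y.1 q.1.
    apply: old_mult => //; apply/eqP => ey; apply: ny.
    exists q; last by rewrite /tau eqxx ey.
    by split; [rewrite -(Kc _ Ky); exact: old_part|exact: Xq Xy y1].
  exfalso; apply: ny; exists y; last first.
    by rewrite /tau; case: eqP => // ey; move: y1; rewrite ey ltxx.
  by split=> //; rewrite -(r_right Xy y1); exact: rX.
rewrite fsbig_image; last first.
  move=> a b; rewrite !inE /tau => -[_ X'a] [_ X'b]; case: eqP => [->|_]; case: eqP => [->|_] //.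
    by move=> e; case: v_notX'; rewrite e.
  by move=> e; case: v_notX'; rewrite -e.
apply: eq_fsbigr => y; rewrite inE => -[Ky X'y]; rewrite /tau.
case: eqP => [ey|ny]; first by rewrite ey vertex_mult // -ey; case: X'y.
have y1 : q.1 < y.1 by case: (new_legs X'y).
apply: mult_near; apply: nbhs_sub (near_gt (@fst_continuous R) y1) => u /= u1.
by split=> h; apply/(curve_slide tl).
Qed.

(** Intersecting with [X'] gives a bijection of components that preserves totals, so the same list
    of totals, in the same order, serves for the new curve. *)
Lemma tritangent_transfer : tritangent_disp w Gamma Lambda -> tritangent_disp w Gamma Lambda'.
Proof.
move=> [Ks [uKs eKs hKs]]; exists [seq K `&` X' | K <- Ks].
have KsX K : K \in Ks -> exists2 p, X p & K = connected_component X p.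
  move=> KK; have : [set` Ks] K by [].
  by rewrite eKs => -[p Xp <-]; exists p.
split.
- rewrite map_inj_in_uniq // => K1 K2 /KsX[p1 Xp1 ->] /KsX[p2 Xp2 ->] e.
  have : (connected_component X p1 `&` X') (r p1) by split; [exact: r_connected|exact: rX].
  rewrite e => -[h _].
  by rewrite (same_connected_component (r_connected Xp1)) (same_connected_component h).
- apply/seteqP; split=> L /=.
    move=> /mapP[K /KsX[p Xp ->] ->]; rewrite -component_slide //.
    by exists (r p); [exact: rX|].
  move=> [p X'p <-]; have Xp := X'X X'p.
  rewrite -/X' -{1}(r_fix X'p) component_slide //; apply: map_f.
  have : components X (connected_component X p) by exists p.
  by rewrite -eKs.
- rewrite -map_comp (_ : map _ Ks = [seq total_mult w Gamma Lambda K | K <- Ks]) //.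
  by apply/eq_in_map => K /KsX[p Xp ->] /=; rewrite total_slide.
Qed.

End Transfer.
End Slide.

(** * The two kinds of slide *)

Section SlideCells.
Variables (R : realType) (c : 'I_4 -> 'I_4 -> R) (w : R * R) (z : R * R * R) (t : R).
Hypothesis tl : 0 < t < z.2.
Let q : R * R := (z.1.1 + t, z.1.2 + t).
Let Gamma := corner_locus c.

Let l0 : 0 <= z.2. Proof. by case/andP: tl => h1 h2; apply: ltW; apply: lt_trans h2. Qed.
Let l0' : 0 <= (slide z t).2. Proof. by case/andP: tl => h1 h2; rewrite /= subr_ge0 ltW. Qed.

(** The region of (0,0) is convex and is not left by moving left or down. Hence neither curve meets
    the given one at abscissas up to that of [q]. *)
Lemma slide_region : argmax c z.1 = [set p00]%SET -> argmax c q = [set p00]%SET ->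
  tritangent_disp w Gamma (curve11 z) -> tritangent_disp w Gamma (curve11 (slide z t)).
Proof.
have tl' := tl; have l1 := l0; have l2 := l0'.
move=> ev eq.
have m00 : p00 \in argmax c z.1 by rewrite ev finset.in_set1.
have m00q : p00 \in argmax c q by rewrite eq finset.in_set1.
have left_cell v : p00 \in argmax c v -> argmax c v = [set p00]%SET ->
    forall s, 0 <= s -> argmax c (v.1 - s, v.2) = [set p00]%SET.
  move=> mv e s; rewrite le_eqVlt => /predU1P[<-|s0]; first by rewrite subr0 -surjective_pairing.
  rewrite (argmax_left mv _ s0) // e; apply/setP => b; rewrite !inE.
  by apply/andP/eqP => [[/eqP]//|->].
have down_cell v : p00 \in argmax c v -> argmax c v = [set p00]%SET ->
    forall s, 0 <= s -> argmax c (v.1, v.2 - s) = [set p00]%SET.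
  move=> mv e s; rewrite le_eqVlt => /predU1P[<-|s0]; first by rewrite subr0 -surjective_pairing.
  rewrite (argmax_down mv _ s0) // e; apply/setP => b; rewrite !inE.
  by apply/andP/eqP => [[/eqP]//|->].
have edge_cell s : 0 <= s <= t -> argmax c (z.1.1 + s, z.1.2 + s) = [set p00]%SET.
  move=> /andP[s0 st].
  have sh b u : trop_term c b (z.1.1 + u, z.1.2 + u) = trop_term c b z.1 + u * slope (1, 1) b.
    by have := trop_term_shift c b z.1 u (1, 1); rewrite /= !mulr1.
  have lt00 b : b != p00 -> trop_term c b (z.1.1 + s, z.1.2 + s) <
      trop_term c p00 (z.1.1 + s, z.1.2 + s).
    move=> b0; have h1 : trop_term c b z.1 < trop_term c p00 z.1.
      by apply: argmax_lt => //; rewrite ev finset.in_set1.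
    have h2 : trop_term c b q < trop_term c p00 q.
      by apply: argmax_lt => //; rewrite eq finset.in_set1.
    have [ets|st'] : s = t \/ s < t by move: st; rewrite le_eqVlt => /predU1P.
      by rewrite ets.
    have [t0 _] := andP tl'; rewrite /q !sh in h2 *.
    rewrite -subr_gt0 -(pmulr_rgt0 _ t0); set A := trop_term c p00 _ in h1 h2 *.
    set B := trop_term c b _ in h1 h2 *.
    (* Multiplied by [t], the gap at time [s] is the combination of the gaps at times 0 and [t] with
       weights [t - s] and [s]. *)
    have -> : t * (A + s * slope (1, 1) p00 - (B + s * slope (1, 1) b)) =
        (t - s) * (A - B) + s * (A + t * slope (1, 1) p00 - (B + t * slope (1, 1) b)) by ring.
    by apply: ltr_wpDr; [apply: mulr_ge0; lra|apply: mulr_gt0; lra].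
  apply/setP => b; rewrite finset.in_set1; apply/argmaxP/eqP => [h|-> e].
    by apply/eqP; apply: contraT => /lt00; rewrite ltNge h.
  by have [->//|/lt00/ltW] := eqVneq e p00.
have offG v : argmax c v = [set p00]%SET -> ~ Gamma v by exact: notin_corner.
have nq : ~ Gamma q by apply: offG.
have old_empty p : (curve11 z `&` Gamma) p -> p.1 <= q.1 -> False.
  move=> [+ Gp] p1; rewrite (curve11_ge0 _ l1).
  case=> [[h h']|[h h']|[h h']|[[h h']|[h h']]].
  - apply: (offG _ (edge_cell (p.1 - z.1.1) _)); first by rewrite /q /= in p1; lra.
    by move: Gp; congr (Gamma _); rewrite [LHS]surjective_pairing; congr (_, _); lra.
  - apply: (offG _ (left_cell _ m00 ev (z.1.1 - p.1) _)); first by lra.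
    by move: Gp; congr (Gamma _); rewrite [LHS]surjective_pairing; congr (_, _); lra.
  - apply: (offG _ (down_cell _ m00 ev (z.1.2 - p.2) _)); first by lra.
    by move: Gp; congr (Gamma _); rewrite [LHS]surjective_pairing; congr (_, _); lra.
  - by rewrite /q /= in p1; lra.
  - by rewrite /q /= in p1; lra.
apply: (tritangent_transfer tl) => //.
- move=> p [+ Gp]; rewrite (curve11_ge0 _ l2) /=.
  case=> [[h h']|[h h']|[h h']|[[h h']|[h h']]].
  - have [p1|p1] := ltP q.1 p.1; [by left|right; rewrite /q /= in p1].
    by rewrite [LHS]surjective_pairing; congr (_, _); lra.
  - exfalso; apply: (offG _ (left_cell _ m00q eq (q.1 - p.1) _)); first by rewrite /q /=; lra.
    by move: Gp; congr (Gamma _); rewrite [LHS]surjective_pairing /q /=; congr (_, _); lra.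
  - exfalso; apply: (offG _ (down_cell _ m00q eq (q.2 - p.2) _)); first by rewrite /q /=; lra.
    by move: Gp; congr (Gamma _); rewrite [LHS]surjective_pairing /q /=; congr (_, _); lra.
  - by left; rewrite /q /=; lra.
  - by left; rewrite /q /=; lra.
- by move=> p Xp p1; case: (old_empty p Xp p1).
- by move=> p Xp p1; case: (old_empty p Xp p1).
Qed.

Hypothesis gw : generic w.
Hypothesis t_sigma : t < sigma c z.1.
Hypothesis v_low : argmax c z.1 \subset low.
Hypotheses (m10 : p10 \in argmax c z.1) (m01 : p01 \in argmax c z.1).

Let edge_cell s : 0 < s <= t -> argmax c (z.1.1 + s, z.1.2 + s) = [set p10; p01]%SET.
Proof.
have ts := t_sigma; move=> /andP[s0 st].
rewrite (argmax_diagonal m10) //; last by rewrite s0 (le_lt_trans st ts).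
apply/setP => a; rewrite [LHS]inE [RHS]inE !finset.in_set1; apply/andP/orP => [[am a1]|].
  have [ea|->|->] := lowP (fintype.subsetP v_low _ am); [|by left|by right].
  by move: a1; rewrite ea.
by case=> /eqP->.
Qed.

Let off_cell v s : p10 \in argmax c v -> p01 \in argmax c v -> argmax c v \subset low ->
  0 < s -> (argmax c (v.1 - s, v.2) = [set b in argmax c v | b.1 == ord0]%SET) /\
           (argmax c (v.1, v.2 - s) = [set b in argmax c v | b.2 == ord0]%SET).
Proof.
by move=> h10 h01 hl s0; split; [exact: (argmax_left h01)|exact: (argmax_down h10)].
Qed.

Let left_set (S : {set 'I_4 * 'I_4}) : S \subset low -> p10 \in S -> p01 \in S ->
  [set b in S | b.1 == ord0]%SET = if p00 \in S then [set p01; p00]%SET else [set p01]%SET.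
Proof.
move=> /fintype.subsetP sl h10 h01; apply/setP => b; rewrite [LHS]inE.
apply/andP/idP => [[bm b1]|].
  have [eb|eb|eb] := lowP (sl _ bm).
  - by rewrite -eb bm eb finset.in_set2 eqxx orbT.
  - by move: b1; rewrite eb.
  - by case: ifP; rewrite eb ?finset.in_set2 ?finset.in_set1 eqxx.
by case: ifP => h; [rewrite finset.in_set2 => /orP[]/eqP->|rewrite finset.in_set1 => /eqP->].
Qed.

Let down_set (S : {set 'I_4 * 'I_4}) : S \subset low -> p10 \in S -> p01 \in S ->
  [set b in S | b.2 == ord0]%SET = if p00 \in S then [set p10; p00]%SET else [set p10]%SET.
Proof.
move=> /fintype.subsetP sl h10 h01; apply/setP => b; rewrite [LHS]inE.
apply/andP/idP => [[bm b1]|].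
  have [eb|eb|eb] := lowP (sl _ bm).
  - by rewrite -eb bm eb finset.in_set2 eqxx orbT.
  - by case: ifP; rewrite eb ?finset.in_set2 ?finset.in_set1 eqxx.
  - by move: b1; rewrite eb.
by case: ifP => h; [rewrite finset.in_set2 => /orP[]/eqP->|rewrite finset.in_set1 => /eqP->].
Qed.

Let corner2 v a b : a != b -> argmax c v = [set a; b]%SET -> Gamma v.
Proof. by move=> ab e; rewrite /Gamma /corner_locus /= e cards2 ab. Qed.

Let star_edge v : argmax c v = [set p10; p01]%SET ->
  star_rays Gamma v = [set` [:: (1, 1); (-1, -1)]].
Proof. by move=> e; rewrite (@star_corner2 _ _ _ p10 p01). Qed.

(** Needed at the old vertex, possibly dual to the whole triangle [low], and at the new one, which
    lies inside the dual edge: the multiplicity is the same in both positions. *)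
Let vertex_mult1 v D : p10 \in argmax c v -> p01 \in argmax c v -> argmax c v \subset low ->
  star_rays D v = [set` tripod] -> mult w Gamma D v = 1%N.
Proof.
move=> h10 h01 hl eD; have [h00|h00] := boolP (p00 \in argmax c v).
  have e : argmax c v = [set p00; p10; p01]%SET.
    apply/setP => a; apply/idP/idP.
      by move=> /(fintype.subsetP hl)/lowP[] ->; rewrite !inE eqxx ?orbT.
    by rewrite [in X in X -> _]inE finset.in_set2 finset.in_set1 => /orP[/orP[]|]/eqP->.
  apply: (@mult_tripod _ _ _ _ _ tripod) => //.
  rewrite (@star_corner3 _ _ _ p00 p10 p01 1) //; last by left.
  apply/seteqP; split=> u; rewrite /= /tripod /outer_normal /edge_vec !inE /=;
    by move=> /or3P[]/eqP->.
apply: (@mult_tripod _ _ _ _ _ [:: (1, 1); (-1, -1)]) => //; apply: star_edge.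
apply/setP => a; rewrite finset.in_set2; apply/idP/orP => [am|[]/eqP->//].
have [ea|->|->] := lowP (fintype.subsetP hl _ am); [|by left|by right].
by rewrite -ea am in h00.
Qed.

(** When (0,0) is not maximal at [v_0], the open left and down legs lie in the regions of (0,1) and
    (1,0), so they miss the curve and only the segment up to [q] remains. *)
Let old_cell p : (curve11 z `&` Gamma) p -> p.1 <= q.1 ->
  [\/ exists2 s, 0 <= s <= t & p = (z.1.1 + s, z.1.2 + s),
      exists2 s, 0 < s & p = (z.1.1 - s, z.1.2) /\ p00 \in argmax c z.1 |
      exists2 s, 0 < s & p = (z.1.1, z.1.2 - s) /\ p00 \in argmax c z.1].
Proof.
have tl' := tl; have l1 := l0.
move=> [+ Gp] p1; rewrite (curve11_ge0 _ l1).
case=> [[h h']|[h h']|[h h']|[[h h']|[h h']]]; try by (rewrite /q /= in p1; lra).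
- apply: Or31; exists (p.1 - z.1.1); first by rewrite /q /= in p1; lra.
  by rewrite [LHS]surjective_pairing; congr (_, _); lra.
- have [s0|s0] := leP (z.1.1 - p.1) 0.
    apply: Or31; exists 0; first by lra.
    by rewrite [LHS]surjective_pairing; congr (_, _); lra.
  have ep : p = (z.1.1 - (z.1.1 - p.1), z.1.2).
    by rewrite [LHS]surjective_pairing; congr (_, _); lra.
  apply: Or32; exists (z.1.1 - p.1) => //; split=> //; apply: contraT => h00; exfalso.
  apply: (@notin_corner _ c p01 p) => //; rewrite ep (off_cell m10 m01 v_low s0).1 left_set //.
  by rewrite (negbTE h00).
have [s0|s0] := leP (z.1.2 - p.2) 0.
  apply: Or31; exists 0; first by lra.
  by rewrite [LHS]surjective_pairing; congr (_, _); lra.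
have ep : p = (z.1.1, z.1.2 - (z.1.2 - p.2)).
  by rewrite [LHS]surjective_pairing; congr (_, _); lra.
apply: Or33; exists (z.1.2 - p.2) => //; split=> //; apply: contraT => h00; exfalso.
apply: (@notin_corner _ c p10 p) => //; rewrite ep (off_cell m10 m01 v_low s0).2 down_set //.
by rewrite (negbTE h00).
Qed.

Let Gv : Gamma z.1.
Proof. by apply/card_gt1P; exists p10, p01; rewrite m10 m01. Qed.

Let X_edge s : 0 <= s <= t -> (curve11 z `&` Gamma) (z.1.1 + s, z.1.2 + s).
Proof.
have tl' := tl; have l1 := l0; move=> st.
split; first by rewrite (curve11_ge0 _ l1); apply: Or41; split=> /=; lra.
move: st => /andP[]; rewrite le_eqVlt => /predU1P[<-|s0] st.
  by rewrite !addr0 -surjective_pairing; exact: Gv.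
by apply: (@corner2 _ p10 p01) => //; apply: edge_cell; rewrite s0 st.
Qed.

(** What is left behind is the segment from [v_0] to [q], together with the whole left and down legs
    if (0,0) is maximal at [v_0]. It is connected, and away from [v_0] the two curves overlap along
    straight lines, where the multiplicity is 0. *)
Lemma slide_edge : tritangent_disp w Gamma (curve11 z) ->
  tritangent_disp w Gamma (curve11 (slide z t)).
Proof.
have tl' := tl; have l1 := l0; have l2 := l0'; have [t0 t1] := andP tl'.
have eq : argmax c q = [set p10; p01]%SET by apply: edge_cell; rewrite t0 lexx.
have q10 : p10 \in argmax c q by rewrite eq !inE eqxx.
have q01 : p01 \in argmax c q by rewrite eq !inE eqxx orbT.
have qlow : argmax c q \subset low.
  by rewrite eq; apply/fintype.subsetP => a; rewrite finset.in_set2 => /orP[]/eqP->; rewrite inE.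
have q00 : p00 \notin argmax c q by rewrite eq !inE.
have left_to_v p s : 0 < s -> p = (z.1.1 - s, z.1.2) -> p00 \in argmax c z.1 ->
    connected_component (curve11 z `&` Gamma) p z.1.
  move=> s0 -> h00; apply: connected_component_segment => u /andP[u0 u1] /=.
  have -> : (z.1.1 - s + u * (z.1.1 - (z.1.1 - s)), z.1.2 + u * (z.1.2 - z.1.2)) =
    (z.1.1 - (1 - u) * s, z.1.2) by congr (_, _); ring.
  have us0 : 0 <= (1 - u) * s by nra.
  split; first by rewrite (curve11_ge0 _ l1); apply: Or42 => /=; split; lra.
  move: us0; rewrite le_eqVlt => /predU1P[<-|us]; first by rewrite subr0 -surjective_pairing.
  apply: (@corner2 _ p01 p00) => //.
  by rewrite (off_cell m10 m01 v_low us).1 left_set // h00.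
have down_to_v p s : 0 < s -> p = (z.1.1, z.1.2 - s) -> p00 \in argmax c z.1 ->
    connected_component (curve11 z `&` Gamma) p z.1.
  move=> s0 -> h00; apply: connected_component_segment => u /andP[u0 u1] /=.
  have -> : (z.1.1 + u * (z.1.1 - z.1.1), z.1.2 - s + u * (z.1.2 - (z.1.2 - s))) =
    (z.1.1, z.1.2 - (1 - u) * s) by congr (_, _); ring.
  have us0 : 0 <= (1 - u) * s by nra.
  split; first by rewrite (curve11_ge0 _ l1); apply: Or43 => /=; split; lra.
  move: us0; rewrite le_eqVlt => /predU1P[<-|us]; first by rewrite subr0 -surjective_pairing.
  apply: (@corner2 _ p10 p00) => //.
  by rewrite (off_cell m10 m01 v_low us).2 down_set // h00.
have edge_to_q s : 0 <= s <= t ->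
    connected_component (curve11 z `&` Gamma) (z.1.1 + s, z.1.2 + s) q.
  move=> /andP[s0 st]; apply: connected_component_segment => u /andP[u0 u1] /=.
  have -> : (z.1.1 + s + u * (z.1.1 + t - (z.1.1 + s)), z.1.2 + s + u * (z.1.2 + t - (z.1.2 + s))) =
    (z.1.1 + (s + u * (t - s)), z.1.2 + (s + u * (t - s))) by congr (_, _); ring.
  by apply: X_edge; apply/andP; split; nra.
have v_to_q : connected_component (curve11 z `&` Gamma) z.1 q.
  have := edge_to_q 0; rewrite !addr0 -surjective_pairing; apply.
  by rewrite lexx ltW.
apply: (tritangent_transfer tl).
- move=> p [+ Gp]; rewrite (curve11_ge0 _ l2) /=.
  case=> [[h h']|[h h']|[h h']|[[h h']|[h h']]].
  - have [p1|p1] := ltP q.1 p.1; [by left|right; rewrite /q /= in p1].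
    by rewrite [LHS]surjective_pairing; congr (_, _); lra.
  - right; have [s0|s0] := leP (q.1 - p.1) 0.
      by rewrite [LHS]surjective_pairing; congr (_, _); rewrite /q /= in s0; lra.
    exfalso; apply: (@notin_corner _ c p01 p) => //.
    have -> : p = (q.1 - (q.1 - p.1), q.2).
      by rewrite [LHS]surjective_pairing; congr (_, _); rewrite /q /=; lra.
    by rewrite (off_cell q10 q01 qlow s0).1 left_set // (negbTE q00).
  - right; have [s0|s0] := leP (q.2 - p.2) 0.
      by rewrite [LHS]surjective_pairing; congr (_, _); rewrite /q /= in s0; lra.
    exfalso; apply: (@notin_corner _ c p10 p) => //.
    have -> : p = (q.1, q.2 - (q.2 - p.2)).
      by rewrite [LHS]surjective_pairing; congr (_, _); rewrite /q /=; lra.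
    by rewrite (off_cell q10 q01 qlow s0).2 down_set // (negbTE q00).
  - by left; rewrite /q /=; lra.
  - by left; rewrite /q /=; lra.
- move=> p Xp p1; case: (old_cell Xp p1) => [[s st ->]|[s s0 [ep h00]]|[s s0 [ep h00]]].
  + exact: edge_to_q.
  + by rewrite (same_connected_component (left_to_v p s s0 ep h00)).
  + by rewrite (same_connected_component (down_to_v p s s0 ep h00)).
- by move=> _; exact: Gv.
- move=> _; rewrite !vertex_mult1 //.
    by have := @vertex_star _ (slide z t); apply => /=; lra.
  by apply: vertex_star; lra.
- move=> p Xp p1 pv; case: (old_cell Xp p1) => [[s st ep]|[s s0 [ep h00]]|[s s0 [ep h00]]].
  + have s0 : 0 < s.
      rewrite lt_neqAle; have [-> _] := andP st; rewrite andbT eq_sym; apply/eqP => e.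
      by move: pv; rewrite ep e !addr0 -surjective_pairing eqxx.
    have [_ st'] := andP st.
    apply: (@mult_parallel _ _ _ _ _ (1, 1)) => //=.
      by apply: star_edge; rewrite ep; apply: edge_cell; rewrite s0 st'.
    by apply: edge_star; rewrite ep /=; lra.
  + apply: (@mult_parallel _ _ _ _ _ (1, 0)) => //=; rewrite oppr0.
      rewrite (@star_corner2 _ _ _ p00 p01) ?ep ?(off_cell m10 m01 v_low s0).1 ?left_set ?h00 //.
      by rewrite finset.setUC.
    by apply: (@left_leg_star _ z l1); rewrite ep /=; lra.
  + apply: (@mult_parallel _ _ _ _ _ (0, 1)) => //=; rewrite oppr0.
      by rewrite (@star_corner2 _ _ _ p10 p00) ?ep ?(off_cell m10 m01 v_low s0).2 ?down_set ?h00.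
    by apply: down_leg_star => //; rewrite ep /=; lra.
Qed.

End SlideCells.

(** * The flow shrinking the edge from its lowest vertex *)

Section Flow.
Variables (R : realType) (c : 'I_4 -> 'I_4 -> R) (w : R * R).
Implicit Types (z : R * R * R) (s t : R).

(** Off the slidable curves the minimum is at most 0; the maximum with 0 makes the flow stationary
    there without losing continuity. *)
Definition slide_time z : R := Num.max 0 (Num.min z.2 (sigma c z.1)).

Definition flow s z : R * R * R := slide z (s * slide_time z).

Definition slidable z := 0 < z.2 /\ argmax c z.1 \subset low.

Lemma slide_continuous z : continuous (slide z).
Proof.
rewrite /slide; apply: (cont_pair (f := fun t => (z.1.1 + t, z.1.2 + t)) (g := fun t => z.2 - t)).
  by apply: cont_pair; (apply: contD; [exact: cont_cst|exact: cont_id]).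
by apply: contB; [exact: cont_cst|exact: cont_id].
Qed.

Lemma slide0 z : slide z 0 = z.
Proof. by rewrite /slide !addr0 subr0 -!surjective_pairing. Qed.

Lemma slide_add z s t : slide (slide z s) t = slide z (s + t).
Proof. by rewrite /slide /=; congr (_, _, _); ring. Qed.

Lemma slidableE z : slidable z <-> 0 < Num.min z.2 (sigma c z.1).
Proof. by rewrite /slidable -sigma_gt0 lt_min; split=> /andP. Qed.

Lemma slide_time_slidable z : slidable z -> slide_time z = Num.min z.2 (sigma c z.1).
Proof. by move=> /slidableE h; rewrite /slide_time max_r // ltW. Qed.

Lemma slide_time_id z : ~ slidable z -> slide_time z = 0.
Proof. by move=> h; rewrite /slide_time max_l // leNgt; apply/negP => /slidableE. Qed.

Lemma flow_id s z : ~ slidable z -> flow s z = z.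
Proof. by move=> /slide_time_id h; rewrite /flow h mulr0 slide0. Qed.

Lemma flow0 z : flow 0 z = z.
Proof. by rewrite /flow mul0r slide0. Qed.

Lemma flow1 z : ~ slidable (flow 1 z).
Proof.
have [sz|nz] := pselect (slidable z); last by rewrite flow_id.
rewrite /flow mul1r slide_time_slidable // slidableE /slide /= sigma_shift lt_min.
set m := Num.min _ _; have : m = z.2 \/ m = sigma c z.1.
  by rewrite /m; case: (leP z.2 (sigma c z.1)) => _; [left|right].
by case=> <-; rewrite subrr ltxx ?andbF.
Qed.

(** Only the lowest vertex moves, and l does not change sign. This is what keeps the four flows from
    disturbing each other. *)
Lemma flow_vertex1 s z : 0 <= s <= 1 -> flow s z = z \/
  [/\ 0 < z.2, 0 <= (flow s z).2 & vertex1 (flow s z) = vertex1 z].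
Proof.
move=> /andP[s0 s1]; have [sz|nz] := pselect (slidable z); last by left; exact: flow_id.
right; have [l0 _] := sz; have := sz => /slidableE m0.
have m1 : Num.min z.2 (sigma c z.1) <= z.2 by rewrite ge_min lexx.
have f0 : 0 <= (flow s z).2.
  by rewrite /flow slide_time_slidable // /slide /=; nra.
split=> //; rewrite /vertex1 f0 ltW // /flow /slide /=.
by congr (_, _); ring.
Qed.

Lemma slide_time_continuous : continuous slide_time.
Proof.
have cs : continuous (fun z : R * R * R => sigma c z.1).
  by apply: cont_comp; [exact: sigma_continuous|cont].
by rewrite /slide_time; cont.
Qed.

Lemma flow_continuous : continuous (fun sz : R * (R * R * R) => flow sz.1 sz.2).
Proof.
have ct : continuous (fun sz : R * (R * R * R) => slide_time sz.2).
  by apply: cont_comp; [exact: slide_time_continuous|cont].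
by rewrite /flow /slide; cont.
Qed.

(** The properties of a tritangent class that the flow uses, stated so that the preimage of a class
    under a reflection has them too, with the reflected displacement. *)
Variable Omega : set (R * R * R).
Hypotheses (gw : generic w) (smooth : fits_unimodular c).
Hypothesis Omega_tri : forall z, Omega z -> tritangent_disp w (corner_locus c) (curve11 z).
Hypothesis Omega_closed : closed Omega.
Hypothesis Omega_connected : forall A : set (R * R * R), connected A ->
  (forall z, A z -> tritangent_disp w (corner_locus c) (curve11 z)) ->
  (exists2 z, A z & Omega z) -> A `<=` Omega.

Let slide_path z t : Omega z -> 0 <= t ->
  (forall s, 0 < s <= t -> tritangent_disp w (corner_locus c) (curve11 (slide z s))) ->
  Omega (slide z t).
Proof.
move=> Oz t0 h; apply: (Omega_connected (A := slide z @` [set s | 0 <= s <= t])).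
- apply: connected_continuous_connected.
    apply/connected_intervalP => a b /= /andP[a0 _] /andP[_ b1] s /andP[sa sb].
    by rewrite (le_trans a0 sa) (le_trans sb b1).
  by apply: continuous_subspaceT; exact: slide_continuous.
- move=> y [s /= /andP[]]; rewrite le_eqVlt => /predU1P[<-|s0] st <-.
    by rewrite slide0; exact: Omega_tri.
  by apply: h; rewrite s0 st.
- by exists z => //; exists 0; rewrite /= ?lexx ?t0 ?slide0.
- by exists t; rewrite /= ?lexx ?t0.
Qed.

Let slide_limit z t : 0 < t -> (forall s, 0 <= s < t -> Omega (slide z s)) -> Omega (slide z t).
Proof.
move=> t0 h; apply: contrapT => nO.
have cs := @slide_continuous z.
have : \forall s \near t, ~ Omega (slide z s).
  apply: (near_cont (Q := fun y => ~ Omega y) cs).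
  by apply: open_nbhs_nbhs; split=> //; exact: closed_openC.
move=> /nbhs_ballP[e /= e1 he]; have {e1}e0 : 0 < e by [].
(* Within distance [e] of [t], strictly before [t], and still nonnegative. *)
pose s := t - Num.min (e / 2) t; have m0 : 0 < Num.min (e / 2) t.
  by rewrite lt_min; apply/andP; split; lra.
have m1 : Num.min (e / 2) t <= t by rewrite ge_min lexx orbT.
have m2 : Num.min (e / 2) t <= e / 2 by rewrite ge_min lexx.
apply: (he s); last by apply: h; rewrite /s; lra.
by rewrite /ball /= /s opprB addrC subrK gtr0_norm //; lra.
Qed.

Let slide_edge_Omega z t : Omega z -> 0 < z.2 -> argmax c z.1 \subset low ->
  p10 \in argmax c z.1 -> p01 \in argmax c z.1 ->
  0 <= t <= Num.min z.2 (sigma c z.1) -> Omega (slide z t).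
Proof.
move=> Oz l0 vlow m10 m01 /andP[t0 tm].
have strict s : 0 <= s < Num.min z.2 (sigma c z.1) -> Omega (slide z s).
  move=> /andP[s0]; rewrite lt_min => /andP[s1 s2]; apply: slide_path => // u /andP[u0 us].
  apply: slide_edge => //; last exact: Omega_tri.
    by rewrite u0 (le_lt_trans us).
  exact: le_lt_trans s2.
move: tm; rewrite le_eqVlt => /predU1P[et|tm]; last by apply: strict; rewrite t0.
move: t0; rewrite le_eqVlt => /predU1P[<-|t0]; first by rewrite slide0.
by apply: slide_limit => // s hs; apply: strict; rewrite -et.
Qed.

(** From the region of (0,0) the slide stays in it until the time [t0] at which (1,0) or (0,1)
    catches up. By closedness the curve at [t0] is still in [Omega], so [low_vertex] makes both
    catch up together, and the edge case takes over. *)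
Lemma slide_Omega z t : Omega z -> slidable z ->
  0 <= t <= Num.min z.2 (sigma c z.1) -> Omega (slide z t).
Proof.
move=> Oz [l0 vlow] tm.
have [e00|[m10 m01]] := low_vertex gw smooth l0 vlow (Omega_tri Oz); last first.
  exact: slide_edge_Omega.
have sh b u : trop_term c b (z.1.1 + u, z.1.2 + u) = trop_term c b z.1 + u * slope (1, 1) b.
  by have := trop_term_shift c b z.1 u (1, 1); rewrite /= !mulr1.
have s00 : slope (1, 1) p00 = 0 :> R by rewrite /slope /=; ring.
have s10 : slope (1, 1) p10 = 1 :> R by rewrite /slope /=; ring.
have s01 : slope (1, 1) p01 = 1 :> R by rewrite /slope /=; ring.
set T := Num.min _ _ in tm *.
pose m := Num.max (trop_term c p10 z.1) (trop_term c p01 z.1).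
pose t0 := trop_term c p00 z.1 - m.
have m1 : trop_term c p10 z.1 <= m by rewrite le_max lexx.
have m2 : trop_term c p01 z.1 <= m by rewrite le_max lexx orbT.
have m00 : p00 \in argmax c z.1 by rewrite e00 finset.in_set1.
have t00 : 0 < t0.
  by rewrite subr_gt0 gt_max !argmax_lt // e00 finset.in_set1.
have TE : T <= z.2 /\ T <= sigma c z.1 by rewrite /T !ge_min !lexx orbT.
have strict s : 0 <= s < T -> s < t0 -> Omega (slide z s).
  move=> /andP[s0 sT] st0; apply: slide_path => // u /andP[u0 us].
  apply: slide_region => //; last exact: Omega_tri.
    by rewrite u0 /=; lra.
  have ulow : argmax c (z.1.1 + u, z.1.2 + u) \subset low by rewrite -sigma_gt; lra.
  have only b : b \in argmax c (z.1.1 + u, z.1.2 + u) -> b = p00.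
    move=> bm; move/argmaxP: (bm) => /(_ p00); rewrite !sh s00.
    have [//|->|->] := lowP (fintype.subsetP ulow _ bm).
      by rewrite s10 => h; exfalso; rewrite /t0 in st0; lra.
    by rewrite s01 => h; exfalso; rewrite /t0 in st0; lra.
  apply/setP => b; rewrite finset.in_set1; apply/idP/eqP => [/only//|->].
  by have [e em] := argmax_ex c (z.1.1 + u, z.1.2 + u); rewrite -(only e em).
have [Tt0|t0T] := leP T t0.
  move: tm => /andP[tt]; rewrite le_eqVlt => /predU1P[et|tT].
    rewrite et; apply: slide_limit => [|s /andP[hs hs']].
      by have /slidableE : slidable z by [].
    by apply: strict; [rewrite hs|exact: lt_le_trans Tt0].
  by apply: strict; [rewrite tt|exact: lt_le_trans Tt0].
have [tt0|t0t] := ltP t t0; first by apply: strict => //; lra.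
have Oz' : Omega (slide z t0).
  by apply: slide_limit => // s /andP[hs hs']; apply: strict => //; lra.
have l0' : 0 < (slide z t0).2 by rewrite /slide /=; lra.
have vlow' : argmax c (slide z t0).1 \subset low by rewrite /slide /= -sigma_gt; lra.
have [e00'|[m10 m01]] := low_vertex gw smooth l0' vlow' (Omega_tri Oz').
  (* By the choice of [t0], one of (1,0), (0,1) ties with (0,0), which therefore is not the only
     maximal term. *)
  exfalso; have m00' : p00 \in argmax c (slide z t0).1 by rewrite e00' finset.in_set1.
  have : trop_term c p10 (slide z t0).1 < trop_term c p00 (slide z t0).1.
    by apply: argmax_lt => //; rewrite e00' finset.in_set1.
  have : trop_term c p01 (slide z t0).1 < trop_term c p00 (slide z t0).1.
    by apply: argmax_lt => //; rewrite e00' finset.in_set1.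
  rewrite /slide /= !sh s00 s10 s01 /t0 => h1 h2.
  have : m = trop_term c p10 z.1 \/ m = trop_term c p01 z.1.
    by rewrite /m; case: (leP (trop_term c p10 z.1)) => _; [right|left].
  by case=> em; rewrite em in h1 h2; lra.
have -> : slide z t = slide (slide z t0) (t - t0) by rewrite slide_add addrC subrK.
apply: slide_edge_Omega => //.
rewrite subr_ge0 t0t /slide /= sigma_shift le_min.
by have [T1 T2] := TE; move: tm => /andP[_ tT]; apply/andP; split; lra.
Qed.

Lemma flow_Omega s z : 0 <= s <= 1 -> Omega z -> Omega (flow s z).
Proof.
move=> s01 Oz; have [sz|nz] := pselect (slidable z); last by rewrite flow_id.
rewrite /flow slide_time_slidable //; apply: slide_Omega => //.
by have /slidableE := sz; move: s01 => /andP[s0 s1] m0; apply/andP; split; nra.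
Qed.

End Flow.

(** * Reflections *)

Definition flip (b : bool) (i : 'I_4) : 'I_4 := if b then rev_ord i else i.

Definition relabel (b1 b2 : bool) (a : 'I_4 * 'I_4) : 'I_4 * 'I_4 := (flip b1 a.1, flip b2 a.2).

Lemma flipK b : involutive (flip b).
Proof. by case: b => // i; exact: rev_ordK. Qed.

Lemma relabelK b1 b2 : involutive (relabel b1 b2).
Proof. by move=> [i j]; rewrite /relabel /= !flipK. Qed.

Lemma flipE b (i : 'I_4) : (flip b i : nat)%:Z = (if b then 3 - i%:Z else i%:Z).
Proof. by case: b => //=; have := ltn_ord i; lia. Qed.

Section Reflections.
Variables (R : realType) (b1 b2 : bool).
Implicit Types (v p w : R * R) (z : R * R * R) (c : 'I_4 -> 'I_4 -> R).

Definition reflect_plane v : R * R := ((-1) ^+ b1 * v.1, (-1) ^+ b2 * v.2).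

Definition reflect_int (u : int * int) : int * int := ((-1) ^+ b1 * u.1, (-1) ^+ b2 * u.2).

Definition reflect_coeff c i j := c (flip b1 i) (flip b2 j).

(* A vertical reflection exchanges the lowest and the highest vertex. *)
Definition reflect_curve z : R * R * R :=
  (reflect_plane (if b2 then vertex1 z else vertex0 z), (-1) ^+ b1 * (-1) ^+ b2 * z.2).

(** The absolute value removes the case distinction on the sign of l, whence the continuity of
    [v_1]. *)
Lemma vertex1E z : vertex1 z = (z.1.1 + z.2, z.1.2 + `|z.2|).
Proof.
rewrite /vertex1; case: ifP => h; first by rewrite ger0_norm.
by rewrite ltr0_norm // ltNge h.
Qed.

Lemma reflect_planeK : involutive reflect_plane.
Proof. by move=> [x y]; rewrite /reflect_plane /= !mulrA -!expr2 !sqrr_sign !mul1r. Qed.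

Lemma reflect_intK : involutive reflect_int.
Proof. by move=> [x y]; rewrite /reflect_int /= !mulrA -!expr2 !sqrr_sign !mul1r. Qed.

Lemma reflect_plane_continuous : continuous reflect_plane.
Proof. by rewrite /reflect_plane; cont. Qed.

Lemma reflect_curve_continuous : continuous reflect_curve.
Proof.
rewrite /reflect_curve (_ : (fun z => _) = (fun z =>
  (reflect_plane (if b2 then (z.1.1 + z.2, z.1.2 + `|z.2|) else z.1), (-1) ^+ b1 * (-1) ^+ b2 * z.2))).
  by case: b2; rewrite /reflect_plane /=; cont.
by apply/funext => z; rewrite vertex1E.
Qed.

Lemma reflect_coeffK c : reflect_coeff (reflect_coeff c) = c.
Proof. by apply/funext => i; apply/funext => j; rewrite /reflect_coeff !flipK. Qed.

Lemma vertex0_reflect z :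
  vertex0 (reflect_curve z) = reflect_plane (if b2 then vertex1 z else vertex0 z).
Proof. by []. Qed.

Lemma vertex1_reflect z :
  vertex1 (reflect_curve z) = reflect_plane (if b2 then vertex0 z else vertex1 z).
Proof.
rewrite vertex1E /reflect_curve /= !normrM !normrX normrN1 !expr1n !mul1r vertex1E.
by rewrite /reflect_plane /vertex0; case: b2 => /=; rewrite ?expr0 ?expr1; congr (_, _); ring.
Qed.

Lemma reflect_curveK : involutive reflect_curve.
Proof.
move=> z; rewrite {1}/reflect_curve vertex1_reflect vertex0_reflect.
rewrite [z in RHS]surjective_pairing /= mulrA; congr (_, _).
  by case: b2; rewrite reflect_planeK.
rewrite -[RHS]mul1r; congr (_ * _).
by rewrite mulrACA -!expr2 !sqrr_sign mulr1.
Qed.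

(** Changing the sign of a coordinate negates its exponents; a monomial factor, the summand common
    to all terms, brings them back to the range from 0 to 3. *)
Lemma reflect_term c a v : trop_term (reflect_coeff c) a (reflect_plane v) =
  trop_term c (relabel b1 b2 a) v + (- b1%:R * 3 * v.1 - b2%:R * 3 * v.2).
Proof.
have fl b (i : 'I_4) : (flip b i)%:R = (if b then 3 - i%:R else i%:R) :> R.
  by have := congr1 (fun x : int => x%:~R : R) (flipE b i); case: b => /=; rewrite ?intrB.
rewrite /trop_term /reflect_coeff /= !fl.
by case: b1; case: b2; rewrite /= ?expr0 ?expr1; ring.
Qed.

Lemma reflect_det (p q r : 'I_4 * 'I_4) : absz (det2 (edge_vec (relabel b1 b2 p) (relabel b1 b2 q))
    (edge_vec (relabel b1 b2 p) (relabel b1 b2 r))) =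
  absz (det2 (edge_vec p q) (edge_vec p r)).
Proof.
have e x y : edge_vec (relabel b1 b2 x) (relabel b1 b2 y) = reflect_int (edge_vec x y).
  rewrite /edge_vec /reflect_int /relabel; congr (_, _); rewrite !flipE.
    by case: b1; rewrite ?expr0 ?expr1 /=; ring.
  by case: b2; rewrite ?expr0 ?expr1 /=; ring.
rewrite !e (_ : det2 _ _ = (-1) ^+ b1 * (-1) ^+ b2 * det2 (edge_vec p q) (edge_vec p r)).
  by rewrite !abszM !abszX abszN !exp1n !mul1n.
by rewrite /det2 /reflect_int /=; ring.
Qed.

Lemma reflect_argmax c v a :
  (a \in argmax (reflect_coeff c) (reflect_plane v)) = (relabel b1 b2 a \in argmax c v).
Proof. exact: (argmax_relabel (@relabelK b1 b2) (reflect_term c)). Qed.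

Lemma reflect_fits c : fits_unimodular c -> fits_unimodular (reflect_coeff c).
Proof.
exact: (fits_relabel (@relabelK b1 b2) reflect_planeK (reflect_term c) reflect_det).
Qed.

End Reflections.

(** At l = 0 some legs merely change the vertex to which they are attributed. Both descriptions
    include this case, so reflections, which may change the sign of l, need not treat it
    separately. *)
Lemma curve11_le0 (R : realType) (z : R * R * R) (p : R * R) : z.2 <= 0 -> curve11 z p <->
  [\/ z.1.1 + z.2 <= p.1 <= z.1.1 /\ p.2 - z.1.2 = z.1.1 - p.1,
      z.1.1 <= p.1 /\ p.2 = z.1.2, p.1 = z.1.1 /\ p.2 <= z.1.2 |
      (p.1 <= z.1.1 + z.2 /\ p.2 = z.1.2 - z.2) \/
      (p.1 = z.1.1 + z.2 /\ z.1.2 - z.2 <= p.2)].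
Proof.
rewrite le_eqVlt => /predU1P[l0|l0].
  have l0' : 0 <= z.2 by rewrite l0.
  rewrite (curve11_ge0 _ l0') l0; split.
    case=> [[h h']|[h h']|[h h']|[[h h']|[h h']]].
    - by apply: Or41; split; lra.
    - by apply: Or44; left; split; lra.
    - by apply: Or43; split; lra.
    - by apply: Or42; split; lra.
    - by apply: Or44; right; split; lra.
  case=> [[h h']|[h h']|[h h']|[[h h']|[h h']]].
  - by apply: Or41; split; lra.
  - by apply: Or44; left; split; lra.
  - by apply: Or43; split; lra.
  - by apply: Or42; split; lra.
  - by apply: Or44; right; split; lra.
case: z p l0 => [[x y] l] [p1 p2] /= l0.
rewrite /curve11 /vertex0 /vertex1 /= leNgt l0 /=; split.
  move=> [[t t01 [e1 e2]]|[[[]|]|] [t t0 [e1 e2]]]; move: e1 e2 => /= -> ->.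
  - by apply: Or41; split; [apply/andP; split; nra|ring].
  - by apply: Or42; split; nra.
  - by apply: Or43; split; nra.
  - by apply: Or44; left; split; nra.
  - by apply: Or44; right; split; nra.
move=> [[h1 h2]|[h1 h2]|[h1 h2]|[[h1 h2]|[h1 h2]]].
- left; have nl : 0 < - l by lra.
  have l1 : l != 0 by rewrite lt_eqF.
  exists ((x - p1) / - l); first by rewrite ler_pdivrMr // ler_pdivlMr //; lra.
  have -> : p2 = y + (x - p1) by lra.
  by congr (_, _) => /=; field.
- right; do 3 left; exists (p1 - x) => /=; first by lra.
  by congr (_, _); lra.
- right; do 2 left; right; exists (y - p2) => /=; first by lra.
  by congr (_, _); lra.
- right; left; right; exists (x + l - p1) => /=; first by lra.
  by congr (_, _); lra.
- right; right; exists (p2 - (y - l)) => /=; first by lra.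
  by congr (_, _); lra.
Qed.

Section ReflectTritangent.
Variables (R : realType) (b1 b2 : bool).
Implicit Types (p w : R * R) (z : R * R * R) (c : 'I_4 -> 'I_4 -> R).

Let curve_reflect_sub b1' b2' z p : curve11 z p ->
  curve11 (reflect_curve b1' b2' z) (reflect_plane b1' b2' p).
Proof.
have [l0|l0] := leP 0 z.2.
  have nE := ger0_norm l0; rewrite (curve11_ge0 _ l0); case: b1' b2' => -[].
  - rewrite (@curve11_ge0 _ (reflect_curve _ _ z)); last by rewrite /reflect_curve /= ?expr1 ?expr0; lra.
    rewrite /reflect_curve /reflect_plane ?vertex1E /vertex0 /= ?nE ?expr1 ?expr0.
    case=> [[h h']|[h h']|[h h']|[[h h']|[h h']]].
    + by apply: Or41; split; lra.
    + by apply: Or44; left; split; lra.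
    + by apply: Or44; right; split; lra.
    + by apply: Or42; split; lra.
    + by apply: Or43; split; lra.
  - rewrite (@curve11_le0 _ (reflect_curve _ _ z)); last by rewrite /reflect_curve /= ?expr1 ?expr0; lra.
    rewrite /reflect_curve /reflect_plane ?vertex1E /vertex0 /= ?nE ?expr1 ?expr0.
    case=> [[h h']|[h h']|[h h']|[[h h']|[h h']]].
    + by apply: Or41; split; lra.
    + by apply: Or42; split; lra.
    + by apply: Or43; split; lra.
    + by apply: Or44; left; split; lra.
    + by apply: Or44; right; split; lra.
  - rewrite (@curve11_le0 _ (reflect_curve _ _ z)); last by rewrite /reflect_curve /= ?expr1 ?expr0; lra.
    rewrite /reflect_curve /reflect_plane ?vertex1E /vertex0 /= ?nE ?expr1 ?expr0.
    case=> [[h h']|[h h']|[h h']|[[h h']|[h h']]].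
    + by apply: Or41; split; lra.
    + by apply: Or44; left; split; lra.
    + by apply: Or44; right; split; lra.
    + by apply: Or42; split; lra.
    + by apply: Or43; split; lra.
  - rewrite (@curve11_ge0 _ (reflect_curve _ _ z)); last by rewrite /reflect_curve /= ?expr1 ?expr0; lra.
    rewrite /reflect_curve /reflect_plane ?vertex1E /vertex0 /= ?nE ?expr1 ?expr0.
    case=> [[h h']|[h h']|[h h']|[[h h']|[h h']]].
    + by apply: Or41; split; lra.
    + by apply: Or42; split; lra.
    + by apply: Or43; split; lra.
    + by apply: Or44; left; split; lra.
    + by apply: Or44; right; split; lra.
have nE := ltr0_norm l0; rewrite (curve11_le0 _ (ltW l0)); case: b1' b2' => -[].
- rewrite (@curve11_le0 _ (reflect_curve _ _ z)); last by rewrite /reflect_curve /= ?expr1 ?expr0; lra.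
  rewrite /reflect_curve /reflect_plane ?vertex1E /vertex0 /= ?nE ?expr1 ?expr0.
  case=> [[h h']|[h h']|[h h']|[[h h']|[h h']]].
  + by apply: Or41; split; lra.
  + by apply: Or44; left; split; lra.
  + by apply: Or44; right; split; lra.
  + by apply: Or42; split; lra.
  + by apply: Or43; split; lra.
- rewrite (@curve11_ge0 _ (reflect_curve _ _ z)); last by rewrite /reflect_curve /= ?expr1 ?expr0; lra.
  rewrite /reflect_curve /reflect_plane ?vertex1E /vertex0 /= ?nE ?expr1 ?expr0.
  case=> [[h h']|[h h']|[h h']|[[h h']|[h h']]].
  + by apply: Or41; split; lra.
  + by apply: Or42; split; lra.
  + by apply: Or43; split; lra.
  + by apply: Or44; left; split; lra.
  + by apply: Or44; right; split; lra.
- rewrite (@curve11_ge0 _ (reflect_curve _ _ z)); last by rewrite /reflect_curve /= ?expr1 ?expr0; lra.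
  rewrite /reflect_curve /reflect_plane ?vertex1E /vertex0 /= ?nE ?expr1 ?expr0.
  case=> [[h h']|[h h']|[h h']|[[h h']|[h h']]].
  + by apply: Or41; split; lra.
  + by apply: Or44; left; split; lra.
  + by apply: Or44; right; split; lra.
  + by apply: Or42; split; lra.
  + by apply: Or43; split; lra.
- rewrite (@curve11_le0 _ (reflect_curve _ _ z)); last by rewrite /reflect_curve /= ?expr1 ?expr0; lra.
  rewrite /reflect_curve /reflect_plane ?vertex1E /vertex0 /= ?nE ?expr1 ?expr0.
  case=> [[h h']|[h h']|[h h']|[[h h']|[h h']]].
  + by apply: Or41; split; lra.
  + by apply: Or42; split; lra.
  + by apply: Or43; split; lra.
  + by apply: Or44; left; split; lra.
  + by apply: Or44; right; split; lra.
Qed.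

Lemma curve_reflect z :
  curve11 (reflect_curve b1 b2 z) = reflect_plane b1 b2 @^-1` curve11 z.
Proof.
apply/seteqP; split=> p; rewrite /=.
  by move/(curve_reflect_sub b1 b2); rewrite reflect_curveK.
by move/(curve_reflect_sub b1 b2); rewrite reflect_planeK.
Qed.

Lemma tritangent_reflect c w z :
  tritangent_disp w (corner_locus c) (curve11 z) ->
  tritangent_disp (reflect_plane b1 b2 w) (corner_locus (reflect_coeff b1 b2 c))
    (curve11 (reflect_curve b1 b2 z)).
Proof.
rewrite curve_reflect (corner_relabel (@relabelK b1 b2) (@reflect_planeK R b1 b2) (reflect_term b1 b2 c)).
apply: (@tritangent_disp_sym R _ (reflect_int b1 b2)).
- exact: reflect_planeK.
- exact: reflect_plane_continuous.
- by rewrite /reflect_plane !mulr0.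
- move=> p t u; rewrite /reflect_plane /reflect_int /=.
  rewrite !intrM; congr (_, _).
    by case: b1; rewrite ?expr0 ?expr1 ?mulrN1z ?mulr1z; ring.
  by case: b2; rewrite ?expr0 ?expr1 ?mulrN1z ?mulr1z; ring.
- exact: reflect_intK.
- move=> u; rewrite /reflect_int.
  by case: b1; case: b2; rewrite /= ?expr0 ?expr1 ?mul1r ?mulN1r ?coprimeNz ?coprimezN.
- move=> u v; rewrite (_ : det2 _ _ = (-1) ^+ b1 * (-1) ^+ b2 * det2 u v).
    by rewrite !abszM !abszX abszN !exp1n !mul1n.
  by rewrite /det2 /reflect_int /=; ring.
Qed.

End ReflectTritangent.

(** * The removed cells *)

Section DualCells.
Variables (R : realType) (c : 'I_4 -> 'I_4 -> R).
Implicit Types (v : R * R) (a b p q r : 'I_4 * 'I_4) (A S T : {set 'I_4 * 'I_4}).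

Lemma lattice_hull_vertex A a : a \in A -> lattice_hull R A (a.1%:R, a.2%:R).
Proof.
move=> aA; exists (fun b => (b == a)%:R); split.
- by move=> b; rewrite ler0n.
- by move=> b bA; case: eqP => // e; rewrite -e (negbTE bA) in aA.
- by rewrite (bigD1 a) //= eqxx big1 ?addr0 // => b /negbTE ->.
- by congr (_, _); rewrite (bigD1 a) //= eqxx mul1r big1 ?addr0 // => b /negbTE ->; rewrite mul0r.
Qed.

(* Barycentric coordinates in a unimodular triangle are integral at lattice points. *)
Lemma unimodular_hull T a (x : 'I_4 * 'I_4 -> R) : unimodular_triangle T ->
  (forall b, 0 <= x b) -> (forall b, b \notin T -> x b = 0) -> \sum_b x b = 1 ->
  (a.1%:R, a.2%:R) = (\sum_b x b * b.1%:R, \sum_b x b * b.2%:R) -> x a != 0.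
Proof.
move=> [p [q [r [eT det1]]]] x0 xT x1 [ea1 ea2].
have dE : det2 (edge_vec p q) (edge_vec p r) != 0.
  by apply/eqP => e; move: det1; rewrite -/(edge_vec p q) -/(edge_vec p r) e.
have pq : p != q by apply: contraNneq dE => ->; rewrite /det2 /edge_vec /= !subrr; apply/eqP; ring.
have pr : p != r by apply: contraNneq dE => ->; rewrite /det2 /edge_vec /= !subrr; apply/eqP; ring.
have qr : q != r by apply: contraNneq dE => ->; rewrite /det2 /edge_vec /=; apply/eqP; ring.
have sum3 (F : 'I_4 * 'I_4 -> R) : \sum_b x b * F b = x p * F p + x q * F q + x r * F r.
  rewrite (bigD1 p) //= (bigD1 q) /= ?(eq_sym q) // (bigD1 r) /=; last first.
    by rewrite !(eq_sym r) pr qr.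
  rewrite big1 ?addr0 ?addrA // => b /andP[/andP[bp bq] br].
  by rewrite xT ?mul0r // eT !inE !negb_or bp bq br.
rewrite sum3 in ea1; rewrite sum3 in ea2.
have := sum3 (fun=> 1); under eq_bigr do rewrite mulr1.
rewrite x1 !mulr1 => xs.
pose D : int := det2 (edge_vec p q) (edge_vec p r).
have D2 : D * D = 1 by have : D = 1 \/ D = -1 by [clear -det1; rewrite /D /edge_vec; lia]; case=> ->.
have DR : D%:~R = (q.1%:R - p.1%:R) * (r.2%:R - p.2%:R) - (q.2%:R - p.2%:R) * (r.1%:R - p.1%:R) :> R.
  by rewrite /D /det2 /edge_vec /= !(intrB, intrM).
(* Cramer's rule for the coordinates at [q] and [r], with [D] its own inverse. They are nonnegative
   integers with sum at most 1, so [a] is a vertex. *)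
pose m := D * det2 (edge_vec p a) (edge_vec p r).
pose n := D * det2 (edge_vec p q) (edge_vec p a).
have D2R : D%:~R * D%:~R = 1 :> R by rewrite -intrM D2.
have xp : x p = 1 - x q - x r by lra.
have mE : x q = m%:~R.
  rewrite /m intrM /det2 /edge_vec /= !(intrB, intrM) -!pmulrn ea1 ea2.
  transitivity (D%:~R * D%:~R * x q); first by rewrite D2R mul1r.
  by rewrite DR xp; ring.
have nE : x r = n%:~R.
  rewrite /n intrM /det2 /edge_vec /= !(intrB, intrM) -!pmulrn ea1 ea2.
  transitivity (D%:~R * D%:~R * x r); first by rewrite D2R mul1r.
  by rewrite DR xp; ring.
have m0 : 0 <= m by rewrite -(ler0z R) -mE.
have n0 : 0 <= n by rewrite -(ler0z R) -nE.
have mn1 : m + n <= 1 by rewrite -(ler_int R) intrD -mE -nE; have := x0 p; lra.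
have same b : x b = 1 -> (a.1%:R = b.1%:R :> R) -> (a.2%:R = b.2%:R :> R) -> x a != 0.
  move=> xb /eqP; rewrite eqr_nat => /eqP h1 /eqP; rewrite eqr_nat => /eqP h2.
  have -> : a = b by rewrite [a]surjective_pairing [b]surjective_pairing; congr (_, _); apply: val_inj.
  by rewrite xb oner_eq0.
have cases : [\/ m = 0 /\ n = 0, m = 1 /\ n = 0 | m = 0 /\ n = 1].
  have : (m = 0 /\ n = 0) \/ (m = 1 /\ n = 0) \/ (m = 0 /\ n = 1) by clear -m0 n0 mn1; lia.
  by case=> [?|[?|?]]; [apply: Or31|apply: Or32|apply: Or33].
case: cases => -[em en]; rewrite em in mE; rewrite en in nE.
- by apply: (same p); rewrite ?xp ?ea1 ?ea2 ?mE ?nE ?xp ?mE ?nE; ring.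
- by apply: (same q); rewrite ?ea1 ?ea2 ?xp ?mE ?nE; ring.
- by apply: (same r); rewrite ?ea1 ?ea2 ?xp ?mE ?nE; ring.
Qed.

Hypothesis smooth : smooth_curve c.

(** A maximal exponent is a lattice point of the hull of [S]. Inside a unimodular triangle it
    carries a nonzero weight at itself, hence belongs to [S]. *)
Lemma smooth_fits : fits_unimodular c.
Proof.
move=> v; have [T [S [uT /fintype.subsetP ST e]]] := smooth v.
exists T; split=> //; apply/fintype.subsetP => a am.
have : dual_cell c v (a.1%:R, a.2%:R) by exact: lattice_hull_vertex.
rewrite e => -[x [x0 xS x1 xa]]; apply: (ST a); apply: contraT => aS.
have : x a != 0.
  apply: (unimodular_hull uT x0 _ x1 xa) => b bT; apply: xS.
  by apply: contra bT; exact: ST.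
by rewrite xS ?eqxx.
Qed.

(** A unimodular triangle has no lattice points besides its vertices. So the polytope conditions in
    (R1)--(R4) can be read off from the maximal terms. *)
Lemma dual_cell_vertex v a : dual_cell c v (a.1%:R, a.2%:R) <-> a \in argmax c v.
Proof.
split=> [[x [x0 xS x1 xa]]|]; last exact: lattice_hull_vertex.
have [T [uT /fintype.subsetP sT]] := smooth_fits v.
apply: contraT => am; have : x a != 0.
  apply: (unimodular_hull uT x0 _ x1 xa) => b bT; apply: xS.
  by apply: contra bT; exact: sT.
by rewrite xS ?eqxx.
Qed.

Lemma dual_cell_point v i j : (i < 4)%N -> (j < 4)%N ->
  dual_cell c v (lattice_point i j) <-> (inord i, inord j) \in argmax c v.
Proof. by move=> hi hj; rewrite -dual_cell_vertex /lattice_point /= !inordK. Qed.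

End DualCells.

(** The third vertex of a unimodular triangle on the edge from (1,0) to (0,1) has coordinate sum 0
    or 2, and 2 is what (R1) forbids. *)
Lemma low_of_middle (T A : {set 'I_4 * 'I_4}) : unimodular_triangle T -> A \subset T ->
  p10 \in A -> p01 \in A -> (forall a, a \in A -> (a.1 + a.2 != 2)%N) -> A \subset low.
Proof.
move=> uT /fintype.subsetP sT h10 h01 h2; apply/fintype.subsetP => a am.
have [e [eT det1]] := unimodular_triangleP uT (sT _ h10) (sT _ h01) isT.
have := sT _ am; rewrite eT !inE => /orP[/orP[]|]/eqP ea; rewrite ea // -ea.
have := h2 a am; rewrite -ea in det1; move: det1; rewrite /det2 /edge_vec /=.
by clear; move=> h1 /eqP h; lia.
Qed.

Section Removal.
Variables (R : realType).
Implicit Types (c : 'I_4 -> 'I_4 -> R) (v w : R * R) (z y : R * R * R) (s : R).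

Definition removable (b1 b2 : bool) c z :=
  slidable (reflect_coeff b1 b2 c) (reflect_curve b1 b2 z).

Definition moved_vertex (b2 : bool) z : R * R := if b2 then vertex1 z else vertex0 z.

Lemma removableE b1 b2 c z : removable b1 b2 c z <->
  0 < (-1) ^+ b1 * (-1) ^+ b2 * z.2 /\
  argmax (reflect_coeff b1 b2 c) (reflect_plane b1 b2 (moved_vertex b2 z)) \subset low.
Proof. by []. Qed.

Lemma region_low b1 b2 c v : region c (relabel b1 b2 p00) v ->
  argmax (reflect_coeff b1 b2 c) (reflect_plane b1 b2 v) \subset low.
Proof.
move=> e; apply/fintype.subsetP => a; rewrite reflect_argmax e finset.in_set1.
by rewrite (inj_eq (inv_inj (@relabelK b1 b2))) => /eqP->; rewrite inE.
Qed.

Lemma edge_low b1 b2 c v : fits_unimodular c ->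
  relabel b1 b2 p10 \in argmax c v -> relabel b1 b2 p01 \in argmax c v ->
  (forall a, a \in argmax c v -> ((relabel b1 b2 a).1 + (relabel b1 b2 a).2 != 2)%N) ->
  argmax (reflect_coeff b1 b2 c) (reflect_plane b1 b2 v) \subset low.
Proof.
move=> fits h10 h01 h2.
have [T [uT sT]] := reflect_fits b1 b2 fits (reflect_plane b1 b2 v).
apply: (low_of_middle uT sT); rewrite ?reflect_argmax // => a.
by rewrite reflect_argmax => /h2; rewrite relabelK.
Qed.

Lemma inord_relabel (i j : nat) (a : 'I_4 * 'I_4) : (i < 4)%N -> (j < 4)%N ->
  a.1 = i :> nat -> a.2 = j :> nat -> (inord i, inord j) = a.
Proof.
move=> hi hj h1 h2; rewrite [a]surjective_pairing.
by congr (_, _); apply: val_inj; rewrite /= inordK.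
Qed.

(** The pair [b1], [b2] is false, false for (U1) and (R1); true, true for (U2) and (R3); true, false
    for (U3) and (R2); false, true for (U4) and (R4). *)
Lemma removed_removable c z : smooth_curve c -> removedU c z \/ removedR c z ->
  exists b1 b2, removable b1 b2 c z.
Proof.
move=> smooth; have fits := smooth_fits smooth.
have corner b1 b2 : relabel b1 b2 p00 = (if b1 then ord_max else ord0, if b2 then ord_max else ord0).
  by case: b1; case: b2; congr (_, _); apply: val_inj.
have edge b1 b2 i j i' j' v : (i < 4)%N -> (j < 4)%N -> (i' < 4)%N -> (j' < 4)%N ->
    dual_cell c v (lattice_point i j) -> dual_cell c v (lattice_point i' j') ->
    (relabel b1 b2 p10).1 = i :> nat -> (relabel b1 b2 p10).2 = j :> nat ->
    (relabel b1 b2 p01).1 = i' :> nat -> (relabel b1 b2 p01).2 = j' :> nat ->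
    (forall a, a \in argmax c v -> ((relabel b1 b2 a).1 + (relabel b1 b2 a).2 = 2)%N -> False) ->
    argmax (reflect_coeff b1 b2 c) (reflect_plane b1 b2 v) \subset low.
  move=> hi hj hi' hj' /(dual_cell_point smooth _ hi hj) m1 /(dual_cell_point smooth _ hi' hj') m2.
  move=> e1 e2 e3 e4 h; apply: edge_low => //.
  - by rewrite -(inord_relabel hi hj e1 e2).
  - by rewrite -(inord_relabel hi' hj' e3 e4).
  - by move=> a am; apply/eqP; exact: h.
have cellP v a i j : a \in argmax c v -> a.1 = i :> nat -> a.2 = j :> nat ->
    dual_cell c v (lattice_point i j).
  by move=> am <- <-; apply/(dual_cell_vertex smooth).
case=> [[]|[]].
- move=> [l0 h]; exists false, false; apply/removableE; rewrite /= !mul1r; split=> //.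
  by apply: region_low; rewrite corner.
- move=> [l0 h]; exists true, true; apply/removableE; rewrite /= mulrNN !mul1r; split=> //.
  by apply: region_low; rewrite corner.
- move=> [l0 h]; exists true, false; apply/removableE; rewrite /= mulr1 mulN1r oppr_gt0; split=> //.
  by apply: region_low; rewrite corner.
- move=> [l0 h]; exists false, true; apply/removableE; rewrite /= mul1r mulN1r oppr_gt0; split=> //.
  by apply: region_low; rewrite corner.
- move=> [l0 h1 h2 hn]; exists false, false; apply/removableE; rewrite /= !mul1r; split=> //.
  apply: (edge _ _ 1%N 0%N 0%N 1%N) => // -[[i hi] [j hj]] am /= e.
  by apply: (hn i); [lia|apply: (cellP _ _ _ _ am) => //=; lia].
- move=> [l0 h1 h2 hn]; exists true, false; apply/removableE; rewrite /= mulr1 mulN1r oppr_gt0; split=> //.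
  apply: (edge _ _ 2%N 0%N 3%N 1%N) => // -[[i hi] [j hj]] am /= e.
  by apply: (hn j); [lia|apply: (cellP _ _ _ _ am) => //=; lia].
- move=> [l0 h1 h2 hn]; exists true, true; apply/removableE; rewrite /= mulrNN !mul1r; split=> //.
  apply: (edge _ _ 2%N 3%N 3%N 2%N) => // -[[i hi] [j hj]] am /= e.
  (* The reflected condition is i + j = 4, and (R3) lists these exponents as (1 + k, 3 - k), so k =
     i - 1. *)
  by apply: (hn (i - 1)%N); [lia|apply: (cellP _ _ _ _ am) => //=; lia].
move=> [l0 h1 h2 hn]; exists false, true; apply/removableE; rewrite /= mul1r mulN1r oppr_gt0; split=> //.
apply: (edge _ _ 1%N 3%N 0%N 2%N) => // -[[i hi] [j hj]] am /= e.
by apply: (hn i); [lia|apply: (cellP _ _ _ _ am) => //=; lia].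
Qed.

Lemma generic_reflect b1 b2 : generic (reflect_plane b1 b2 (1, Num.sqrt 2 : R)).
Proof. by rewrite /reflect_plane /= mulr1; exact: generic_sign. Qed.

(** This direction needs tritangency: [low_vertex] leaves only the cells named in the U and R
    conditions. *)
Lemma removable_removed b1 b2 c z : smooth_curve c ->
  tritangent_disp (1, Num.sqrt 2) (corner_locus c) (curve11 z) ->
  removable b1 b2 c z -> removedU c z \/ removedR c z.
Proof.
move=> smooth tri rem; have fits := smooth_fits smooth.
have [l0 slow] := rem.
have tri' := tritangent_reflect b1 b2 tri.
have corner : relabel b1 b2 p00 = (if b1 then ord_max else ord0, if b2 then ord_max else ord0).
  by case: (b1); case: (b2); congr (_, _); apply: val_inj.
have [e00|[h10 h01]] := low_vertex (@generic_reflect b1 b2) (reflect_fits b1 b2 fits) l0 slow tri'.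
  left; have e : region c (relabel b1 b2 p00) (moved_vertex b2 z).
    rewrite /region /=; apply/setP => a.
    rewrite -[a in LHS](@relabelK b1 b2) -reflect_argmax e00 !finset.in_set1.
    by rewrite (can2_eq (@relabelK b1 b2) (@relabelK b1 b2)).
  rewrite corner in e; move: l0 e; rewrite /reflect_curve /moved_vertex /=.
  case: (b1); case: (b2); rewrite /= ?expr0 ?expr1 ?mulrNN ?mulr1 ?mul1r ?mulN1r ?oppr_gt0 => l0 e.
  - by apply: Or42.
  - by apply: Or43.
  - by apply: Or44.
  - by apply: Or41.
right.
have m10 : relabel b1 b2 p10 \in argmax c (moved_vertex b2 z) by rewrite -reflect_argmax.
have m01 : relabel b1 b2 p01 \in argmax c (moved_vertex b2 z) by rewrite -reflect_argmax.
have cellP a i j : a \in argmax c (moved_vertex b2 z) -> a.1 = i :> nat -> a.2 = j :> nat ->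
    dual_cell c (moved_vertex b2 z) (lattice_point i j).
  by move=> am <- <-; apply/(dual_cell_vertex smooth).
have offP i j : (i < 4)%N -> (j < 4)%N ->
    ((if b1 then 3 - i else i) + (if b2 then 3 - j else j) = 2)%N ->
    ~ dual_cell c (moved_vertex b2 z) (lattice_point i j).
  move=> hi hj e /(dual_cell_point smooth _ hi hj) m.
  have : relabel b1 b2 (inord i, inord j) \in low.
    by apply: (fintype.subsetP slow); rewrite reflect_argmax relabelK.
  move: e; rewrite inE /relabel /flip; case: (b1); case: (b2);
    rewrite /= !inordK //; clear -hi hj; lia.
move: l0 m10 m01 cellP offP; rewrite /reflect_curve /moved_vertex /=.
case: (b1); case: (b2);
  rewrite /= ?expr0 ?expr1 ?mulrNN ?mulr1 ?mul1r ?mulN1r ?oppr_gt0 => l0 m10 m01 cellP offP.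
- apply: Or43; split=> //; [exact: (cellP _ _ _ m10)|exact: (cellP _ _ _ m01)|].
  by move=> i hi; apply: offP; lia.
- apply: Or42; split=> //; [exact: (cellP _ _ _ m10)|exact: (cellP _ _ _ m01)|].
  by move=> i hi; apply: offP; lia.
- apply: Or44; split=> //; [exact: (cellP _ _ _ m01)|exact: (cellP _ _ _ m10)|].
  by move=> i hi; apply: offP; lia.
- apply: Or41; split=> //; [exact: (cellP _ _ _ m10)|exact: (cellP _ _ _ m01)|].
  by move=> i hi; apply: offP; lia.
Qed.

(** Slidability is the positivity of a minimum of two continuous functions. *)
Lemma near_removable b1 b2 c z : removable b1 b2 c z ->
  \forall y \near z, removable b1 b2 c y.
Proof.
move=> /slidableE h.
pose f y := Num.min (reflect_curve b1 b2 y).2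
  (sigma (reflect_coeff b1 b2 c) (reflect_curve b1 b2 y).1).
have cf : continuous f.
  have cr := @reflect_curve_continuous R b1 b2.
  apply: contmin; first exact: cont_snd.
  by apply: cont_comp; [exact: sigma_continuous|exact: cont_fst].
by apply: nbhs_sub (near_gt cf h) => y /slidableE.
Qed.

(* Excludes that the sign of [l] changes inside a cell all of whose curves have the same
   cells at [v_0] and at [v_1], by looking at curves with [l = 0] and [l < 0]. *)
Lemma no_sign_change c w y y0 ym : generic w -> generic (reflect_plane true false w) ->
  fits_unimodular c ->
  tritangent_disp w (corner_locus c) (curve11 y) ->
  tritangent_disp w (corner_locus c) (curve11 y0) ->
  slidable c y -> y0.2 = 0 -> ym.2 < 0 ->
  argmax c (vertex0 y0) = argmax c (vertex0 y) -> argmax c (vertex1 y0) = argmax c (vertex1 y) ->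
  argmax c (vertex0 ym) = argmax c (vertex0 y) -> argmax c (vertex1 ym) = argmax c (vertex1 y) ->
  False.
Proof.
move=> gw gw' fits tri tri0 [l0 slow] y0l yml e0 e1 em0 em1.
have [e00|[h10 h01]] := low_vertex gw fits l0 slow tri.
  have tri0' := tritangent_reflect true false tri0.
  (* At l = 0 the right leg also starts at [v_0], in the region of (0,0). Reflected, it is a left
     leg starting in the region of (3,0), and 3 is odd. *)
  apply: (@odd_left _ _ _ _ gw' (reflect_fits true false fits) _ (relabel true false p00) _ _ tri0') => //.
    by rewrite /reflect_curve /= y0l mulr0.
  apply/setP => a; rewrite /reflect_curve /= reflect_argmax e0 /vertex0 e00 !finset.in_set1.
  by rewrite (can2_eq (@relabelK true false) (@relabelK true false)).
have v01 : vertex1 y0 = vertex0 y0.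
  by rewrite vertex1E y0l normr0 !addr0 /vertex0 -surjective_pairing.
rewrite v01 e0 in e1.
(* Both vertices of [ym] lie on the line where (1,0) and (0,1) tie, which has direction (1,1),
   whereas for l < 0 they differ by a nonzero multiple of (1,-1). *)
have a10 : p10 \in argmax c (vertex0 ym) by rewrite em0.
have a01 : p01 \in argmax c (vertex0 ym) by rewrite em0.
have b10 : p10 \in argmax c (vertex1 ym) by rewrite em1 -e1.
have b01 : p01 \in argmax c (vertex1 ym) by rewrite em1 -e1.
have := argmax_eq a10 a01; have := argmax_eq b10 b01.
rewrite vertex1E ltr0_norm // /vertex0 /trop_term /= => h1 h2; lra.
Qed.

End Removal.

(** * The retraction *)

Section Retraction.
Variables (R : realType) (c : 'I_4 -> 'I_4 -> R) (Omega : set (R * R * R)).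
Hypotheses (smooth : smooth_curve c) (class_Omega : tritangent_class c Omega).
Hypothesis Omega_closed : closed Omega.
Implicit Types (z : R * R * R) (s : R).

Definition reflect_flow b1 b2 s z : R * R * R :=
  reflect_curve b1 b2 (flow (reflect_coeff b1 b2 c) s (reflect_curve b1 b2 z)).

Let tritangent0 z := tritangent_disp (1, Num.sqrt 2) (corner_locus c) (curve11 z).

Lemma class_tritangent z : Omega z -> tritangent0 z.
Proof. by rewrite /tritangent0 -tritangentE; case: class_Omega => x _ <- /connected_component_sub. Qed.

Lemma class_connected (A : set (R * R * R)) : connected A ->
  (forall z, A z -> tritangent0 z) -> (exists2 z, A z & Omega z) -> A `<=` Omega.
Proof.
have tE z : tritangent0 z = tritangent c z by rewrite tritangentE.
case: class_Omega => x _ <- cA At [z Az xz].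
have {}At y : A y -> tritangent c y by rewrite -tE; exact: At.
rewrite (same_connected_component xz); exact: connected_component_max.
Qed.

Lemma reflect_flow0 b1 b2 z : reflect_flow b1 b2 0 z = z.
Proof. by rewrite /reflect_flow flow0 reflect_curveK. Qed.

Lemma reflect_flow_id b1 b2 s z : ~ removable b1 b2 c z -> reflect_flow b1 b2 s z = z.
Proof. by move=> h; rewrite /reflect_flow flow_id // reflect_curveK. Qed.

Lemma reflect_flow1 b1 b2 z : ~ removable b1 b2 c (reflect_flow b1 b2 1 z).
Proof. by rewrite /removable /reflect_flow reflect_curveK; exact: flow1. Qed.

(** Along a moving curve l keeps its sign or vanishes, so among the other three conditions only the
    one differing by both reflections could become true. It concerns the opposite vertex, which
    stays fixed. *)
Lemma reflect_flow_removable b1 b2 b1' b2' s z : 0 <= s <= 1 -> (b1, b2) != (b1', b2') ->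
  ~ removable b1' b2' c z -> ~ removable b1' b2' c (reflect_flow b1 b2 s z).
Proof.
move=> s01 bb nz; rewrite /reflect_flow.
set y := reflect_curve b1 b2 z.
have ez : z = reflect_curve b1 b2 y by rewrite /y reflect_curveK.
clearbody y; have [->|[y0 f0 fv]] := flow_vertex1 (reflect_coeff b1 b2 c) y s01.
  by rewrite -ez.
move: f0 fv; move: (flow _ s y) => f f0 fv.
move=> /removableE[l1 slow]; apply: nz; apply/removableE.
have moved u : b2' = ~~ b2 ->
    moved_vertex b2' (reflect_curve b1 b2 u) = reflect_plane b1 b2 (vertex1 u).
  by move=> ->; rewrite /moved_vertex vertex1_reflect vertex0_reflect; case: (b2).
have [e1 e2] : b1' = ~~ b1 /\ b2' = ~~ b2.
  move: bb l1; rewrite /reflect_curve /= => bb l1; move: bb l1.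
  case: (b1); case: (b2); case: (b1'); case: (b2') => //= _;
  rewrite ?expr0 ?expr1 => l1; exfalso; have := f0; lra.
rewrite ez !moved // fv in slow *; split=> //.
move: y0; rewrite /reflect_curve /= e1 e2; case: (b1); case: (b2);
  rewrite /= ?expr0 ?expr1; lra.
Qed.

Lemma reflect_flow_continuous (T : topologicalType) (f : T -> R) (g : T -> R * R * R) b1 b2 :
  continuous f -> continuous g -> continuous (fun x => reflect_flow b1 b2 (f x) (g x)).
Proof.
move=> cf cg; have cr := @reflect_curve_continuous R b1 b2.
apply: (cont_comp (f := fun x => flow (reflect_coeff b1 b2 c) (f x) (reflect_curve b1 b2 (g x))) cr).
apply: (cont_comp (f := fun x => (f x, reflect_curve b1 b2 (g x))) (@flow_continuous R _)).
by apply: cont_pair => //; apply: cont_comp.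
Qed.

(** [flow_Omega] is applied to the reflected polynomial, the reflected displacement and the preimage
    of [Omega]; conjugation brings the result back. *)
Lemma reflect_flow_Omega b1 b2 s z : 0 <= s <= 1 -> Omega z -> Omega (reflect_flow b1 b2 s z).
Proof.
move=> s01 Oz.
have cr := @reflect_curve_continuous R b1 b2.
have fits := smooth_fits smooth.
apply: (@flow_Omega R (reflect_coeff b1 b2 c) (reflect_plane b1 b2 (1, Num.sqrt 2))
  (reflect_curve b1 b2 @^-1` Omega)) => //.
- exact: generic_reflect.
- exact: reflect_fits.
- move=> y /class_tritangent h; rewrite -(@reflect_curveK R b1 b2 y).
  exact: (tritangent_reflect b1 b2 h).
- exact: ((continuous_closedP _).1 cr).
- move=> A cA At [y Ay Oy] u Au.
  apply: (class_connected (A := reflect_curve b1 b2 @` A)).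
  + by apply: connected_continuous_connected => //; apply: continuous_subspaceT.
  + move=> _ [x Ax <-].
    have := tritangent_reflect b1 b2 (At x Ax).
    by rewrite reflect_coeffK reflect_planeK.
  + by exists (reflect_curve b1 b2 y) => //; exists y.
  + by exists u.
- by rewrite /= reflect_curveK.
Qed.

(** Will turn out to be the support of the bounded subcomplex, described pointwise and independently
    of the polyhedral structure. *)
Definition core : set (R * R * R) :=
  [set z | Omega z /\ forall b1 b2, ~ removable b1 b2 c z].

Definition core_flow (s : R) z : R * R * R :=
  reflect_flow true false s (reflect_flow false true s
    (reflect_flow true true s (reflect_flow false false s z))).

Lemma core_flow_continuous : continuous (fun sz : R * (R * R * R) => core_flow sz.1 sz.2).
Proof. by rewrite /core_flow; do 4 (apply: reflect_flow_continuous; first by cont); cont. Qed.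

Lemma core_flow_Omega s z : 0 <= s <= 1 -> Omega z -> Omega (core_flow s z).
Proof. by move=> s01 Oz; rewrite /core_flow; do 4 apply: reflect_flow_Omega => //. Qed.

Lemma core_flow_id s z : core z -> core_flow s z = z.
Proof. by move=> [_ h]; rewrite /core_flow !reflect_flow_id. Qed.

Lemma core_flow1 z : Omega z -> core (core_flow 1 z).
Proof.
have i1 : 0 <= (1 : R) <= 1 by rewrite ler01 lexx.
move=> Oz; split; first exact: core_flow_Omega.
rewrite /core_flow; case; case.
- do 2 (apply: reflect_flow_removable => //); exact: reflect_flow1.
- exact: reflect_flow1.
- by apply: reflect_flow_removable => //; exact: reflect_flow1.
- do 3 (apply: reflect_flow_removable => //); exact: reflect_flow1.
Qed.

Lemma core_retract : strong_deformation_retract R Omega core.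
Proof.
split; first by move=> z [].
exists (fun sz => core_flow sz.1 sz.2); split.
- by apply: continuous_subspaceT; exact: core_flow_continuous.
- by move=> s z s01 Oz; exact: core_flow_Omega.
- by move=> z _; rewrite /core_flow /= !reflect_flow0.
- by move=> z Oz; exact: core_flow1.
- by move=> s z _ Cz; exact: core_flow_id.
Qed.

Lemma core_connected : connected core.
Proof.
have -> : core = core_flow 1 @` Omega.
  apply/seteqP; split=> [z Cz|_ [z Oz <-]]; last exact: core_flow1.
  by exists z; [case: Cz|exact: core_flow_id].
apply: connected_continuous_connected.
  by case: class_Omega => x _ <-; exact: component_connected.
apply: continuous_subspaceT.
by rewrite /core_flow; do 4 (apply: reflect_flow_continuous; first by cont); cont.
Qed.

Variable P : set (set (R * R * R)).
Hypotheses (complex_P : polyhedral_complex P) (support_P : complex_support P = Omega).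
Hypothesis compatible_P : compatible c P.

(** Compatibility leaves only the sign of l to be controlled. If it changed, the relative interior
    would also contain curves with l = 0 and with the opposite sign, against [no_sign_change]. *)
Lemma removable_cell b1 b2 (C : set (R * R * R)) z z' : P C -> rel_interior C z ->
  rel_interior C z' -> removable b1 b2 c z' -> removable b1 b2 c z.
Proof.
move=> PC rz rz' rem'; have [l' slow'] := rem'.
have fits := smooth_fits smooth.
have CO : C `<=` Omega by move=> y Cy; rewrite -support_P; exists C.
have same y : rel_interior C y -> forall i : bool,
    argmax (reflect_coeff b1 b2 c) ((if i then @vertex1 R else @vertex0 R) (reflect_curve b1 b2 y)) =
    argmax (reflect_coeff b1 b2 c) ((if i then @vertex1 R else @vertex0 R) (reflect_curve b1 b2 z')).
  move=> ry i; have [e0 e1] := compatible_P PC ry rz'.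
  apply/setP => a; case: i; rewrite ?vertex1_reflect ?vertex0_reflect !reflect_argmax.
    by case: (b2); rewrite ?e0 ?e1.
  by case: (b2); rewrite ?e0 ?e1.
split; last by have := same _ rz false; rewrite /vertex0 => ->.
have sgn y : (reflect_curve b1 b2 y).2 = (-1) ^+ b1 * (-1) ^+ b2 * y.2 by [].
have tri y : rel_interior C y -> tritangent_disp (reflect_plane b1 b2 (1, Num.sqrt 2))
    (corner_locus (reflect_coeff b1 b2 c)) (curve11 (reflect_curve b1 b2 y)).
  by move=> [/CO/class_tritangent h _]; exact: tritangent_reflect.
rewrite ltNge; apply/negP => lz.
have polyC : polyhedron C by case: complex_P => _ /(_ C PC)[].
have e2 : ((-1) ^+ b1 * (-1) ^+ b2) * ((-1) ^+ b1 * (-1) ^+ b2) = 1 :> R.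
  by case: (b1); case: (b2); rewrite ?expr0 ?expr1; ring.
set e : R := (-1) ^+ b1 * (-1) ^+ b2 in sgn e2; rewrite !sgn in l' lz.
have zz' : z.2 * z'.2 <= 0.
  by rewrite -[X in X <= 0]mul1r -e2 mulrACA mulr_le0_ge0 // ltW.
have z'0 : z'.2 != 0 by apply/eqP => h; rewrite h mulr0 ltxx in l'.
have [[x0 rx0 x00] [xm rxm xm0]] := rel_interior_sign polyC rz rz' zz' z'0.
apply: (@no_sign_change R (reflect_coeff b1 b2 c) (reflect_plane b1 b2 (1, Num.sqrt 2))
  (reflect_curve b1 b2 z') (reflect_curve b1 b2 x0) (reflect_curve b1 b2 xm)).
- exact: generic_reflect.
- rewrite (_ : reflect_plane true false _ = reflect_plane (~~ b1) b2 (1, Num.sqrt 2)).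
    exact: generic_reflect.
  by rewrite /reflect_plane /=; case: (b1); rewrite /= ?expr0 ?expr1; congr (_, _); ring.
- exact: reflect_fits.
- exact: tri.
- exact: tri.
- exact: rem'.
- by rewrite sgn x00 mulr0.
- rewrite sgn; have : (e * xm.2) * (e * z'.2) < 0 by rewrite mulrACA e2 mul1r.
  by rewrite pmulr_llt0.
- exact: (same _ rx0 false).
- exact: (same _ rx0 true).
- exact: (same _ rxm false).
- exact: (same _ rxm true).
Qed.

(** A removable point of a cell makes nearby points removable, among them relatively interior ones,
    so the cell is removed. Conversely, a core point is relatively interior to some cell, and
    [removable_cell] shows that this cell stays. *)
Lemma bounded_subcomplex_core : complex_support (bounded_subcomplex c P) = core.
Proof.
apply/seteqP; split=> [z [C [PC nC] Cz]|z [Oz nz]].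
  have CO : C `<=` Omega by move=> y Cy; rewrite -support_P; exists C.
  split=> [|b1 b2 rem]; first exact: CO.
  have polyC : polyhedron C by case: complex_P => _ /(_ C PC)[].
  have [y ry remy] := rel_interior_dense polyC Cz (near_removable rem).
  apply: nC; exists y => //; apply: removable_removed remy => //.
  by apply: class_tritangent; apply: CO; case: ry.
have [C PC Cz] : complex_support P z by rewrite support_P.
have [F PF rz] := rel_interior_cover complex_P PC Cz.
exists F; last by case: rz.
split=> // -[z' rz' /(removed_removable smooth)[b1 [b2 rem']]].
exact: (nz b1 b2 (removable_cell PF rz rz' rem')).
Qed.

End Retraction.

Theorem corollary4p7 (R : realType) (c : 'I_4 -> 'I_4 -> R)
    (Omega : set (R * R * R)) (P : set (set (R * R * R)))
    (smooth_c : smooth_curve c) (class_Omega : tritangent_class c Omega)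
    (complex_P : polyhedral_complex P) (support_P : complex_support P = Omega)
    (compatible_P : compatible c P) :
  strong_deformation_retract R Omega
    (complex_support (bounded_subcomplex c P)) /\
  connected (complex_support (bounded_subcomplex c P)).
Proof.
have closed_Omega : closed Omega by rewrite -support_P; exact: complex_support_closed.
rewrite (bounded_subcomplex_core smooth_c class_Omega complex_P support_P compatible_P).
split; first exact: core_retract.
exact: core_connected.
Qed.
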